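(* Let $m$ be a positive integer and let $j\in\{0,1,\ldots,m-1\}$. Then the natural density of the set of all positive integers $n$ such that $\Omega(n)\equiv j \pmod m$ exists and is equal to $1/m$; furthermore, there exists a real number $A>0$ such that, as $x\to\infty$, $$N_{m,j}(x):=\#\{n\leq x:\Omega(n)\equiv j \pmod m\}=\frac{x}{m}+O\left(\frac{x}{\log^A x}\right).$$
   Context: For a positive integer $n$, $\Omega(n)$ denotes the number of prime divisors of $n$ counted with multiplicity (so $\Omega(1)=0$). In the counting function, $n$ ranges over positive integers and $x$ is a real variable. The natural density of a set $S$ of positive integers is $\lim_{x\to\infty}\frac1x\#\{n\le x: n\in S\}$, when this limit exists. $\log^A x$ means $(\log x)^A$. The implied constant does not depend on $x$ (it may depend on $m$ and $j$). *)

(* Defs.v *)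
From HB Require Import structures.
From mathcomp Require Import all_boot all_order all_algebra.
From mathcomp Require Import finmap.
From mathcomp Require Import all_classical all_reals all_analysis.

Set Implicit Arguments.
Unset Strict Implicit.
Unset Printing Implicit Defensive.

Import Order.TTheory GRing.Theory Num.Theory.
Import numFieldNormedType.Exports.

Local Open Scope classical_set_scope.
Local Open Scope ring_scope.

(* Needed for the Landau notations at [+oo], which expect a [filter_on]. *)
Canonical pinfty_filter_on (R : numFieldType) : filter_on R :=
  FilterType (pinfty_nbhs R) filter_filter.

Definition prime_Omega (n : nat) : nat := (\sum_(p <- primes n) logn p n)%N.

Definition Omega_class (m j : nat) : set nat :=
  [set n | (prime_Omega n = j %[mod m])%N].

(* [fset_set] is the empty set on infinite sets; the set below is finite for
   every real [x]. *)
Definition count_le (R : realType) (S : set nat) (x : R) : nat :=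
  #|` fset_set [set n : nat | [/\ (0 < n)%N, n%:R <= x & S n]]|%fset.

Definition has_natural_density (R : realType) (S : set nat) (d : R) : Prop :=
  x^-1 * (count_le S x)%:R @[x --> +oo] --> d.

(* Main.v *)
Require Import Defs.
From HB Require Import structures.
From mathcomp Require Import all_boot all_order all_algebra.
From mathcomp Require Import finmap.
From mathcomp Require Import all_classical all_reals all_analysis.
From mathcomp Require Import complex ring lra zify.

Set Implicit Arguments.
Unset Strict Implicit.
Unset Printing Implicit Defensive.

Import Order.TTheory GRing.Theory Num.Theory.
Import numFieldNormedType.Exports.

Local Open Scope classical_set_scope.
Local Open Scope ring_scope.

Local Notation Re := complex.Re.
Local Notation Im := complex.Im.

(** The counting function is a sum over the [m]-th roots of unity [z]: the trivial root gives
    [x / m], and each [z != 1] contributes, up to a factor of modulus [1 / m], the sum up to [x] of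
    the completely multiplicative function [f n = z ^ Omega n]. Everything rests on
    [mean_value], which saves a power of [ln x] over the trivial bound [x] for these sums. The
    method is that of Halasz and Montgomery: it uses the behaviour of Dirichlet series only to
    the right of the line [Re s = 1], and no analytic continuation.

    Let [F] be the Dirichlet series of [f]. On the line [Re s = 1 + d] one has trivially
    [|F| <= zeta (1 + d)], of size [1 / d], and [sup_bound] improves this to a power
    [d ^ (A - 1)] times a slowly growing function of [t = Im s]. If [|F|] were
    almost maximal at [1 + d + i t], then [z * p ^ (- i t)] would be close to 1 for most primes
    [p]. Raising to the power [m] removes [z] and makes [p ^ (- i m t)] close to 1, which is
    only possible for [t] near 0, because [zeta] is of moderate size away from its pole
    ([sup_large]). But for [t] near 0, [p ^ (- i t)] is itself mostly close to 1, and
    [z * p ^ (- i t)] is then close to [z], away from 1 ([sup_small]). The comparison is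
    carried out factor by factor in finite Euler products.

    To use a bound for [F] on sums of [f], the sequence is weighted by [ln n], since
    [- F'] is [F] times [- F' / F], and the factor [- F' / F], a series over prime powers, is small
    in mean square by the large sieve ([weighted_large_sieve], [gram_mangoldt]), which needs no
    more than the Chebyshev bound on primes. A Plancherel inequality ([spectral_upper]) converts this
    into a bound for [energy], the mean square of the sums of [ln n * f n]. In order to
    stay with finite sums, the Fourier integral is replaced by a positive combination of cosines
    approximating [exp (- |v|)], and the series by partial sums so long that all
    truncation errors vanish.

    The mean square bound becomes a pointwise one because [log = Lambda * 1]: the sum of
    [ln n * f n] up to [x] is an average over prime powers [d] of the sums of [f] up to
    [x / d]. Since these sums are Lipschitz, it is bounded by their logarithmic average
    ([lnOmega_average]), which the energy controls ([psum_average]). *)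

(** * The modulus and the exponential on the complex plane *)

Section ComplexModulus.
Variable R : realType.
Local Notation C := R[i].
Implicit Types (z w : C) (x y t : R).

(** The modulus with values in [R]: the norm of [R[i]] takes complex values, which cannot
    be compared with real bounds. *)
Definition cabs z : R := Normc.normc z.
Definition rc x : C := real_complex R x.

Lemma cabsE z : (rc (cabs z)) = `|z| .
Proof. by case: z => a b; rewrite normc_def. Qed.

Lemma cabs_ge0 z : 0 <= cabs z.
Proof. by case: z => a b; rewrite /cabs /= sqrtr_ge0. Qed.

Lemma cabsM z w : cabs (z * w) = cabs z * cabs w.
Proof. exact: Normc.normcM. Qed.

Lemma cabs0 : cabs 0 = 0. Proof. exact: Normc.normc0. Qed.
Lemma cabs1 : cabs 1 = 1. Proof. exact: Normc.normc1. Qed.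
Lemma cabsN z : cabs (- z) = cabs z.
Proof. exact: normcN. Qed.

Lemma cabsX z n : cabs (z ^+ n) = cabs z ^+ n.
Proof. by elim: n => [|n IH]; rewrite ?expr0 ?cabs1// !exprS cabsM IH. Qed.

Lemma ler_cabsD z w : cabs (z + w) <= cabs z + cabs w.
Proof. exact: le_normcD. Qed.

Lemma ler_cabsB z w : cabs (z - w) <= cabs z + cabs w.
Proof. by rewrite -(cabsN w) ler_cabsD. Qed.

Lemma ler_cabs_sum (I : Type) (s : seq I) (P : pred I) (F : I -> C) :
  cabs (\sum_(i <- s | P i) F i) <= \sum_(i <- s | P i) cabs (F i).
Proof.
elim/big_rec2: _ => [|i y z _ yz]; first by rewrite cabs0.
by rewrite (le_trans (ler_cabsD _ _))// lerD2l.
Qed.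

Lemma cabs_prod (I : Type) (s : seq I) (P : pred I) (F : I -> C) :
  cabs (\prod_(i <- s | P i) F i) = \prod_(i <- s | P i) cabs (F i).
Proof.
elim/big_rec2: _ => [|i y z _ <-]; first by rewrite cabs1.
by rewrite cabsM.
Qed.

Lemma cabs_rc x : cabs (rc x) = `|x|.
Proof. by rewrite /cabs /= expr0n addr0 sqrtr_sqr. Qed.

Lemma rcB x y : rc (x - y) = rc x - rc y. Proof. exact: rmorphB. Qed.
Lemma rcM x y : rc (x * y) = rc x * rc y. Proof. exact: rmorphM. Qed.

Lemma cabs_sqr z : cabs z ^+ 2 = Re z ^+ 2 + Im z ^+ 2.
Proof. by case: z => a b; rewrite /cabs /= sqr_sqrtr// addr_ge0 ?sqr_ge0. Qed.

Lemma cabs_sqrE z : cabs z ^+ 2 = Re (z * z^*%C).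
Proof. by rewrite cabs_sqr; case: z => a b /=; rewrite mulrN opprK !expr2. Qed.

Lemma cabs_conj z : cabs (z^*%C) = cabs z.
Proof. by case: z => a b; rewrite /cabs /= sqrrN. Qed.

Lemma normr_Re_le_cabs z : `|Re z| <= cabs z.
Proof.
rewrite -(@ler_pXn2r _ 2) ?nnegrE ?cabs_ge0//.
by rewrite cabs_sqr real_normK ?num_real// lerDl sqr_ge0.
Qed.

Lemma Re_le_cabs z : Re z <= cabs z.
Proof. exact: le_trans (ler_norm _) (normr_Re_le_cabs z). Qed.

Lemma normr_Im_le_cabs z : `|Im z| <= cabs z.
Proof.
rewrite -(@ler_pXn2r _ 2) ?nnegrE ?cabs_ge0//.
by rewrite cabs_sqr real_normK ?num_real// lerDr sqr_ge0.
Qed.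

Lemma cabs_le_ReIm z : cabs z <= `|Re z| + `|Im z|.
Proof.
rewrite -(@ler_pXn2r _ 2) ?nnegrE ?cabs_ge0 ?addr_ge0//.
rewrite cabs_sqr sqrrD !real_normK ?num_real//.
by rewrite -addrA lerD2l lerDr mulrn_wge0// mulr_ge0.
Qed.

Lemma cabs_eq0 z : (cabs z == 0) = (z == 0).
Proof. by apply/eqP/eqP => [/Normc.eq0_normc//|->]; rewrite cabs0. Qed.

Lemma cabsV z : cabs z^-1 = (cabs z)^-1. Proof. exact: Normc.normcV. Qed.

Lemma Re_sum (I : Type) (s : seq I) (P : pred I) (F : I -> C) :
  Re (\sum_(i <- s | P i) F i) = \sum_(i <- s | P i) Re (F i).
Proof. by elim/big_rec2: _ => [//|i x z _ <-]; case: (F i) => a b; case: z. Qed.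

Lemma Re_mul_rc z x : Re (z * rc x) = Re z * x.
Proof. by case: z => a b /=; rewrite mulr0 subr0. Qed.

Definition cis t : C := Complex (cos t) (sin t).

Lemma cabs_cis t : cabs (cis t) = 1.
Proof. by rewrite /cabs /= cos2Dsin2 sqrtr1. Qed.

Lemma cis0 : cis 0 = 1. Proof. by rewrite /cis cos0 sin0. Qed.

Lemma cisD t u : cis (t + u) = cis t * cis u.
Proof. by rewrite /cis cosD sinD; simpc; congr Complex; rewrite addrC. Qed.

Lemma cisN t : cis (- t) = (cis t)^*%C.
Proof. by rewrite /cis cosN sinN. Qed.

Lemma cisX t n : cis t ^+ n = cis (t *+ n).
Proof. by elim: n => [|n IH]; rewrite ?mulr0n ?cis0// exprS IH -cisD mulrS. Qed.

(** Lets a lower bound for [1 - Re z] be read as a distance, to which the triangle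
    inequality applies. *)
Lemma cabs_1B_sqr z : cabs z = 1 -> cabs (1 - z) ^+ 2 = 2 * (1 - Re z).
Proof.
move=> z1; have := cabs_sqr z; rewrite z1 cabs_sqr; case: z {z1} => a b /=.
rewrite expr1n => h.
have -> : (1 - a) ^+ 2 + (0 - b) ^+ 2 = 1 - 2 * a + (a ^+ 2 + b ^+ 2) by ring.
by rewrite -h; ring.
Qed.

Lemma mvt_le (f df : R -> R) x y :
  (forall u : R, is_derive u 1 f (df u)) ->
  (forall u, x <= u <= y -> 0 <= df u) -> x <= y -> f x <= f y.
Proof.
move=> fd df0 xy; rewrite le_eqVlt in xy; case/orP: xy => [/eqP->//|xy].
have [//|c cI] := @MVT R f df x y xy (fun u _ => fd u).
  by apply: derivable_within_continuous => u _.
move=> e; rewrite -subr_ge0 e mulr_ge0 ?subr_ge0 ?(ltW xy)// df0//.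
by move: cI; rewrite in_itv/= => /andP[/ltW-> /ltW->].
Qed.

Lemma sin_le_id x : 0 <= x -> sin x <= x.
Proof.
move=> x0; rewrite -subr_ge0 -[leLHS](subrr 0) -{2}(@sin0 R).
apply: (@mvt_le (fun u => u - sin u) (fun u => 1 - cos u)) => // u _.
Qed.

Lemma normr_sin_le x : `|sin x| <= `|x|.
Proof.
wlog x0 : x / 0 <= x.
  move=> h; have [/h//|/ltW x0] := leP 0 x.
  by rewrite -[leRHS]normrN -[leLHS]normrN -sinN; apply: h; rewrite oppr_ge0.
rewrite (ger0_norm x0) ler_norml sin_le_id// andbT.
have [x1|x1] := leP x 1.
  rewrite (@le_trans _ _ 0) ?oppr_le0// sin_ge0_pi// x0/= (le_trans x1)//.
  by rewrite (le_trans _ (pi_ge2 R))// ler1n.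
by rewrite (le_trans _ (sin_geN1 x))// lerN2 ltW.
Qed.

Lemma cos_ge_quad x : 1 - cos x <= x ^+ 2 / 2.
Proof.
wlog x0 : x / 0 <= x.
  move=> h; have [/h//|/ltW x0] := leP 0 x.
  by rewrite -cosN -sqrrN; apply: h; rewrite oppr_ge0.
have := @mvt_le (fun u => u ^+ 2 / 2 + cos u) (fun u => u - sin u) 0 x.
rewrite cos0 expr0n/= mul0r add0r lerBlDr; apply=> // u; last first.
  by move=> /andP[u0 _]; rewrite subr_ge0 sin_le_id.
by apply: is_derive_eq; rewrite /GRing.scale/=; field.
Qed.

Lemma sin_ge_quad x : 0 <= x -> x - sin x <= x ^+ 2 / 2.
Proof.
move=> x0.
have := @mvt_le (fun u => u ^+ 2 / 2 - u + sin u) (fun u => u - 1 + cos u) 0 x.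
rewrite sin0 expr0n/= mul0r subr0 add0r => h.
rewrite -subr_ge0 opprB addrA; rewrite addrAC; apply: h => // u.
  by apply: is_derive_eq; rewrite /GRing.scale/=; field.
move=> /andP[u0 _]; have := cos_ge_quad u; have := cos_geN1 u.
have [u2|u2] := leP u 2; last by lra.
move=> _ h2; have : u ^+ 2 / 2 <= u by nra.
lra.
Qed.

Lemma normr_sinB_le x : `|x - sin x| <= x ^+ 2 / 2.
Proof.
wlog x0 : x / 0 <= x.
  move=> h; have [/h//|/ltW x0] := leP 0 x.
  by rewrite -normrN opprD -sinN -sqrrN; apply: h; rewrite oppr_ge0.
by rewrite ger0_norm ?sin_ge_quad// subr_ge0 sin_le_id.
Qed.

Lemma expRN_quad x : 0 <= x -> `|1 - x - expR (- x)| <= x ^+ 2.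
Proof.
move=> x0; have h := expR_ge1Dx (- x).
rewrite ler0_norm; last by move: h; lra.
have e : expR (- x) <= (1 + x)^-1.
  by rewrite expRN lef_pV2 ?posrE ?expR_gt0 ?expR_ge1Dx//; lra.
suff : (1 + x)^-1 <= 1 - x + x ^+ 2 by move: e; lra.
rewrite -[leLHS]mul1r ler_pdivrMr; last lra.
have -> : (1 - x + x ^+ 2) * (1 + x) = 1 + x ^+ 3 by ring.
by rewrite lerDl exprn_ge0.
Qed.

(** Second order Taylor estimate of [1 - exp (- (a + i b))], with a bound that does not
    degrade when [b] is large. *)
Lemma cexp_quad a b : 0 <= a ->
  cabs (1 - rc (expR (- a)) * cis (- b) - Complex a b) <= 2 * (a ^+ 2 + b ^+ 2).
Proof.
move=> a0; apply: (le_trans (cabs_le_ReIm _)) => /=.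
rewrite cosN sinN !mul0r subr0 addr0.
have e0 := expR_gt0 (- a).
have e1 : expR (- a) <= 1 by rewrite expR_le1 oppr_le0.
have ea : 1 - a <= expR (- a) by rewrite expR_ge1Dx.
have h1 := expRN_quad a0.
have h2 := cos_ge_quad b.
have h3 := normr_sinB_le b.
have h4 := normr_sin_le b.
have c1 := cos_le1 b.
have -> : 1 - expR (- a) * cos b - a =
  (1 - a - expR (- a)) + expR (- a) * (1 - cos b) by ring.
have -> : 0 - expR (- a) * - sin b - b =
  - (b - sin b) - (1 - expR (- a)) * sin b by ring.
have k1 : `|expR (- a) * (1 - cos b)| <= b ^+ 2 / 2.
  rewrite ger0_norm; last by rewrite mulr_ge0 ?(ltW e0)// subr_ge0.
  by rewrite (le_trans _ h2)// ler_piMl// subr_ge0.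
have k2 : `|(1 - expR (- a)) * sin b| <= (a ^+ 2 + b ^+ 2) / 2.
  rewrite normrM (@le_trans _ _ (a * `|b|))//.
    by rewrite ler_pM// ger0_norm; lra.
  have := sqr_ge0 (a - `|b|); have := real_normK (num_real b).
  by move: (`|b|) => bb <-; nra.
have t1 := ler_normD (1 - a - expR (- a)) (expR (- a) * (1 - cos b)).
have t2 := ler_normD (- (b - sin b)) (- ((1 - expR (- a)) * sin b)).
rewrite !normrN in t2.
have := sqr_ge0 a; have := sqr_ge0 b.
by move: t1 t2 k1 k2 h1 h3; rewrite -?mulNr; lra.
Qed.

(** The factor 1/4 is far from optimal: it is what the parabola [x - x ^+ 2 / 2] gives
    below 1, followed by monotonicity up to [pi / 2]. *)
Lemma sin_ge_lin x : 0 <= x -> x <= pi / 2 -> x / 4 <= sin x.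
Proof.
move=> x0 xpi; have := sin_ge_quad x0.
have [x1|x1] := leP x 1; first by nra.
have p2 := @pihalf_lt2 R.
have : sin 1 <= sin x.
  have := @ltr_sin R; rewrite /= => h.
  rewrite leNgt h ?in_itv/= -?leNgt ?(ltW x1)//; apply/andP; split; lra.
have := @sin_ge_quad 1 ler01; rewrite expr1n; lra.
Qed.

Lemma cabs_1B_cis_sqr t : cabs (1 - cis t) ^+ 2 = 2 * (1 - cos t).
Proof. by rewrite cabs_1B_sqr ?cabs_cis. Qed.

Lemma cabs_1B_cis_ge t : `|t| <= pi -> `|t| / 4 <= cabs (1 - cis t).
Proof.
move=> tpi; rewrite -(@ler_pXn2r _ 2) ?nnegrE ?cabs_ge0 ?divr_ge0//.
rewrite cabs_1B_cis_sqr -cos_norm.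
have -> : cos `|t| = 1 - 2 * sin (`|t| / 2) ^+ 2.
  have {1}-> : `|t| = (`|t| / 2) *+ 2 by rewrite mulr2n -splitr.
  by rewrite cos_mulr2n cos2sin2 mulr2n; ring.
have h : `|t| / 2 / 4 <= sin (`|t| / 2) by apply: sin_ge_lin => //; lra.
have {}h : (`|t| / 2 / 4) ^+ 2 <= sin (`|t| / 2) ^+ 2.
  by rewrite ler_pXn2r// nnegrE ?divr_ge0//; apply: le_trans h; rewrite !divr_ge0.
by move: h; move: (sin _ ^+ 2) => s; rewrite !expr2; lra.
Qed.

Lemma cabs_1B_cis_le t : cabs (1 - cis t) <= `|t|.
Proof.
rewrite -(@ler_pXn2r _ 2) ?nnegrE ?cabs_ge0// cabs_1B_cis_sqr.
by rewrite real_normK ?num_real//; have := cos_ge_quad t; lra.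
Qed.

End ComplexModulus.

(** * Arithmetic of Omega and of the von Mangoldt function *)

Section MultiplesSum.
Variables (V : zmodType) (F : nat -> V) (d : nat).
Hypothesis d_gt0 : (0 < d)%N.

Lemma sum_multiples N :
  \sum_(1 <= k < N.+1 | (d %| k)%N) F k = \sum_(1 <= e < (N %/ d).+1) F (d * e)%N.
Proof.
elim: N => [|N IH]; first by rewrite div0n !big_geq.
rewrite big_mkcond big_nat_recr//= -big_mkcond/= IH divnS//.
case: ifPn => dN; last by rewrite add0n addr0.
rewrite add1n [in RHS]big_nat_recr//=; congr (_ + F _).
by have := divnS N d_gt0; rewrite dN add1n => <-; rewrite mulnC divnK.
Qed.

End MultiplesSum.

Section OmegaAdditive.

(** Summing over a common range of indices, where [logn] vanishes off the primes, makes
    additivity termwise. *)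
Lemma prime_OmegaE (N n : nat) : (0 < n <= N)%N ->
  prime_Omega n = (\sum_(0 <= p < N.+1) logn p n)%N.
Proof.
move=> /andP[n0 nN]; rewrite /prime_Omega.
have pe : perm_eq (primes n) [seq p <- index_iota 0 N.+1 | p \in primes n].
  apply: uniq_perm; rewrite ?primes_uniq ?filter_uniq ?iota_uniq// => p.
  rewrite mem_filter mem_index_iota/=; case: (boolP (p \in primes n)) => //= pn.
  by rewrite ltnS (leq_trans _ nN)// dvdn_leq//; move: pn; rewrite mem_primes => /and3P[].
rewrite (perm_big _ pe) big_filter big_mkcond; apply: eq_bigr => p _.
case: ifPn => //; rewrite -logn_gt0 lt0n negbK => /eqP->//.
Qed.

Lemma prime_OmegaM (a b : nat) : (0 < a)%N -> (0 < b)%N ->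
  prime_Omega (a * b) = (prime_Omega a + prime_Omega b)%N.
Proof.
move=> a0 b0; have ab0 : (0 < a * b)%N by rewrite muln_gt0 a0.
rewrite (@prime_OmegaE (a * b)) ?ab0 ?leqnn//.
rewrite (@prime_OmegaE (a * b) a) ?a0 ?leq_pmulr//.
rewrite (@prime_OmegaE (a * b) b) ?b0 ?leq_pmull// -big_split/=.
by apply: eq_bigr => p _; rewrite lognM.
Qed.

Lemma prime_Omega1 : prime_Omega 1 = 0%N.
Proof. by rewrite /prime_Omega big_nil. Qed.

Lemma prime_Omega_prime p : prime p -> prime_Omega p = 1%N.
Proof. by move=> pp; rewrite /prime_Omega primes_prime// big_seq1 logn_prime// eqxx. Qed.

End OmegaAdditive.

Section VonMangoldt.
Variable R : realType.
Local Notation C := R[i].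

(** A double sum over prime powers, so that divisor sums can be computed by exchanging
    sums; at most one term is nonzero. *)
Definition vonMangoldt (n : nat) : R :=
  \sum_(0 <= p < n.+1 | prime p) \sum_(0 <= k < n.+1)
    (if (p ^ k.+1 == n)%N then ln p%:R else 0).

Lemma ln_nat_ge0 (n : nat) : 0 <= ln (n%:R : R).
Proof.
case: n => [|n]; last by rewrite ln_ge0// ler1n.
by rewrite ln0.
Qed.

Lemma vonMangoldt_ge0 n : 0 <= vonMangoldt n.
Proof.
apply: sumr_ge0 => p _; apply: sumr_ge0 => k _; case: ifP => // _.
exact: ln_nat_ge0.
Qed.

Lemma sum_nat_widen (F : nat -> R) (P : pred nat) (n N : nat) : (n <= N)%N ->
  (forall i, (n <= i)%N -> F i = 0) ->
  \sum_(0 <= i < N | P i) F i = \sum_(0 <= i < n | P i) F i.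
Proof.
move=> nN F0; rewrite (@big_cat_nat _ _ _ n)//= [X in _ + X]big_nat_cond.
by rewrite [X in _ + X]big1 ?addr0// => i /andP[/andP[ni _] _]; rewrite F0.
Qed.

Lemma vonMangoldt_widen N n : (n <= N)%N -> vonMangoldt n =
  \sum_(0 <= p < N.+1 | prime p) \sum_(0 <= k < N.+1)
    (if (p ^ k.+1 == n)%N then ln p%:R else 0).
Proof.
move=> nN; rewrite (@sum_nat_widen _ _ n.+1)// => [|p np]; last first.
  rewrite big1// => k _; case: eqP => // e; suff : (p <= n)%N by lia.
  by rewrite -e expnS leq_pmulr// expn_gt0 (leq_ltn_trans (leq0n n) np).
rewrite /vonMangoldt; apply: eq_bigr => p pp.
rewrite [RHS](@sum_nat_widen _ _ n.+1)// => k nk; case: eqP => // e.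
have := ltn_expl k.+1 (prime_gt1 pp); lia.
Qed.

Lemma ln_prod (F : nat -> R) (n : nat) : (forall i, 0 < F i) ->
  ln (\prod_(0 <= i < n) F i) = \sum_(0 <= i < n) ln (F i).
Proof.
move=> F0; elim: n => [|n IH]; first by rewrite !big_geq// ln1.
by rewrite !big_nat_recr//= lnM ?IH// posrE// prodr_gt0.
Qed.

Lemma ln_nat_logn N n : (0 < n <= N)%N ->
  ln (n%:R : R) = \sum_(0 <= p < N.+1 | prime p) (logn p n)%:R * ln p%:R.
Proof.
move=> /andP[n0 nN]; rewrite -{1}(partnT n0) (widen_partn _ nN) natr_prod.
rewrite ln_prod => [|p]; last first.
  rewrite ltr0n; case: p => [|p]; last by rewrite expn_gt0.
  by rewrite lognE.
rewrite [RHS]big_mkcond/=; apply: eq_bigr => p _.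
case: ifPn => pp; last by rewrite lognE (negbTE pp) expn0 ln1.
by rewrite natrX lnXn ?ltr0n ?prime_gt0// mulr_natl.
Qed.

Lemma sum_bool_lt (m N : nat) : (m <= N)%N ->
  \sum_(0 <= k < N) (k < m)%N%:R = m%:R :> R.
Proof.
move=> mN; rewrite (@sum_nat_widen _ _ m)// => [|i mi]; last by rewrite ltnNge mi.
rewrite (eq_big_nat _ _ (F2 := fun=> 1)) => [|i /andP[_ ->]//].
by rewrite big_const_nat subn0 iter_addr_0.
Qed.

(** The identity [Lambda * 1 = log]: a prime [p] contributes [ln p] once for each [k] with
    [p ^ k.+1 %| n]. *)
Lemma sum_vonMangoldt_dvd N n : (0 < n <= N)%N ->
  \sum_(1 <= d < N.+1 | (d %| n)%N) vonMangoldt d = ln n%:R.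
Proof.
move=> /andP[n0 nN]; rewrite (@ln_nat_logn N) ?n0//.
rewrite big_nat_cond.
rewrite (eq_bigr (fun d => \sum_(0 <= p < N.+1 | prime p) \sum_(0 <= k < N.+1)
    (if (p ^ k.+1 == d)%N then ln p%:R else 0))); last first.
  by move=> d /andP[/andP[_ dN] _]; rewrite (@vonMangoldt_widen N).
rewrite -big_nat_cond exchange_big/=; apply: eq_bigr => p pp.
rewrite exchange_big/= -(@sum_bool_lt (logn p n) N.+1); last first.
  have := ltn_expl (logn p n) (prime_gt1 pp).
  have : (p ^ logn p n <= n)%N by rewrite dvdn_leq// pfactor_dvdnn.
  lia.
rewrite mulr_suml; apply: eq_bigr => k _.
have -> : (k < logn p n)%N = (p ^ k.+1 %| n)%N by rewrite pfactor_dvdn.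
case: (boolP (p ^ k.+1 %| n)%N) => pn; last first.
  rewrite mul0r big1// => d dn; case: eqP => // e; first by move: pn; rewrite e dn.
rewrite mul1r big_mkcond/= (big_rem (p ^ k.+1)%N)/=; last first.
  rewrite mem_index_iota expn_gt0 prime_gt0//= ltnS.
  by rewrite (leq_trans _ nN)// dvdn_leq.
rewrite pn eqxx big_seq_cond big1 ?addr0// => d /andP[+ _].
rewrite mem_rem_uniq ?iota_uniq// inE => /andP[/negbTE].
by rewrite eq_sym => ->; case: ifP.
Qed.

(** Complete multiplicativity on the positive integers. *)
Definition cmul (h : nat -> C) :=
  h 1%N = 1 /\ forall a b, (0 < a)%N -> (0 < b)%N -> h (a * b)%N = h a * h b.

(** [log = Lambda * 1] multiplied by a completely multiplicative function; for
    [h n = f n * n ^- s] this is [- F' = F * (- F' / F)], for [h = f] it expresses the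
    logarithmic summatory function through values of the plain one. *)
Lemma sum_ln_convolution (h : nat -> C) N : cmul h ->
  \sum_(1 <= k < N.+1) rc (ln k%:R) * h k =
  \sum_(1 <= d < N.+1) rc (vonMangoldt d) * h d * \sum_(1 <= e < (N %/ d).+1) h e.
Proof.
move=> [_ hM].
rewrite big_nat (eq_bigr (fun k => \sum_(1 <= d < N.+1)
   (if (d %| k)%N then rc (vonMangoldt d) * h k else 0))); last first.
  move=> k /andP[k0 kN]; rewrite -(@sum_vonMangoldt_dvd N) ?k0// -big_mkcond/=.
  by rewrite /rc rmorph_sum mulr_suml.
rewrite -big_nat exchange_big/= !big_nat; apply: eq_bigr => d /andP[d0 dN].
rewrite -big_mkcond/= -big_distrr/= sum_multiples// -mulrA; congr (_ * _).
rewrite mulr_sumr !big_nat; apply: eq_bigr => e /andP[e0 _].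
exact: hM.
Qed.

Lemma sum_ln_floor N :
  \sum_(1 <= k < N.+1) ln k%:R = \sum_(1 <= d < N.+1) vonMangoldt d * (N %/ d)%:R.
Proof.
rewrite big_nat (eq_bigr (fun k => \sum_(1 <= d < N.+1)
   (if (d %| k)%N then vonMangoldt d else 0))); last first.
  by move=> k /andP[k0 kN]; rewrite -(@sum_vonMangoldt_dvd N) ?k0// -big_mkcond/=.
rewrite -big_nat exchange_big/= !big_nat; apply: eq_bigr => d /andP[d0 dN].
rewrite -big_mkcond/= sum_multiples// big_const_nat iter_addr_0 subSS subn0.
by rewrite mulr_natr.
Qed.

Definition psi (n : nat) : R := \sum_(1 <= d < n.+1) vonMangoldt d.

Lemma psi_mono m n : (m <= n)%N -> psi m <= psi n.
Proof.
move=> mn; rewrite /psi (@big_cat_nat _ _ _ m.+1 1 n.+1)//= lerDl.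
by apply: sumr_ge0 => d _; exact: vonMangoldt_ge0.
Qed.

Lemma ln_fact n : ln (n`!%:R : R) = \sum_(1 <= k < n.+1) ln k%:R.
Proof.
elim: n => [|n IH]; first by rewrite big_geq// ln1.
rewrite [RHS]big_nat_recr//= -IH factS natrM lnM ?posrE ?ltr0n ?fact_gt0//.
by rewrite addrC.
Qed.

(** Chebyshev: [ln 'C(2n, n)] is the sum over [d] of
    [Lambda d * ((2n %/ d) - 2 * (n %/ d))], whose coefficients are nonnegative and equal
    to 1 for [n < d <= 2n]. *)
Lemma psi_double n : psi (2 * n) <= psi n + (2 * n)%:R.
Proof.
have h1 : ln ('C(2 * n, n)%:R : R) <= (2 * n)%:R.
  have h2 : ('C(2 * n, n) <= 2 ^ (2 * n))%N.
    have -> : (2 ^ (2 * n) = (1 + 1) ^ (2 * n))%N by [].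
    rewrite expnDn.
    rewrite (bigD1 (inord n))//= inordK ?ltnS; last by rewrite leq_pmull.
    by rewrite !exp1n !muln1 leq_addr.
  rewrite (@le_trans _ _ (ln ((2 ^ (2 * n))%:R)))//.
    by rewrite ler_ln ?posrE ?ltr0n ?bin_gt0 ?expn_gt0 ?leq_pmull// ler_nat.
  rewrite natrX lnXn// -[leLHS]mulr_natl ler_piMr//.
  by have := @le_ln1Dx R 1; apply; rewrite (@lt_trans _ _ 0).
have e : ln ('C(2 * n, n)%:R : R) = ln ((2 * n)`!%:R) - 2 * ln (n`!%:R).
  have <- : ('C(2 * n, n) * (n`! * (2 * n - n)`!))%N = (2 * n)`!.
    by rewrite bin_fact// leq_pmull.
  have -> : (2 * n - n = n)%N by lia.
  rewrite !natrM !lnM ?posrE ?mulr_gt0 ?ltr0n ?fact_gt0 ?bin_gt0 ?leq_pmull//.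
  ring.
rewrite -lerBlDl (le_trans _ h1)// e !ln_fact !sum_ln_floor.
have -> : \sum_(1 <= d < n.+1) vonMangoldt d * (n %/ d)%:R =
  \sum_(1 <= d < (2 * n).+1) vonMangoldt d * (n %/ d)%:R.
  rewrite [RHS](@big_cat_nat _ _ _ n.+1)//=; last by lia.
  rewrite [X in _ = _ + X]big_nat [X in _ = _ + X]big1 ?addr0// => d /andP[nd _].
  by rewrite divn_small ?mulr0.
rewrite mulr_sumr -sumrB {1}/psi (@big_cat_nat _ _ _ n.+1 1 (2 * n).+1)//=; last by lia.
rewrite addrAC subrr add0r (@big_cat_nat _ _ _ n.+1 1 (2 * n).+1)//=; last by lia.
have tm d : vonMangoldt d * (2 * n %/ d)%:R - 2 * (vonMangoldt d * (n %/ d)%:R) =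
   vonMangoldt d * ((2 * n %/ d) - 2 * (n %/ d))%:R.
  have h : (2 * (n %/ d) <= (2 * n) %/ d)%N.
    case: d => [|d]; first by rewrite !divn0.
    by rewrite leq_divRL// -mulnA leq_mul2l leq_divM orbT.
  by rewrite natrB// natrM; ring.
rewrite -[leLHS]add0r lerD//.
  by apply: sumr_ge0 => d _; rewrite tm mulr_ge0// vonMangoldt_ge0.
rewrite !big_nat; apply: ler_sum => d /andP[nd dn].
rewrite tm ler_peMr ?vonMangoldt_ge0// ler1n.
rewrite (@divn_small n d)// muln0 subn0 divn_gt0//; lia.
Qed.

(** Doubling gives the bound along powers of 2; rounding up to the next power costs the
    second factor 2. *)
Lemma psi_le n : psi n <= 4 * n%:R.
Proof.
have h k : psi (2 ^ k) <= 2 * (2 ^ k)%:R.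
  elim: k => [|k IH].
    rewrite expn0 /psi big_nat1 /vonMangoldt big1 ?mulr1// => p pp.
    rewrite big1// => i _; case: eqP => // e.
    by have := ltn_expl i.+1 (prime_gt1 pp); lia.
  rewrite expnS (le_trans (psi_double _))// natrM.
  by move: IH; set t := (2 ^ k)%:R; lra.
case: n => [|n]; first by rewrite /psi big_geq// mulr0.
have /andP[h1 h2] := trunc_log_bounds (isT : 1 < 2)%N (ltn0Sn n).
rewrite (le_trans (psi_mono (ltnW h2)))// (le_trans (h _))//.
have : ((2 ^ (trunc_log 2 n.+1).+1)%:R : R) <= (2 * n.+1)%:R.
  by rewrite ler_nat expnS leq_mul2l.
rewrite natrM; lra.
Qed.

Lemma ln_fact_le n : ln (n`!%:R : R) <= n%:R * ln n%:R.
Proof.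
rewrite ln_fact big_nat (@le_trans _ _ (\sum_(1 <= k < n.+1) ln n%:R))//.
  rewrite [leRHS]big_nat; apply: ler_sum => k /andP[k0 kn].
  by rewrite ler_ln ?posrE ?ltr0n ?ler_nat//; lia.
by rewrite big_const_nat iter_addr_0 subSS subn0 mulr_natl.
Qed.

Lemma ln_fact_ge n : n%:R * ln n%:R - n%:R <= ln (n`!%:R : R).
Proof.
case: n => [|n]; first by rewrite mul0r subr0 fact0 ln1.
have h : (n.+1%:R : R) ^+ n.+1 <= expR n.+1%:R * n.+1`!%:R.
  have := @expR_ge1Dxn R n.+1%:R n (ler0n _ _).
  move=> h; rewrite -ler_pdivrMr ?ltr0n ?fact_gt0//.
  by rewrite (le_trans _ h)// lerDr.
rewrite lerBlDr -[X in _ <= _ + X]expRK -lnM ?posrE ?expR_gt0 ?ltr0n ?fact_gt0//.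
rewrite mulr_natl -lnXn ?ltr0n// ler_ln ?posrE ?exprn_gt0 ?mulr_gt0 ?expR_gt0 ?ltr0n ?fact_gt0//.
by rewrite mulrC.
Qed.

(** The upper half of the first theorem of Mertens, from [ln n`!] and the Chebyshev bound
    for the rounding errors. *)
Lemma sum_vonMangoldt_div n : (0 < n)%N ->
  \sum_(1 <= d < n.+1) vonMangoldt d / d%:R <= ln n%:R + 4.
Proof.
move=> n0; have n0' : 0 < n%:R :> R by rewrite ltr0n.
rewrite -(ler_pM2l n0') mulrDr mulr_sumr.
have h1 := ln_fact_le n; rewrite ln_fact sum_ln_floor in h1.
have h2 := psi_le n.
apply: (@le_trans _ _ (\sum_(1 <= d < n.+1) (vonMangoldt d * (n %/ d)%:R + vonMangoldt d))).
  rewrite big_nat [leRHS]big_nat; apply: ler_sum => d /andP[d0 dn].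
  rewrite mulrCA -[X in _ <= _ + X]mulr1 -mulrDr ler_wpM2l ?vonMangoldt_ge0//.
  rewrite ler_pdivrMr ?ltr0n// natr1 -natrM ler_nat.
  by rewrite ltnW// ltn_ceil.
by rewrite big_split/= -/(psi n); lra.
Qed.

End VonMangoldt.

(** * Sums of negative powers *)

Section NegativePowers.
Variable R : realType.
Implicit Types (s d e : R) (n k : nat).

(** The power [n ^ (- s)]. *)
Definition npow s n : R := expR (- (s * ln n%:R)).

Lemma npow_gt0 s n : 0 < npow s n. Proof. exact: expR_gt0. Qed.
Lemma npow_ge0 s n : 0 <= npow s n. Proof. exact: expR_ge0. Qed.
Hint Resolve npow_ge0 : core.

Lemma npow1 s : npow s 1 = 1.
Proof. by rewrite /npow ln1 mulr0 oppr0 expR0. Qed.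

Lemma npowM s a b : (0 < a)%N -> (0 < b)%N -> npow s (a * b) = npow s a * npow s b.
Proof. by move=> a0 b0; rewrite /npow natrM lnM ?posrE ?ltr0n// mulrDr opprD expRD. Qed.

Lemma npowD s d n : npow (s + d) n = npow s n * npow d n.
Proof. by rewrite /npow mulrDl opprD expRD. Qed.

Lemma npow_one n : (0 < n)%N -> npow 1 n = n%:R^-1.
Proof. by move=> n0; rewrite /npow mul1r expRN lnK ?posrE ?ltr0n. Qed.

Lemma npow_anti s a b : 0 <= s -> (0 < a)%N -> (a <= b)%N -> npow s b <= npow s a.
Proof.
move=> s0 a0 ab; rewrite ler_expR lerN2 ler_wpM2l// ler_ln ?posrE ?ltr0n ?ler_nat//.
by rewrite (leq_trans a0).
Qed.

Lemma npow_le1 s n : 0 <= s -> npow s n <= 1.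
Proof. by move=> s0; rewrite expR_le1 oppr_le0 mulr_ge0// ln_nat_ge0. Qed.

Lemma ln_succB_ge k : (0 < k)%N -> k.+1%:R^-1 <= ln (k.+1%:R : R) - ln k%:R.
Proof.
move=> k0; have k0' : 0 < k%:R :> R by rewrite ltr0n.
have k1 : 0 < k.+1%:R :> R by rewrite ltr0n.
have := @le_ln1Dx R (- k.+1%:R^-1).
have -> : 1 + - k.+1%:R^-1 = k%:R / k.+1%:R :> R.
  by rewrite -[k%:R](addrK 1) natr1 mulrBl mulfV ?gt_eqF// mul1r.
rewrite ln_div ?posrE// => h; rewrite -lerN2 opprB h// ltrN2 invf_lt1// ltr1n.
by rewrite ltnS.
Qed.

Lemma ln_succB_le k : (0 < k)%N -> ln (k.+1%:R : R) - ln k%:R <= k%:R^-1.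
Proof.
move=> k0; have k0' : 0 < k%:R :> R by rewrite ltr0n.
rewrite -ln_div ?posrE ?ltr0n// -natr1 mulrDl mulfV ?gt_eqF// mul1r.
by rewrite le_ln1Dx// (@lt_trans _ _ 0)// invr_gt0.
Qed.

(** Integral test for [k ^ (- 1 - d)] in telescoped form. *)
Lemma npow_telescope d k : 0 < d -> (0 < k)%N ->
  npow (1 + d) k.+1 <= (npow d k - npow d k.+1) / d.
Proof.
move=> d0 k0; rewrite ler_pdivlMr// npowD npow_one//.
have -> : npow d k = npow d k.+1 * expR (d * (ln k.+1%:R - ln k%:R)).
  by rewrite /npow -expRD; congr expR; ring.
rewrite -[X in _ - X]mulr1 -mulrBr mulrAC mulrC ler_wpM2l// lerBrDl.
apply: le_trans (expR_ge1Dx _); rewrite lerD2l mulrC ler_wpM2l ?(ltW d0)//.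
exact: ln_succB_ge.
Qed.

Lemma sum_npow_tail d M N : 0 < d -> (0 < M)%N ->
  \sum_(M.+1 <= k < N.+1) npow (1 + d) k <= npow d M / d.
Proof.
move=> d0 M0; have [NM|MN] := leqP N M.
  by rewrite big_geq ?ltnS// divr_ge0// ltW.
rewrite big_add1/= (@le_trans _ _ (\sum_(M <= k < N) ((- npow d k.+1 / d) - (- npow d k / d))))//.
  rewrite big_nat [leRHS]big_nat; apply: ler_sum => k /andP[Mk _].
  rewrite (le_trans (npow_telescope d0 _))// ?(leq_trans M0)//.
  by rewrite -mulrBl opprK [- _ + _]addrC.
rewrite (telescope_sumr (fun k => - npow d k / d)) ?(ltnW MN)// !mulNr opprK.
by rewrite addrC gerBl divr_ge0// ltW.
Qed.

Lemma sum_npow_le d N : 0 < d -> \sum_(1 <= k < N.+1) npow (1 + d) k <= 1 + d^-1.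
Proof.
move=> d0; case: N => [|N]; first by rewrite big_geq// addr_ge0// invr_ge0 ltW.
rewrite big_ltn// npow1 lerD2l (le_trans (sum_npow_tail _ d0 _))//.
by rewrite npow1 mul1r.
Qed.

Lemma npow_small d e : 0 < d -> 0 < e ->
  exists M0, (0 < M0)%N /\ forall M, (M0 <= M)%N -> npow d M <= e.
Proof.
move=> d0 e0; exists (Num.truncn (expR ((d * e)^-1))).+1; split=> // M hM.
have M0 : 0 < M%:R :> R by rewrite ltr0n (leq_trans _ hM).
have h : expR ((d * e)^-1) <= M%:R.
  rewrite (le_trans (ltW (truncnS_gt _)))// ler_nat//.
rewrite /npow expRN -[leRHS]invrK lef_pV2 ?posrE ?expR_gt0 ?invr_gt0//.
have h2 : (d * e)^-1 <= ln M%:R by rewrite -ler_expR lnK ?posrE.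
apply: (@le_trans _ _ (d * (d * e)^-1)).
  by rewrite invfM mulrA mulfV ?gt_eqF// mul1r.
rewrite (le_trans (ler_wpM2l (ltW d0) h2))//.
by rewrite (le_trans _ (expR_ge1Dx _))// lerDr.
Qed.

Lemma sum_inv_sqr_le N : \sum_(1 <= k < N.+1) ((k%:R : R) ^+ 2)^-1 <= 2.
Proof.
suff h M : \sum_(1 <= k < M.+2) ((k%:R : R) ^+ 2)^-1 <= 2 - M.+1%:R^-1.
  case: N => [|N]; first by rewrite big_geq.
  by rewrite (le_trans (h N))// gerBl invr_ge0.
elim: M => [|M IH]; first by rewrite big_nat1; lra.
rewrite big_nat_recr//= (le_trans (lerD IH (lexx _)))//.
have a0 : 0 < M.+1%:R :> R by rewrite ltr0n.
rewrite -[M.+2%:R]natr1; set a : R := M.+1%:R in a0 *.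
rewrite -addrA lerD2l addrC -lerBrDr opprK.
have -> : - (a + 1)^-1 + a^-1 = (a * (a + 1))^-1 by field; rewrite ?gt_eqF//; lra.
by rewrite lef_pV2 ?posrE ?mulr_gt0 ?exprn_gt0; nra.
Qed.

End NegativePowers.

(** * Finite Euler products *)

Section EulerProduct.
Variable R : realType.
Local Notation C := R[i].
Implicit Types (h v : nat -> C) (d : R).

(** Every estimate below is uniform over this class, so that it applies to all the twists
    [f n * n ^ (- i t)] at the same time, with cut-offs independent of [t]. *)
Definition ucmul h := cmul h /\ forall n, cabs (h n) = 1.

(** Partial sum of the Dirichlet series at a real point; the imaginary part of the
    argument is carried by [h]. *)
Definition dsum (s : R) h N : C := \sum_(1 <= n < N.+1) h n * rc (npow s n).
(** The inverse of the Euler product over the primes up to [y]. *)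
Definition eprod (s : R) h y : C := \prod_(0 <= p < y.+1 | prime p) (1 - h p * rc (npow s p)).
(** The [y]-rough integers of sieve theory. *)
Definition rough y n := all (fun p => ~~ (prime p && (p %| n)%N)) (iota 0 y.+1).

Lemma roughS y n : rough y.+1 n = rough y n && ~~ (prime y.+1 && (y.+1 %| n)%N).
Proof. by rewrite /rough -[in LHS]addn1 iotaD all_cat/= andbT add0n. Qed.

Lemma roughM y q n : prime q -> (y < q)%N -> rough y (q * n) = rough y n.
Proof.
move=> qp yq; apply: eq_in_all => p; rewrite mem_iota add0n ltnS => /andP[_ py].
case: (boolP (prime p)) => //= pp; rewrite Euclid_dvdM// dvdn_prime2//.
by rewrite ltn_eqF// (leq_ltn_trans py).
Qed.

Lemma rough_gt y n : (0 < n)%N -> rough y n -> n != 1%N -> (y < n)%N.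
Proof.
move=> n0 /allP rn n1; rewrite ltnNge; apply/negP => ny.
have n2 : (1 < n)%N by case: n n0 n1 {rn ny} => [|[]].
have := rn (pdiv n); rewrite mem_iota/= add0n ltnS (leq_trans (pdiv_leq n0) ny).
by move=> /(_ isT); rewrite pdiv_prime// pdiv_dvd.
Qed.

Lemma cabs_term (s : R) h n : ucmul h -> cabs (h n * rc (npow s n)) = npow s n.
Proof. by move=> [_ h1]; rewrite cabsM h1 cabs_rc mul1r ger0_norm// npow_ge0. Qed.

(** Sieving out one prime [q] at a time: multiplying by [1 - h q * q ^ (- s)] removes the
    multiples of [q], up to the terms between [N %/ q] and [N], which are a tail of a
    convergent series. The cut-off [N0] depends on [d], [y] and [e] but not on [h]. *)
Lemma euler_rough d y (e : R) : 0 < d -> 0 < e -> exists N0, forall N, (N0 <= N)%N ->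
  forall h, ucmul h ->
  cabs (dsum (1 + d) h N * eprod (1 + d) h y -
        \sum_(1 <= n < N.+1 | rough y n) h n * rc (npow (1 + d) n)) <= e.
Proof.
move=> d0; have d1 : 0 <= 1 + d by lra.
elim: y e => [|y IH] e e0.
  exists 0%N => N _ h hu; rewrite /eprod big_mkcond big_nat1/= mulr1 /dsum.
  rewrite (eq_bigl (fun=> true)) ?subrr ?cabs0 ?(ltW e0)//.
case: (boolP (prime y.+1)) => [qp|qnp]; last first.
  have [N0 hN0] := IH e e0; exists N0 => N NN0 h hu.
  rewrite (eq_bigl (rough y)); last by move=> n; rewrite roughS (negbTE qnp) andbT.
  rewrite [eprod _ _ _]big_mkcond big_nat_recr//= (negbTE qnp) mulr1 -big_mkcond.
  exact: hN0.
have e4 : 0 < e / 4 by rewrite divr_gt0.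
have ed : 0 < e * d / 2 by rewrite divr_gt0// mulr_gt0.
have [N0 hN0] := IH _ e4; have [M0 [M00 hM0]] := npow_small d0 ed.
set q := y.+1 in qp *.
exists (maxn N0 (q * M0)) => N; rewrite geq_max => /andP[/hN0{}hN0 NM] h hu.
have {}hN0 := hN0 h hu; set s := 1 + d in hN0 d1 *.
rewrite [eprod _ _ _]big_mkcond big_nat_recr//= -/q qp -big_mkcond -/(eprod s h y).
set A := \sum_(1 <= n < N.+1 | rough y n) _ in hN0.
set u := h q * rc (npow s q).
set B := \sum_(1 <= n < N.+1 | rough y.+1 n) _.
have qN : (M0 <= N %/ q)%N by rewrite leq_divRL// mulnC.
pose A' := \sum_(1 <= n < (N %/ q).+1 | rough y n) h n * rc (npow s n).
have AB : A = B + u * A'.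
  rewrite /A (bigID (fun n => (q %| n)%N))/= addrC; congr (_ + _).
    by apply: eq_bigl => n; rewrite roughS qp.
  rewrite (eq_bigl (fun n => (q %| n)%N && rough y n)); last by move=> n; rewrite andbC.
  rewrite big_mkcondr/= sum_multiples// /A' [in RHS]big_mkcond/= mulr_sumr.
  rewrite !big_nat; apply: eq_bigr => n /andP[n0 _].
  rewrite roughM// /u; case: ifP => _; last by rewrite mulr0.
  have [[_ hM] _] := hu; rewrite hM// npowM// /rc rmorphM/=; ring.
have AA : A = A' + \sum_((N %/ q).+1 <= n < N.+1 | rough y n) h n * rc (npow s n).
  by rewrite /A (@big_cat_nat _ _ _ (N %/ q).+1)//= ltnS leq_div.
set T := \sum_((N %/ q).+1 <= n < N.+1 | rough y n) _ in AA.
have Tle : cabs T <= e / 2.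
  rewrite (le_trans (ler_cabs_sum _ _ _))//.
  rewrite (le_trans (_ : _ <= \sum_((N %/ q).+1 <= n < N.+1) npow s n))//.
    rewrite big_mkcond; apply: ler_sum => n _; rewrite cabs_term//.
    by case: ifP => // _; exact: npow_ge0.
  rewrite (le_trans (sum_npow_tail _ d0 _))// ?(leq_trans M00)//.
  rewrite ler_pdivrMr// mulrAC; exact: hM0.
have ule : cabs u <= 1 by rewrite cabs_term// npow_le1.
have -> : dsum s h N * (eprod s h y * (1 - u)) - B =
   (dsum s h N * eprod s h y - A) * (1 - u) - u * T.
  have A1u : A * (1 - u) = B - u * T.
    by rewrite mulrBr mulr1 [X in X - _]AB [X in _ - X * _]AA; ring.
  by rewrite [in RHS]mulrBl A1u; ring.
have u2 : cabs (1 - u) <= 2.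
  by rewrite (le_trans (ler_cabsB _ _))// cabs1; lra.
rewrite (le_trans (ler_cabsB _ _))// (cabsM _ (1 - u)) (cabsM u T).
have h1 := ler_pM (cabs_ge0 _) (cabs_ge0 _) hN0 u2.
have h2 := ler_pM (cabs_ge0 _) (cabs_ge0 _) ule Tle.
by rewrite (le_trans (lerD h1 h2))//; lra.
Qed.

(** A [y]-rough integer other than 1 exceeds [y], so after sieving only the term 1 and a
    tail of the series remain. *)
Lemma euler_approx d (e : R) : 0 < d -> 0 < e -> exists y N0, forall N, (N0 <= N)%N ->
  forall h, ucmul h -> cabs (dsum (1 + d) h N * eprod (1 + d) h y - 1) <= e.
Proof.
move=> d0 e0; have ed : 0 < e * d / 2 by rewrite divr_gt0// mulr_gt0.
have [y [y0 hy]] := npow_small d0 ed.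
have e2 : 0 < e / 2 by rewrite divr_gt0.
have [N0 hN0] := euler_rough y d0 e2; exists y, (maxn y N0) => N.
rewrite geq_max => /andP[yN /hN0{}hN0] h hu; have {}hN0 := hN0 h hu.
set A := \sum_(_ <= _ < _ | _) _ in hN0.
suff AA : cabs (A - 1) <= e / 2.
  rewrite -(subrKA A) (le_trans (ler_cabsD _ _))//; move: AA hN0; lra.
have -> : A - 1 = \sum_(2 <= n < N.+1 | rough y n) h n * rc (npow (1 + d) n).
  rewrite /A big_ltn_cond ?ltnS ?(leq_trans y0)// npow1; have [[-> _] _] := hu.
  have -> : rough y 1.
    by apply/allP => p _; apply/negP => /andP[pp]; rewrite dvdn1 => /eqP e1; move: pp; rewrite e1.
  by rewrite mul1r /rc rmorph1 addrC addKr.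
rewrite (le_trans (ler_cabs_sum _ _ _))//.
rewrite (le_trans (_ : _ <= \sum_(y.+1 <= n < N.+1) npow (1 + d) n))//; last first.
  rewrite (le_trans (sum_npow_tail _ d0 _))// ler_pdivrMr// mulrAC; exact: hy.
rewrite (@big_cat_nat _ _ _ y.+1)//=.
rewrite [X in X + _]big_nat_cond big1 ?add0r; last first.
  move=> n /andP[/andP[n2 ny] rn]; have := rough_gt (ltnW n2) rn.
  by rewrite gtn_eqF// => /(_ isT); lia.
rewrite big_mkcond; apply: ler_sum => n _; rewrite cabs_term//.
by case: ifP => // _; exact: npow_ge0.
Qed.

End EulerProduct.

(** * Comparing Euler factors with those of zeta *)

Section EulerFactors.
Variable R : realType.
Local Notation C := R[i].
Implicit Types (u v z : C) (r : R).

(** With [r = p ^ (- 1 - d)] and [u = h p], the modulus of the quotient of the Euler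
    factor at [p] of [zeta] by that of the Dirichlet series of [h]. It grows with the
    distance of [h p] from 1. *)
Definition efac r u : R := cabs (1 - u * rc r) / (1 - r).

Lemma efac_ge0 r u : r <= 2^-1 -> 0 <= efac r u.
Proof. by move=> r2; rewrite divr_ge0 ?cabs_ge0//; lra. Qed.

(** The square is affine in [1 - Re u] with nonnegative slope, which turns products of
    such factors into Bernoulli inequalities. *)
Lemma efac_sqr r u : r <= 2^-1 -> cabs u = 1 ->
  efac r u ^+ 2 = 1 + 2 * r * (1 - Re u) / (1 - r) ^+ 2.
Proof.
move=> r2 u1; have r1 : 1 - r != 0 by rewrite gt_eqF//; lra.
rewrite expr_div_n cabs_sqr; have := cabs_sqr u; rewrite u1; case: u {u1} => a b /=.
rewrite expr1n !mulr0 subr0 !add0r => h.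
have -> : (1 - a * r) ^+ 2 + (- (b * r)) ^+ 2 = (1 - r) ^+ 2 + 2 * r * (1 - a).
  have -> : (1 - a * r) ^+ 2 + (- (b * r)) ^+ 2 = 1 - 2 * a * r + (a ^+ 2 + b ^+ 2) * r ^+ 2 by ring.
  by rewrite -h; ring.
by rewrite mulrDl mulfV// expf_neq0.
Qed.

Lemma Re_le1 u : cabs u = 1 -> Re u <= 1.
Proof. by move=> <-; exact: Re_le_cabs. Qed.

Lemma bernoulli (x : R) n : 0 <= x -> 1 + n%:R * x <= (1 + x) ^+ n.
Proof.
move=> x0; elim: n => [|n IH]; first by rewrite mul0r addr0.
rewrite exprSr (le_trans _ (ler_wpM2r _ IH)) ?addr_ge0// -natr1.
have : 0 <= n%:R * x * x by rewrite !mulr_ge0.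
by rewrite mulrDl mulrDr; lra.
Qed.

Lemma cabs_1BX u n : cabs u = 1 -> cabs (1 - u ^+ n) <= n%:R * cabs (1 - u).
Proof.
move=> u1; elim: n => [|n IH]; first by rewrite expr0 subrr cabs0 mul0r.
have -> : 1 - u ^+ n.+1 = (1 - u) + u * (1 - u ^+ n) by rewrite exprS; ring.
rewrite (le_trans (ler_cabsD _ _))// cabsM u1 mul1r -natr1 mulrDl mul1r addrC.
by rewrite lerD2r.
Qed.

(** From [1 - cos (n a) <= n ^ 2 * (1 - cos a)] and Bernoulli. *)
Lemma efacX r u n : 0 < r -> r <= 2^-1 -> cabs u = 1 ->
  efac r (u ^+ n) <= efac r u ^+ (n ^ 2).
Proof.
move=> r0 r2 u1; have un : cabs (u ^+ n) = 1 by rewrite cabsX u1 expr1n.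
rewrite -(@ler_pXn2r _ 2) ?nnegrE ?efac_ge0 ?exprn_ge0 ?efac_ge0//.
rewrite exprAC !efac_sqr//.
have x0 : 0 <= 2 * r * (1 - Re u) / (1 - r) ^+ 2.
  by rewrite divr_ge0 ?sqr_ge0// !mulr_ge0 ?(ltW r0)// subr_ge0 Re_le1.
apply: le_trans (bernoulli _ x0); rewrite lerD2l mulrA ler_wpM2r ?invr_ge0 ?sqr_ge0//.
rewrite mulrCA ler_wpM2l//; first by lra.
have := cabs_1B_sqr u1; have := cabs_1B_sqr un.
have h := cabs_1BX n u1.
have : cabs (1 - u ^+ n) ^+ 2 <= (n%:R * cabs (1 - u)) ^+ 2.
  by rewrite ler_pXn2r ?nnegrE ?cabs_ge0 ?mulr_ge0 ?cabs_ge0.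
rewrite exprMn natrX => h1 h2 h3.
by move: h1; rewrite h2 h3 mulrCA ler_pM2l.
Qed.

Lemma Re_mul_unit u v : cabs u = 1 -> cabs v = 1 ->
  1 - Re (u * v) <= 2 * (1 - Re u) + 2 * (1 - Re v).
Proof.
move=> u1 v1; have uv1 : cabs (u * v) = 1 by rewrite cabsM u1 v1 mul1r.
have := cabs_1B_sqr u1; have := cabs_1B_sqr v1; have := cabs_1B_sqr uv1.
have : cabs (1 - u * v) <= cabs (1 - u) + cabs (1 - v).
  have -> : 1 - u * v = (1 - u) + u * (1 - v) by ring.
  by rewrite (le_trans (ler_cabsD _ _))// cabsM u1 mul1r.
have := cabs_ge0 (1 - u * v).
set a := cabs _; set b := cabs _; set c := cabs _ => a0 abc h1 h2 h3.
have : a ^+ 2 <= (b + c) ^+ 2 by rewrite ler_pXn2r ?nnegrE ?addr_ge0 ?cabs_ge0.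
have := sqr_ge0 (b - c); nra.
Qed.

(** If [u * v] keeps away from 1, then [u] or [v] does, so the product of their factors
    dominates a fixed power of the factor [(1 - r)^-1] of [zeta]. *)
Lemma efac_twist r u v (K : nat) : 0 < r -> r <= 2^-1 -> cabs u = 1 -> cabs v = 1 ->
  1 <= 2 * K%:R * (1 - Re (u * v)) ->
  (1 - r)^-1 <= (efac r u * efac r v) ^+ (4 * K).
Proof.
move=> r0 r2 u1 v1 hK.
have r1 : 0 < 1 - r by lra.
have uv := Re_mul_unit u1 v1.
have hu := Re_le1 u1; have hv := Re_le1 v1.
have huv : Re (u * v) <= 1 by rewrite Re_le1// cabsM u1 v1 mul1r.
have e : (efac r u * efac r v) ^+ (4 * K) =
   (((1 + 2 * r * (1 - Re u) / (1 - r) ^+ 2) *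
    (1 + 2 * r * (1 - Re v) / (1 - r) ^+ 2)) ^+ 2) ^+ K.
  by rewrite -!efac_sqr// -exprMn -!exprM mulnA.
rewrite e.
set q := (1 - r) ^+ 2; have q0 : 0 < q by rewrite exprn_gt0.
set c := r / q; have c0 : 0 < c by rewrite divr_gt0.
have cE (x : R) : 2 * r * x / q = c * (2 * x) by rewrite /c; ring.
rewrite !cE.
have x0 : 0 <= c * (2 * (1 - Re (u * v))) by rewrite mulr_ge0 ?(ltW c0)//; lra.
apply: (@le_trans _ _ ((1 + c * (2 * (1 - Re (u * v)))) ^+ K)).
  apply: le_trans (bernoulli _ x0).
  have -> : (1 - r)^-1 = 1 + r / (1 - r).
    by field; rewrite gt_eqF.
  rewrite lerD2l (@le_trans _ _ c)//.
    rewrite /c ler_wpM2l ?(ltW r0)// lef_pV2 ?posrE// /q expr2 ler_piMr ?(ltW r1)//.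
    lra.
  rewrite -[leLHS]mulr1 [leRHS]mulrCA ler_wpM2l ?(ltW c0)//; move: hK; lra.
apply: lerXn2r; rewrite ?nnegrE ?sqr_ge0 ?addr_ge0//.
have a0 : 0 <= c * (2 * (1 - Re u)) by rewrite mulr_ge0 ?(ltW c0)//; lra.
have b0 : 0 <= c * (2 * (1 - Re v)) by rewrite mulr_ge0 ?(ltW c0)//; lra.
have h : c * (2 * (1 - Re (u * v))) <= 2 * (c * (2 * (1 - Re u))) + 2 * (c * (2 * (1 - Re v))).
  by rewrite ![2 * (c * _)]mulrCA -mulrDr ler_wpM2l ?(ltW c0)//; lra.
move: h a0 b0; set A := c * (2 * (1 - Re u)); set B := c * (2 * (1 - Re v)).
set D := c * _ => h A0 B0.
have AB0 : 0 <= A * B by rewrite mulr_ge0.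
have := bernoulli 2 (_ : 0 <= A + B + A * B); rewrite !addr_ge0// => /(_ isT).
have -> : 1 + (A + B + A * B) = (1 + A) * (1 + B) by ring.
lra.
Qed.

End EulerFactors.

(** * Comparing Euler products with that of zeta *)

Section EulerComparison.
Variable R : realType.
Local Notation C := R[i].
Implicit Types (h v : nat -> C) (d : R).

Definition one_fun (n : nat) : C := 1.

Lemma ucmul_one : ucmul one_fun.
Proof. by split; [split => // a b _ _; rewrite /one_fun mulr1|move=> n; exact: cabs1]. Qed.

(** The inverse of the truncated Euler product of [zeta] at [1 + d]. *)
Definition pzero d y : R := \prod_(0 <= p < y.+1 | prime p) (1 - npow (1 + d) p).

(** The modulus of the quotient of the truncated Euler products of [zeta] and of [h]; by
    [cabs_eprodE] it is the natural variable in which to compare different [h]. *)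
Definition pratio d h y : R := \prod_(0 <= p < y.+1 | prime p) efac (npow (1 + d) p) (h p).

Lemma npow_prime_half d p : 0 < d -> prime p -> npow (1 + d) p <= 2^-1.
Proof.
move=> d0 pp; rewrite npowD npow_one ?prime_gt0// -[leRHS]mulr1.
by rewrite ler_pM ?invr_ge0 ?npow_ge0 ?npow_le1 ?(ltW d0)// lef_pV2 ?posrE ?ltr0n ?ler_nat ?prime_gt0 ?prime_gt1.
Qed.

Lemma pzero_gt0 d y : 0 < d -> 0 < pzero d y.
Proof.
by move=> d0; apply: prodr_gt0 => p pp; have := npow_prime_half d0 pp; lra.
Qed.

Lemma pratio_ge0 d h y : 0 < d -> 0 <= pratio d h y.
Proof. by move=> d0; apply: prodr_ge0 => p pp; rewrite efac_ge0 ?npow_prime_half. Qed.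

Lemma cabs_eprodE d h y : 0 < d -> cabs (eprod (1 + d) h y) = pratio d h y * pzero d y.
Proof.
move=> d0; rewrite /eprod cabs_prod -big_split/=; apply: eq_bigr => p pp.
by rewrite /efac mulfVK// gt_eqF//; have := npow_prime_half d0 pp; lra.
Qed.

Lemma pratio_one d y : 0 < d -> pratio d one_fun y = 1.
Proof.
move=> d0; apply: big1 => p pp; have h := npow_prime_half d0 pp.
have e : 1 - one_fun p * rc (npow (1 + d) p) = rc (1 - npow (1 + d) p).
  by rewrite /one_fun mul1r /rc rmorphB rmorph1.
rewrite /efac e cabs_rc.
by rewrite ger0_norm ?mulfV ?gt_eqF//; lra.
Qed.

Lemma pratioX d h y n : 0 < d -> (forall k, cabs (h k) = 1) ->
  pratio d (fun k => h k ^+ n) y <= pratio d h y ^+ (n ^ 2).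
Proof.
move=> d0 h1; rewrite -prodrXl; apply: ler_prod => p pp.
by rewrite efac_ge0 ?npow_prime_half//= efacX ?npow_prime_half ?npow_gt0.
Qed.

Lemma pratio_twist d h v z y (K : nat) : 0 < d ->
  (forall k, cabs (h k) = 1) -> (forall k, cabs (v k) = 1) ->
  (forall p, prime p -> h p * v p = z) -> 1 <= 2 * K%:R * (1 - Re z) ->
  (pzero d y)^-1 <= (pratio d h y * pratio d v y) ^+ (4 * K).
Proof.
move=> d0 h1 v1 hv hK; rewrite -big_split/= -prodrXl -prodfV.
apply: ler_prod => p pp; have r2 := npow_prime_half d0 pp.
rewrite invr_ge0; apply/andP; split; first by lra.
by apply: efac_twist => //; rewrite ?npow_gt0// hv.
Qed.

End EulerComparison.

(** * Zeta to the right of its pole *)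

Section ZetaNearOne.
Variable R : realType.
Local Notation C := R[i].
Implicit Types (d t : R).

(** The twist [n ^ (- i t)]. *)
Definition nit t (n : nat) : C := cis (- (t * ln n%:R)).

Lemma ucmul_nit t : ucmul (nit t).
Proof.
split; last by move=> n; exact: cabs_cis.
split=> [|a b a0 b0]; first by rewrite /nit ln1 mulr0 oppr0 cis0.
by rewrite /nit natrM lnM ?posrE ?ltr0n// mulrDr opprD cisD.
Qed.

Lemma cabs_Complex d t : cabs (Complex d t) ^+ 2 = d ^+ 2 + t ^+ 2.
Proof. by rewrite cabs_sqr. Qed.

(** The summand [n ^ (- d - i t)], a discrete antiderivative of
    [- (d + i t) * n ^ (- 1 - d - i t)]. *)
Definition zphi d t k := rc (npow d k) * nit t k.

Lemma zeta_step d t (n : nat) : 0 < d -> (0 < n)%N ->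
  cabs (zphi d t n - zphi d t n.+1 - Complex d t * (nit t n * rc (npow (1 + d) n))) <=
    (cabs (Complex d t) + 2 * cabs (Complex d t) ^+ 2) * (n%:R ^+ 2)^-1.
Proof.
move=> d0 n0; set w := Complex d t; set phi := zphi d t; pose u : R := ln n.+1%:R - ln n%:R.
have n0' : 0 < n%:R :> R by rewrite ltr0n.
have u1 := ln_succB_ge R n0; have u2 := ln_succB_le R n0; rewrite -/u in u1 u2.
have u0 : 0 <= u by rewrite (le_trans _ u1)// invr_ge0.
have phiS : phi n.+1 = phi n * (rc (expR (- (d * u))) * cis (- (t * u))).
  rewrite /phi /zphi mulrACA -rmorphM/= /nit -cisD /npow -expRD.
  by congr (rc (expR _) * cis _); rewrite /u; ring.
have wphi : nit t n * rc (npow (1 + d) n) = phi n * rc n%:R^-1.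
  by rewrite npowD npow_one// /rc rmorphM/= /phi /zphi; ring.
have -> : phi n - phi n.+1 - w * (nit t n * rc (npow (1 + d) n)) =
  phi n * ((1 - rc (expR (- (d * u))) * cis (- (t * u)) - Complex (d * u) (t * u)) +
     w * rc (u - n%:R^-1)).
  have -> : Complex (d * u) (t * u) = w * rc u.
    by rewrite /w /rc; simpc.
  by rewrite wphi phiS (rcB u); ring.
rewrite cabsM [cabs (phi n)]cabsM cabs_cis mulr1 cabs_rc ger0_norm ?npow_ge0//.
rewrite (le_trans (ler_piMl _ _)) ?cabs_ge0 ?npow_le1 ?(ltW d0)//.
rewrite (le_trans (ler_cabsD _ _))// addrC mulrDl lerD//.
  rewrite cabsM ler_wpM2l ?cabs_ge0// cabs_rc ler0_norm ?subr_le0// opprB.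
  rewrite (@le_trans _ _ (n%:R^-1 - n.+1%:R^-1)) ?lerB//.
  rewrite -[n.+1%:R]natr1; set x : R := n%:R in n0' *.
  have -> : x^-1 - (x + 1)^-1 = (x * (x + 1))^-1 by field; rewrite ?gt_eqF//; lra.
  by rewrite lef_pV2 ?posrE ?mulr_gt0 ?exprn_gt0; nra.
rewrite (le_trans (cexp_quad _ _)) ?mulr_ge0 ?(ltW d0)//.
rewrite -mulrA ler_wpM2l// !exprMn -mulrDl cabs_Complex ler_wpM2l ?addr_ge0 ?sqr_ge0//.
by rewrite -exprVn ler_pXn2r ?nnegrE// invr_ge0.
Qed.

(** [zeta (1 + w)] is [w^-1 + O(1 + |w|)] with [w = d + i t]: the series is compared with
    the telescoping sum of [n ^ (- w)], the differences being second order. *)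
Lemma zeta_approx d t N : 0 < d ->
  cabs (Complex d t * dsum (1 + d) (nit t) N - 1) <=
    npow d N.+1 + 2 * (cabs (Complex d t) + 2 * cabs (Complex d t) ^+ 2).
Proof.
move=> d0; set w := Complex d t; pose phi := zphi d t.
have e : w * dsum (1 + d) (nit t) N - 1 =
  - phi N.+1 - \sum_(1 <= n < N.+1) (phi n - phi n.+1 - w * (nit t n * rc (npow (1 + d) n))).
  rewrite sumrB -mulr_sumr -/(dsum (1 + d) (nit t) N).
  rewrite (eq_bigr (fun n => - phi n.+1 - - phi n)); last by move=> n _; rewrite opprK addrC.
  rewrite (telescope_sumr (fun n => - phi n))// opprK.
  have -> : phi 1%N = 1.
    by rewrite /phi /zphi npow1 /nit ln1 mulr0 oppr0 cis0 mulr1 /rc rmorph1.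
  by ring.
rewrite e (le_trans (ler_cabsB _ _))// cabsN lerD//.
  by rewrite cabsM cabs_cis mulr1 cabs_rc ger0_norm ?npow_ge0.
rewrite (le_trans (ler_cabs_sum _ _ _))//.
rewrite (le_trans (_ : _ <= \sum_(1 <= n < N.+1) (cabs w + 2 * cabs w ^+ 2) * (n%:R ^+ 2)^-1))//.
  rewrite big_nat [leRHS]big_nat; apply: ler_sum => n /andP[n0 _].
  exact: zeta_step.
rewrite -mulr_sumr mulrC ler_wpM2r ?addr_ge0 ?mulr_ge0 ?cabs_ge0 ?sqr_ge0//.
exact: sum_inv_sqr_le.
Qed.

End ZetaNearOne.

(** * Bounding the Dirichlet series of z^Omega at one point *)

Section SupBound.
Variable R : realType.
Local Notation C := R[i].
Implicit Types (d t : R).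

Definition twist (z : C) t (n : nat) : C := z ^+ prime_Omega n * nit t n.

Lemma ucmul_twist z t : cabs z = 1 -> ucmul (twist z t).
Proof.
move=> z1; have [[n1 nM] nu] := ucmul_nit t; split; last first.
  by move=> n; rewrite /twist cabsM cabsX z1 expr1n mul1r nu.
split=> [|a b a0 b0]; first by rewrite /twist prime_Omega1 n1 mulr1.
by rewrite /twist prime_OmegaM// nM// exprD; ring.
Qed.

Lemma nitX t n k : nit t n ^+ k = nit (k%:R * t) n.
Proof. by rewrite /nit cisX; congr cis; rewrite -mulr_natl; ring. Qed.

Lemma nitN_mul t n : nit t n * nit (- t) n = 1.
Proof. by rewrite /nit -cisD -[RHS](@cis0 R); congr cis; ring. Qed.

(** Multiply by [w = d + i t] and use [|t| <= |w|]. *)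
Lemma zeta_upper d t N : 0 < d -> d <= 1 -> 0 < `|t| ->
  cabs (dsum (1 + d) (nit t) N) <= 2 * `|t|^-1 + 6 + 4 * `|t|.
Proof.
move=> d0 d1 t0; have := zeta_approx t N d0.
set w := Complex d t; set D := dsum _ _ _ => h.
have wt : `|t| <= cabs w by rewrite (normr_Im_le_cabs w).
have w0 : 0 < cabs w by rewrite (lt_le_trans t0).
have wd : cabs w <= 1 + `|t|.
  by rewrite (le_trans (cabs_le_ReIm _))//= lerD2r ger0_norm// ltW.
have n1 := npow_le1 N.+1 (ltW d0).
have h1 : cabs w * cabs D <= 2 + 2 * cabs w + 4 * cabs w ^+ 2.
  rewrite -cabsM -[w * D](subrK 1) (le_trans (ler_cabsD _ _))// cabs1; lra.
have -> : cabs D = (cabs w * cabs D) / cabs w by rewrite mulrAC mulfV ?mul1r// gt_eqF.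
rewrite ler_pdivrMr// (le_trans h1)//.
have : `|t|^-1 * cabs w >= 1 by rewrite mulrC ler_pdivlMr// mul1r.
rewrite !mulrDl -mulrA; nra.
Qed.

Lemma zeta_lower d t N : 0 < d -> cabs (Complex d t) <= 1 / 16 -> npow d N.+1 <= 1 / 4 ->
  1 <= 2 * cabs (Complex d t) * cabs (dsum (1 + d) (nit t) N).
Proof.
move=> d0 hw hn; have := zeta_approx t N d0.
set w := Complex d t in hw *; set D := dsum _ _ _ => h.
rewrite -mulrA -cabsM; have := ler_cabsB (w * D) (w * D - 1).
have -> : w * D - (w * D - 1) = 1 by ring.
rewrite cabs1; have := cabs_ge0 w; nra.
Qed.

Section EulerConsequences.
Variables (d : R) (y N : nat).
Hypothesis d0 : 0 < d.
Hypothesis d1 : d <= 1.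
Hypothesis hE : forall h : nat -> C, ucmul h ->
  cabs (dsum (1 + d) h N * eprod (1 + d) h y - 1) <= 1 / 2.

Let D h := cabs (dsum (1 + d) h N).
Let X h := pratio d h y.
Let p0 := pzero d y.

(** With [euler_lower]: the modulus of the Dirichlet series of [h] is, up to constants,
    the zeta product [p0^-1] divided by [pratio d h y]. *)
Lemma euler_upper h : ucmul h -> D h * X h * p0 <= 3 / 2.
Proof.
move=> hu; have := hE hu; rewrite /D /X -mulrA -cabs_eprodE// -cabsM.
set a := _ * _ => ha; have := ler_cabsD (a - 1) 1; rewrite subrK cabs1; lra.
Qed.

Lemma euler_lower h : ucmul h -> 1 / 2 <= D h * X h * p0.
Proof.
move=> hu; have := hE hu; rewrite /D /X -mulrA -cabs_eprodE// -cabsM.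
set a := _ * _ => ha; have := ler_cabsB a (a - 1).
have -> : a - (a - 1) = 1 by ring.
by rewrite cabs1; lra.
Qed.

(** The lower estimate for the constant function 1, whose series is at most [1 + d^-1]. *)
Lemma pzero_inv_le : p0^-1 <= 4 / d.
Proof.
have q0 := pzero_gt0 y d0; rewrite -/p0 in q0.
have := euler_lower (ucmul_one R); rewrite /X pratio_one// mulr1 => h.
have hD : D (@one_fun R) <= 1 + d^-1.
  rewrite /D /dsum (le_trans (ler_cabs_sum _ _ _))// (le_trans _ (sum_npow_le N d0))//.
  by apply: ler_sum => n _; rewrite cabs_term//; exact: ucmul_one.
have hd : 1 <= d^-1 by rewrite invf_ge1.
have : p0^-1 <= 2 * D (@one_fun R).
  by rewrite -[leLHS]mul1r ler_pdivrMr//; move: h; lra.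
lra.
Qed.

(** The [m]-th power of [z * p ^ (- i t)] is [p ^ (- i m t)], since [z ^+ m = 1]. By
    [pratioX] the series [F] at [1 + d + i t] satisfies
    [|F| ^ (m ^ 2) << zeta (1 + d) ^ (m ^ 2 - 1) * |zeta (1 + d + i m t)|], which gains
    when [t] stays away from 0. *)
Lemma sup_large z t (m : nat) : (0 < m)%N -> cabs z = 1 -> z ^+ m = 1 ->
  D (twist z t) ^+ (m ^ 2) <=
    2 * (3 / 2) ^+ (m ^ 2) * (4 / d) ^+ (m ^ 2).-1 * D (nit (m%:R * t)).
Proof.
move=> m0 z1 zm; have hu := ucmul_twist t z1; have vu := ucmul_nit (m%:R * t).
have q0 : 0 < p0 := pzero_gt0 y d0.
have X0 : 0 <= X (twist z t) := pratio_ge0 _ _ d0.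
have D0 : 0 <= D (twist z t) := cabs_ge0 _.
have hX : X (nit (m%:R * t)) <= X (twist z t) ^+ (m ^ 2).
  have := pratioX y m d0 hu.2; congr (_ <= _); apply: eq_bigr => p pp; congr efac.
  by rewrite /twist exprMn exprAC zm expr1n mul1r nitX.
have h1 : (D (twist z t) * X (twist z t)) ^+ (m ^ 2) <= (3 / 2 * p0^-1) ^+ (m ^ 2).
  rewrite lerXn2r ?nnegrE ?mulr_ge0 ?invr_ge0 ?(ltW q0)//.
  by rewrite ler_pdivlMr// euler_upper.
have h2 := euler_lower vu; set D' := D (nit _) in h2 *.
have D'0 : 0 <= D' := cabs_ge0 _.
set E := D _ ^+ _.
have h3 : E * X (nit (m%:R * t)) <= (3 / 2 * p0^-1) ^+ (m ^ 2).
  by rewrite (le_trans _ h1)// exprMn ler_wpM2l// exprn_ge0.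
have m2 : (m ^ 2 = (m ^ 2).-1.+1)%N by rewrite prednK// expn_gt0 m0.
have E0 : 0 <= E by rewrite exprn_ge0.
have : E <= 2 * (D' * p0) * (E * X (nit (m%:R * t))).
  have -> : 2 * (D' * p0) * (E * X (nit (m%:R * t))) = E * (2 * (D' * X (nit (m%:R * t)) * p0)) by ring.
  by rewrite ler_peMr//; move: h2; lra.
move=> /le_trans; apply.
have Dp0 : 0 <= 2 * (D' * p0) by rewrite !mulr_ge0// ltW.
rewrite (le_trans (ler_wpM2l Dp0 h3))// exprMn {2}m2 exprS.
have -> : 2 * (D' * p0) * ((3 / 2) ^+ (m ^ 2) * (p0^-1 * p0^-1 ^+ (m ^ 2).-1)) =
   2 * (3 / 2) ^+ (m ^ 2) * p0^-1 ^+ (m ^ 2).-1 * D' * (p0 * p0^-1) by ring.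
rewrite mulfV ?gt_eqF// mulr1 ler_wpM2r//.
rewrite ler_wpM2l ?mulr_ge0 ?exprn_ge0 ?divr_ge0//.
by rewrite lerXn2r ?nnegrE ?invr_ge0 ?divr_ge0 ?(ltW q0) ?(ltW d0)// pzero_inv_le.
Qed.

(** At each prime, [z * p ^ (- i t)] and [p ^ (i t)] multiply to [z], so by [pratio_twist]
    the quotients of [zeta (1 + d)] by the series and by [zeta (1 + d - i t)] have a
    product at least [zeta (1 + d) ^ (1 / 4K)]. As [|zeta (1 + d - i t)|^-1 << |d - i t|],
    the series is small when [t] is close to 0. *)
Lemma sup_small z t (K : nat) : (0 < K)%N -> cabs z = 1 -> 1 <= 2 * K%:R * (1 - Re z) ->
  cabs (Complex d (- t)) <= 1 / 16 -> npow d N.+1 <= 1 / 4 ->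
  D (twist z t) ^+ (4 * K) <=
    (9 / 2 * cabs (Complex d (- t))) ^+ (4 * K) * (4 / d) ^+ (8 * K).-1.
Proof.
move=> K0 z1 hK hw hn; have hu := ucmul_twist t z1; have vu := ucmul_nit (- t).
have q0 : 0 < p0 := pzero_gt0 y d0.
have X0 : 0 <= X (twist z t) := pratio_ge0 _ _ d0.
have X0' : 0 <= X (nit (- t)) := pratio_ge0 _ _ d0.
have D0 : 0 <= D (twist z t) := cabs_ge0 _.
have hv p : prime p -> twist z t p * nit (- t) p = z.
  by move=> pp; rewrite /twist prime_Omega_prime// expr1 -mulrA nitN_mul mulr1.
have h1 := pratio_twist y d0 hu.2 vu.2 hv hK; rewrite -/p0 -!/(X _) in h1.
have h2 := zeta_lower d0 hw hn; rewrite -/(D _) in h2.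
set w := cabs _ in h2 hw *; have w0 : 0 <= w := cabs_ge0 _.
have h3 := euler_upper vu; have h4 := euler_upper hu.
have h5 : X (nit (- t)) <= 3 * w / p0.
  rewrite ler_pdivlMr//.
  have : X (nit (- t)) * p0 <= 2 * w * D (nit (- t)) * (X (nit (- t)) * p0).
    by rewrite ler_peMl// mulr_ge0// ltW.
  move=> /le_trans; apply; move: h3; set a := D _; set b := X _.
  have -> : 2 * w * a * (b * p0) = 2 * w * (a * b * p0) by ring.
  by move=> /(ler_wpM2l (mulr_ge0 (ler0n _ 2) w0)) /le_trans; apply; lra.
have h6 : D (twist z t) * (X (twist z t) * X (nit (- t))) <= 9 / 2 * w * p0^-1 ^+ 2.
  rewrite mulrA; have -> : 9 / 2 * w * p0^-1 ^+ 2 = (3 / 2 / p0) * (3 * w / p0) by field; rewrite gt_eqF.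
  by rewrite ler_pM// ?mulr_ge0// ler_pdivlMr.
have h7 : D (twist z t) ^+ (4 * K) <= p0 * (D (twist z t) * (X (twist z t) * X (nit (- t)))) ^+ (4 * K).
  rewrite exprMn mulrCA ler_peMr ?exprn_ge0//.
  by rewrite -ler_pdivrMl// mulr1.
rewrite (le_trans h7)//.
rewrite (@le_trans _ _ (p0 * (9 / 2 * w * p0^-1 ^+ 2) ^+ (4 * K)))//.
  rewrite ler_wpM2l ?(ltW q0)// lerXn2r ?nnegrE// ?mulr_ge0// ?exprn_ge0// ?invr_ge0 ?ltW//.
rewrite exprMn mulrCA ler_wpM2l ?exprn_ge0 ?mulr_ge0// -exprM mulnA.
rewrite -[(2 * 4)%N]/8%N.
have -> : (8 * K = (8 * K).-1.+1)%N by rewrite prednK// muln_gt0.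
rewrite exprS mulrA mulfV ?gt_eqF// mul1r -pred_Sn.
by rewrite lerXn2r ?nnegrE ?invr_ge0 ?divr_ge0 ?(ltW q0) ?(ltW d0)// pzero_inv_le.
Qed.

End EulerConsequences.
End SupBound.

(** * A uniform power saving for the Dirichlet series *)

Section SupBoundUniform.
Variable R : realType.
Local Notation C := R[i].
Implicit Types (d t : R).

Lemma Re_lt1 (z : C) : cabs z = 1 -> z != 1 -> 0 < 1 - Re z.
Proof.
move=> z1 zn1; have := cabs_1B_sqr z1.
have : 0 < cabs (1 - z) ^+ 2.
  by rewrite exprn_gt0// lt0r cabs_ge0 cabs_eq0 subr_eq0 eq_sym zn1.
lra.
Qed.

Lemma powR_ler_expn (a b : R) (n k : nat) : 0 <= a -> (0 < n)%N -> a ^+ n <= b ->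
  a ^+ k <= b `^ (k%:R / n%:R).
Proof.
move=> a0 n0 ab; have b0 : 0 <= b by rewrite (le_trans _ ab)// exprn_ge0.
have -> : a ^+ k = (a ^+ n) `^ (k%:R / n%:R).
  rewrite -!powR_mulrn// -powRrM mulrCA mulfV ?mulr1// pnatr_eq0.
  by rewrite -lt0n.
by rewrite ge0_ler_powR ?nnegrE ?exprn_ge0// divr_ge0.
Qed.

Lemma expn_div_powR (c d : R) n : 0 < d -> (c / d) ^+ n = c ^+ n * d `^ (- n%:R).
Proof. by move=> d0; rewrite expr_div_n powR_invn// ltW. Qed.

(** The two regimes meet at [|t| = d ^ (1 - k)] with [k = 1 / (8 K)]: below, [sup_small]
    gives [d ^ (- 2 + (1 - k) + 2 k) = d ^ (k - 1)]; above, [sup_large] gives the exponent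
    [k / m ^ 2 - 1]. The fourth power is stated because the factor in [t] is then the
    plain [1 + |t|], which leaves only a square root of it in the energy estimate. *)
Lemma sup_bound (z : C) (m : nat) : (0 < m)%N -> cabs z = 1 -> z ^+ m = 1 -> z != 1 ->
  exists A Cst d0 : R, [/\ 0 < A, A <= 1, 0 < Cst, 0 < d0 & d0 <= 1] /\
    forall d, 0 < d -> d <= d0 -> exists N0, forall N, (N0 <= N)%N -> forall t,
      cabs (dsum (1 + d) (twist z t) N) ^+ 4 <= Cst * d `^ (4 * A - 4) * (1 + `|t|).
Proof.
move=> m0 z1 zm zn1.
(* how far [z] is from 1, as an integer *)
have [K K0 hK] : exists2 K : nat, (0 < K)%N & 1 <= 2 * K%:R * (1 - Re z).
  exists (Num.truncn (2 * (1 - Re z))^-1).+1 => //.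
  have q0 : 0 < 2 * (1 - Re z) by rewrite mulr_gt0// Re_lt1.
  by rewrite mulrAC -ler_pdivrMl// mulr1 ltW// truncnS_gt.
have m2 : (1 < m)%N.
  by case: m m0 zm => [//|[_|//]]; rewrite expr1 => z11; move: zn1; rewrite z11 eqxx.
have K0' : 1 <= K%:R :> R by rewrite ler1n.
have m0' : 2 <= m%:R :> R by rewrite ler_nat.
(* [sup_small] saves [d ^ (1 / 4 K)] and loses [d ^ (- k)] through the size of [t] *)
pose k : R := (8 * K%:R)^-1.
have k0 : 0 < k by rewrite invr_gt0; lra.
have k8 : k <= 1 / 8.
  by rewrite /k -[leRHS]invrK lef_pV2 ?posrE; lra.
pose A : R := k / m%:R ^+ 2.
have mm : 4 <= m%:R ^+ 2 :> R by nra.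
have mm0 : 0 < m%:R ^+ 2 :> R by lra.
have A0 : 0 < A by rewrite divr_gt0.
have Ak : A <= k / 4 by rewrite /A ler_wpM2l ?(ltW k0)// lef_pV2 ?posrE//; lra.
pose C2 : R := 2 * (3 / 2) ^+ (m ^ 2) * 4 ^+ (m ^ 2).-1 * (8 + 4 * m%:R).
pose C3 : R := 9 ^+ (4 * K) * 4 ^+ (8 * K).-1.
have C20 : 0 < C2 by rewrite !mulr_gt0 ?exprn_gt0//; lra.
have C30 : 0 < C3 by rewrite !mulr_gt0 ?exprn_gt0//; lra.
(* [d <= (1 / 32) ^+ 2] makes [d `^ (1 - k) <= 1 / 32], whence [|d - i t| <= 1 / 16] as
   [sup_small] requires *)
exists A, (C2 `^ (4 / m%:R ^+ 2) + C3 `^ (4 / (4 * K)%:R)), ((1 / 32) ^+ 2).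
have q1 : (1 / 32 : R) ^+ 2 <= 1 by rewrite exprn_ile1//; lra.
split; first by split; rewrite ?addr_gt0 ?powR_gt0 ?exprn_gt0//; lra.
move=> d d0 dd.
have d1 : d <= 1 by rewrite (le_trans dd).
clear q1.
have [y [N1 hE]] := @euler_approx R d (1 / 2) d0 ltac:(by lra).
have [M0 [_ hM]] := @npow_small R d (1 / 4) d0 ltac:(by lra).
exists (maxn N1 M0) => N; rewrite geq_max => /andP[/hE{}hE NM] t.
have {}hM : npow d N.+1 <= 1 / 4 by apply: hM; rewrite (leq_trans NM).
set D := cabs _; have D0 : 0 <= D := cabs_ge0 _.
have t1 : 1 <= 1 + `|t| by rewrite lerDl.
have dpow_ge1 x : x <= 0 -> 1 <= d `^ x.
  by move=> x0; rewrite -(powRr0 d); apply: ger_powR => //; rewrite d0.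
have [tbig|tsmall] := ltP (d `^ (1 - k)) `|t|.
  have t0 : 0 < `|t| by rewrite (lt_trans _ tbig)// powR_gt0.
  have h := sup_large d0 d1 hE t m0 z1 zm; rewrite -/D in h.
  have hD' : cabs (dsum (1 + d) (nit (m%:R * t)) N) <= (8 + 4 * m%:R) * (d `^ (k - 1) * (1 + `|t|)).
    have mt : `|m%:R * t| = m%:R * `|t| by rewrite normrM ger0_norm.
    have mt1 : `|t| <= m%:R * `|t| by rewrite ler_peMl//; lra.
    rewrite (le_trans (zeta_upper _ d0 d1 _)) ?mt ?(lt_le_trans t0)//.
    have i1 : (m%:R * `|t|)^-1 <= d `^ (k - 1).
      have mt0 : 0 < m%:R * `|t| by rewrite (lt_le_trans t0).
      rewrite -opprB powRN lef_pV2 ?posrE ?powR_gt0//.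
      by rewrite (le_trans (ltW tbig)).
    have p1 : 1 <= d `^ (k - 1) by apply: dpow_ge1; lra.
    set p := d `^ (k - 1) in i1 p1 *; set tt := `|t| in t0 mt1 t1 i1 *.
    have a1 : p <= p * (1 + tt) by rewrite ler_peMr//; lra.
    have a2 : tt <= p * (1 + tt) by nra.
    have := ler_wpM2l (_ : 0 <= 4 * m%:R :> R) a2; rewrite mulr_ge0// => /(_ isT).
    by rewrite [(8 + _) * _]mulrDl; lra.
  have hD : D ^+ (m ^ 2) <= C2 * d `^ (k - m%:R ^+ 2) * (1 + `|t|).
    rewrite (le_trans h)// (@expn_div_powR 4 d)//.
    set c := 2 * (3 / 2) ^+ (m ^ 2) * _.
    have c0 : 0 <= c by rewrite !mulr_ge0 ?exprn_ge0 ?powR_ge0.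
    rewrite (le_trans (ler_wpM2l c0 hD'))// /c /C2.
    have -> : d `^ (k - m%:R ^+ 2) = d `^ (- (m ^ 2).-1%:R) * d `^ (k - 1).
      rewrite -powRD ?(gt_eqF d0) ?implybT//; congr powR.
      by rewrite -subn1 natrB ?expn_gt0 ?m0// natrX; ring.
    by rewrite le_eqVlt; apply/orP; left; apply/eqP; ring.
  have e0 : (0 < m ^ 2)%N by rewrite expn_gt0 m0.
  apply: (le_trans (powR_ler_expn 4 D0 e0 hD)).
  rewrite natrX powRM ?mulr_ge0 ?powR_ge0 ?(ltW C20)//.
  rewrite powRM ?powR_ge0 ?(ltW C20)// -powRrM.
  have -> : (k - m%:R ^+ 2) * (4 / m%:R ^+ 2) = 4 * A - 4 :> R.
    by rewrite /A; field; rewrite pnatr_eq0 -lt0n.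
  rewrite -!mulrA [leRHS]mulrDl -[leLHS]addr0 lerD//; last first.
    by rewrite !mulr_ge0 ?powR_ge0//; lra.
  rewrite ler_wpM2l ?powR_ge0// ler_wpM2l ?powR_ge0//.
  rewrite -[leRHS]powRr1; last by lra.
  by apply: ler_powR => //; rewrite ler_pdivrMr// mul1r.
have w2 : cabs (Complex d (- t)) <= 2 * d `^ (1 - k).
  rewrite (le_trans (cabs_le_ReIm _))//= normrN ger0_norm ?(ltW d0)//.
  have : d <= d `^ (1 - k).
    by rewrite -[leLHS]powRr1 ?(ltW d0)//; apply: ger_powR; [rewrite d0|lra].
  lra.
have w16 : cabs (Complex d (- t)) <= 1 / 16.
  rewrite (le_trans w2)//.
  have : d `^ (1 - k) <= d `^ (2^-1) by apply: ger_powR; [rewrite d0|lra].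
  have : d `^ (2^-1) <= 1 / 32.
    have -> : 1 / 32 = ((1 / 32) ^+ 2) `^ (2^-1) :> R.
      by rewrite -powR_mulrn ?divr_ge0// -powRrM mulfV ?powRr1 ?divr_ge0// pnatr_eq0.
    by rewrite ge0_ler_powR ?nnegrE ?exprn_ge0 ?divr_ge0 ?(ltW d0).
  lra.
have h := sup_small d0 d1 hE K0 z1 hK w16 hM; rewrite -/D in h.
have hD : D ^+ (4 * K) <= C3 * d `^ (2^-1 - (4 * K)%:R).
  rewrite (le_trans h)// (@expn_div_powR 4 d)//.
  rewrite (@le_trans _ _ ((9 * d `^ (1 - k)) ^+ (4 * K) * (4 ^+ (8 * K).-1 * d `^ (- (8 * K).-1%:R))))//.
    rewrite ler_wpM2r ?mulr_ge0 ?exprn_ge0 ?powR_ge0//.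
    by rewrite lerXn2r ?nnegrE ?mulr_ge0 ?cabs_ge0 ?powR_ge0//; lra.
  rewrite exprMn -(@powR_mulrn _ (d `^ (1 - k))) ?powR_ge0// -powRrM /C3.
  have -> : d `^ (2^-1 - (4 * K)%:R) = d `^ ((1 - k) * (4 * K)%:R) * d `^ (- (8 * K).-1%:R).
    rewrite -powRD ?(gt_eqF d0) ?implybT//; congr powR.
    rewrite -subn1 natrB ?muln_gt0// !natrM /k; field.
    by rewrite gt_eqF//; lra.
  by rewrite le_eqVlt; apply/orP; left; apply/eqP; ring.
have e0 : (0 < 4 * K)%N by rewrite muln_gt0 K0.
apply: (le_trans (powR_ler_expn 4 D0 e0 hD)).
rewrite powRM ?powR_ge0 ?(ltW C30)// -powRrM.
rewrite (@le_trans _ _ (C3 `^ (4 / (4 * K)%:R) * d `^ (4 * A - 4)))//.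
  rewrite ler_wpM2l ?powR_ge0//; apply: ger_powR; first by rewrite d0.
  have -> : (2^-1 - (4 * K)%:R) * (4 / (4 * K)%:R) = 4 * k - 4 :> R.
    by rewrite natrM /k; field; rewrite gt_eqF//; lra.
  lra.
rewrite -[leLHS]mulr1 ler_pM ?mulr_ge0 ?powR_ge0// ler_wpM2r ?powR_ge0//.
by rewrite lerDr powR_ge0.
Qed.

End SupBoundUniform.

(** * Discrete Fourier analysis of the exponential kernel *)

Section DirichletKernel.
Variable R : realType.
Implicit Types (x r h t v : R).

(** Multiplicity of the frequency [e] when the frequencies modulo the odd number [M] are
    folded by [e -> - e]. *)
Definition mult (e : nat) : R := if e == 0%N then 1 else 2.

Lemma mult_bounds e : 0 <= mult e <= 2.
Proof. by rewrite /mult; case: ifP; rewrite ?ler01 ?ler0n ?lexx//= ler1n. Qed.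

Lemma dirichlet_kernel x L :
  sin (x / 2) * \sum_(0 <= e < L.+1) mult e * cos (e%:R * x) = sin ((2 * L).+1%:R * (x / 2)).
Proof.
elim: L => [|L IH]; first by rewrite big_nat1 /mult/= mul0r cos0 mulr1 mulr1 mul1r.
rewrite big_nat_recr//= mulrDr IH /mult/=.
have -> : (2 * L).+1%:R * (x / 2) = L.+1%:R * x - x / 2 :> R.
  by rewrite -[(2 * L).+1%:R]natr1 -[L.+1%:R]natr1 natrM; field.
have -> : (2 * L.+1).+1%:R * (x / 2) = L.+1%:R * x + x / 2 :> R.
  by rewrite -[(2 * L.+1).+1%:R]natr1 natrM; field.
by rewrite sinB sinD; ring.
Qed.

Lemma sin_pi_nat k : sin (k%:R * pi : R) = 0.
Proof.
elim: k => [|k IH]; first by rewrite mul0r sin0.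
by rewrite -natr1 mulrDl mul1r sinDpi IH oppr0.
Qed.

Lemma cos_2pi_nat k : cos (k%:R * (pi *+ 2) : R) = 1.
Proof.
elim: k => [|k IH]; first by rewrite mul0r cos0.
by rewrite -natr1 mulrDl mul1r cosD2pi.
Qed.

Variable L : nat.
Let M := (2 * L).+1.
Definition theta (e : nat) : R := e%:R * (pi *+ 2 / M%:R).

(** Orthogonality of the characters modulo [M], folded; the range [k < 2 * M] is what the
    sums of two indices below [M] need. *)
Lemma sum_cos_roots k : (k < 2 * M)%N ->
  \sum_(0 <= e < L.+1) mult e * cos (k%:R * theta e) =
  if (k == 0)%N || (k == M) then M%:R else 0.
Proof.
have M0 : M%:R != 0 :> R by rewrite pnatr_eq0.
have sM : \sum_(0 <= e < L.+1) mult e = M%:R.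
  rewrite big_ltn// {1}/mult eqxx (eq_big_nat _ _ (F2 := fun=> 2)); last by case.
  by rewrite big_const_nat iter_addr_0 subSS subn0 -[_ *+ L]mulr_natr -[M%:R]natr1 natrM addrC.
case: (eqVneq k 0%N) => [->|k0] /= kM.
  by rewrite -sM; apply: eq_bigr => e _; rewrite mul0r cos0 mulr1.
case: eqP => [->|/eqP kM'].
  rewrite -[RHS]sM; apply: eq_bigr => e _.
  by rewrite /theta mulrCA [_ * (_ / _)]mulrC mulfVK// cos_2pi_nat mulr1.
pose x : R := k%:R * (pi *+ 2 / M%:R).
have hx : sin (x / 2) != 0.
  have e1 : x / 2 = k%:R / M%:R * pi by rewrite /x; field.
  rewrite e1; have [km|km] := ltnP k M.
    rewrite gt_eqF// sin_gt0_pi// mulr_gt0 ?divr_gt0 ?pi_gt0 ?ltr0n ?lt0n//=.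
    by rewrite gtr_pMl ?pi_gt0// ltr_pdivrMr ?ltr0n// mul1r ltr_nat.
  have -> : k%:R / M%:R * pi = (k - M)%:R / M%:R * pi + pi :> R.
    by rewrite natrB//; field.
  have kM2 : (0 < k - M)%N by rewrite subn_gt0 ltn_neqAle eq_sym kM'.
  rewrite sinDpi oppr_eq0 gt_eqF// sin_gt0_pi// mulr_gt0 ?divr_gt0 ?pi_gt0 ?ltr0n//=.
  rewrite gtr_pMl ?pi_gt0// ltr_pdivrMr ?ltr0n// mul1r ltr_nat; lia.
apply: (mulfI hx); rewrite mulr0.
rewrite (eq_bigr (fun e => mult e * cos (e%:R * x))); last first.
  by move=> e _; rewrite /theta /x mulrCA.
rewrite dirichlet_kernel -/M.
have -> : M%:R * (x / 2) = k%:R * pi by rewrite /x; field.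
exact: sin_pi_nat.
Qed.

Variable r : R.
Hypothesis r0 : 0 <= r.
Hypothesis r1 : r < 1.

(** The discrete Fourier transform modulo [M] of the periodised kernel
    [q -> r ^+ q + r ^+ (M - q)]. *)
Definition wt (e : nat) : R :=
  1 + r ^+ M + 2 * \sum_(1 <= i < M) r ^+ i * cos (i%:R * theta e).

Lemma sum_wt_cos q : (q < M)%N ->
  \sum_(0 <= e < L.+1) mult e * wt e * cos (q%:R * theta e) = M%:R * (r ^+ q + r ^+ (M - q)).
Proof.
move=> qM.
have e1 e : mult e * wt e * cos (q%:R * theta e) =
   (1 + r ^+ M) * (mult e * cos (q%:R * theta e)) +
   \sum_(1 <= i < M) r ^+ i * (mult e * cos ((i + q)%:R * theta e) +
      mult e * cos ((maxn i q - minn i q)%:R * theta e)).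
  rewrite /wt mulrDr mulrDl; congr (_ + _); first by ring.
  rewrite [2 * _]mulr_sumr mulr_sumr mulr_suml; apply: eq_bigr => i _.
  have -> : cos ((maxn i q - minn i q)%:R * theta e) = cos (i%:R * theta e - q%:R * theta e).
    rewrite -mulrBl; have [iq|qi] := leqP i q.
      by rewrite natrB// -[RHS]cosN; congr cos; ring.
    by rewrite natrB// ltnW.
  have -> : (i + q)%:R * theta e = i%:R * theta e + q%:R * theta e by rewrite natrD mulrDl.
  by rewrite cosB cosD; ring.
rewrite (eq_bigr _ (fun e _ => e1 e)) big_split/= -mulr_sumr sum_cos_roots; last by lia.
rewrite exchange_big/=.
rewrite (eq_big_nat _ _ (F2 := fun i => r ^+ i * (if (i == M - q)%N then M%:R else 0) +
   r ^+ i * (if (i == q)%N then M%:R else 0))); last first.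
  move=> i /andP[i0 iM]; rewrite -mulr_sumr -mulrDr big_split/=; congr (_ * _).
  rewrite !sum_cos_roots; [|lia..].
  congr (_ + _); congr (if _ then _ else _); [lia|].
  by have [iq|qi] := leqP i q; lia.
rewrite big_split/=.
have pick k : (0 < k <= M)%N -> \sum_(1 <= i < M) r ^+ i * (if (i == k)%N then M%:R else 0) =
    (if (k == M)%N then 0 else r ^+ k * M%:R).
  move=> /andP[k0 kM]; case: eqP => [->|/eqP kM'].
    rewrite big_nat big1// => i /andP[_ iM]; rewrite ltn_eqF ?mulr0//.
  rewrite (bigD1_seq k) ?iota_uniq ?mem_index_iota ?k0/= ?ltn_neqAle ?kM'//= eqxx.
  by rewrite big1 ?addr0// => i /negbTE->; rewrite mulr0.
rewrite pick; last by lia.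
case: (eqVneq q 0%N) => [->|q0] /=.
  rewrite subn0 eqxx expr0 add0r big_nat big1 ?addr0; first by ring.
  by move=> i /andP[i0 _]; rewrite gtn_eqF// mulr0.
rewrite pick; last by lia.
rewrite !(ltn_eqF qM) mulr0 add0r.
by rewrite ltn_eqF; [ring|lia].
Qed.

(** Geometric series: the Fourier weights are discrete Poisson kernels, whence their
    positivity. *)
Lemma wt_closed e : wt e * cabs (1 - rc r * cis (theta e)) ^+ 2 = (1 - r ^+ 2) * (1 - r ^+ M).
Proof.
set u := rc r * cis (theta e).
(* [cis (theta e)] is an [M]-th root of unity, so this geometric sum has a real closed
   form up to the factor [1 - u] *)
pose G := \sum_(0 <= i < M) u ^+ i.
have uM : u ^+ M = rc (r ^+ M).
  rewrite exprMn cisX /rc rmorphXn/= -/(rc _) -[RHS]mulr1; congr (_ * _).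
  have -> : theta e *+ M = e%:R * (pi *+ 2).
    by rewrite -[LHS]mulr_natr /theta -mulrA mulfVK// pnatr_eq0.
  rewrite /cis cos_2pi_nat; have -> : e%:R * (pi *+ 2) = (2 * e)%:R * pi :> R.
    by rewrite natrM -mulr_natl; ring.
  by rewrite sin_pi_nat.
have gG : (1 - u) * G = rc (1 - r ^+ M).
  rewrite rcB -uM /G big_mkord; have := subrX1 u M.
  have -> : rc 1 = 1 :> R[i] by rewrite /rc rmorph1.
  by move=> h; rewrite -(opprB u 1) mulNr -h opprB.
have wG : wt e = 2 * Re G - (1 - r ^+ M).
  rewrite /G big_ltn// expr0 /wt.
  have -> : Re (1 + \sum_(1 <= i < M) u ^+ i) = 1 + \sum_(1 <= i < M) r ^+ i * cos (i%:R * theta e).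
    rewrite -[1 in LHS]/(rc 1); move: (Re_sum (index_iota 1 M) xpredT (fun i => u ^+ i)).
    case: (\sum_(1 <= i < M) u ^+ i) => a b /= ->; congr (_ + _); apply: eq_bigr => i _.
    rewrite /u exprMn cisX /rc -rmorphXn/= mul0r subr0 mulr_natl//.
  by ring.
have key : Re G * cabs (1 - u) ^+ 2 = Re (1 - u) * (1 - r ^+ M).
  have : Re (((1 - u) * G) * (1 - u)^*%C) = Re G * cabs (1 - u) ^+ 2.
    rewrite cabs_sqr; case: (G) => a b; case: (1 - u) => c d /=; ring.
  by rewrite gG => <-; case: (1 - u) => c d /=; ring.
rewrite wG mulrBl -mulrA key.
have -> : cabs (1 - u) ^+ 2 = 1 - 2 * (r * cos (theta e)) + r ^+ 2.
  rewrite cabs_sqr /u /rc /=; have := cos2Dsin2 (theta e).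
  set c := cos _; set s := sin _ => cs.
  transitivity (1 - 2 * (r * c) + r ^+ 2 * (c ^+ 2 + s ^+ 2)); first by ring.
  by rewrite cs mulr1.
by rewrite /u /rc /=; ring.
Qed.

Lemma cabs_1B_rcis x : cabs (1 - rc r * cis x) ^+ 2 = (1 - r) ^+ 2 + 2 * r * (1 - cos x).
Proof.
rewrite cabs_sqr /rc /=; have := cos2Dsin2 x.
set c := cos _; set s := sin _ => cs.
transitivity (1 - 2 * (r * c) + r ^+ 2 * (c ^+ 2 + s ^+ 2)); first by ring.
by rewrite cs; ring.
Qed.

Lemma cabs_1B_rcis_gt0 x : 0 < cabs (1 - rc r * cis x) ^+ 2.
Proof.
rewrite cabs_1B_rcis ltr_pwDl ?exprn_gt0 ?subr_gt0// !mulr_ge0// subr_ge0.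
Qed.

Lemma wt_ge0 e : 0 <= wt e.
Proof.
rewrite -(pmulr_lge0 _ (cabs_1B_rcis_gt0 (theta e))) wt_closed.
by rewrite mulr_ge0// subr_ge0 exprn_ile1// ltW.
Qed.

End DirichletKernel.

(** * The kernel exp(-|v|) as a positive combination of cosines *)

Section SpectralKernel.
Variable R : realType.
Local Notation C := R[i].
Implicit Types (x h t v : R).

Lemma cos_lipschitz x y : `|cos x - cos y| <= `|x - y| :> R.
Proof.
have -> : cos x - cos y = Re (- (cis x * (cis (y - x) - 1))).
  rewrite mulrBr mulr1 -cisD [x + _]addrC subrK opprB.
  by rewrite /cis /=.
apply: (@le_trans _ _ (cabs (- (cis x * (cis (y - x) - 1))))).
  exact: normr_Re_le_cabs.
rewrite cabsN cabsM cabs_cis mul1r -cabsN opprB (le_trans (cabs_1B_cis_le _))//.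
by rewrite distrC.
Qed.

Lemma expRN_lipschitz x y : 0 <= x -> x <= y -> expR (- x) - expR (- y) <= y - x.
Proof.
move=> x0 xy; have -> : - y = - x - (y - x) by ring.
rewrite expRD -[X in X - _]mulr1 -mulrBr.
have e1 : expR (- x) <= 1 by rewrite expR_le1 oppr_le0.
have e2 := expR_ge1Dx (- (y - x)).
have e3 : expR (- (y - x)) <= 1 by rewrite expR_le1; lra.
rewrite (@le_trans _ _ (1 - expR (- (y - x))))//; last by lra.
by rewrite ler_piMl// subr_ge0.
Qed.

Section Grid.
Variables (D L : nat).
Hypothesis D0 : (0 < D)%N.
Let M := (2 * L).+1.
Let h : R := pi *+ 2 * D%:R / M%:R.
Hypothesis h2 : h <= 1 / 2.
Let r := expR (- h).

Let DR : 0 < D%:R :> R. Proof. by rewrite ltr0n. Qed.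
Let MR : 0 < M%:R :> R. Proof. by rewrite ltr0n. Qed.
Let h0 : 0 < h.
Proof. by rewrite divr_gt0// mulr_gt0// pmulrn_rgt0// pi_gt0. Qed.
Let r0 : 0 <= r. Proof. exact: expR_ge0. Qed.
Let r1 : r < 1. Proof. by rewrite expR_lt1 oppr_lt0. Qed.

(** The frequency [theta e / h], independent of the mesh [h]. *)
Definition freq (e : nat) : R := e%:R / D%:R.

Let theta_freq e : theta R L e = h * freq e.
Proof. by rewrite /theta /h /freq -/M; field; rewrite !gt_eqF. Qed.

(** The discrete Poisson kernel is dominated by the Cauchy density [1 / (1 + x ^ 2)], the
    Fourier transform of [exp (- |v|)]. *)
Lemma wt_upper e : (e <= L)%N ->
  wt L r e / M%:R <= 16 / D%:R / (1 + freq e ^+ 2).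
Proof.
move=> eL; have f0 : 0 <= freq e by rewrite divr_ge0.
have := wt_closed L r e; rewrite cabs_1B_rcis.
have thpi : `|theta R L e| <= pi.
  rewrite ger0_norm; last by rewrite theta_freq mulr_ge0// ltW.
  have eM : 2 * e%:R <= M%:R :> R by rewrite -natrM ler_nat /M; lia.
  by rewrite /theta -/M mulrA ler_pdivrMr// mulr2n; have := pi_gt0 R; nra.
have := cabs_1B_cis_ge thpi.
rewrite -(@ler_pXn2r _ 2) ?nnegrE ?cabs_ge0 ?divr_ge0// cabs_1B_cis_sqr expr_div_n real_normK ?num_real//.
rewrite theta_freq exprMn; set c := 1 - cos _ => hc hw.
have rr : 1 / 2 <= r.
  by have := expR_ge1Dx (- h); rewrite -/r; move: h2; lra.
have rh : h / 2 <= 1 - r.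
  have := expRN_quad (ltW h0); rewrite -/r ler_norml => /andP[+ _].
  have : h ^+ 2 <= h / 2 by rewrite expr2 ler_wpM2l ?(ltW h0)//; move: h2; lra.
  lra.
have rh2 : 1 - r ^+ 2 <= 2 * h.
  have := expR_ge1Dx (- (2 * h)); have -> : - (2 * h) = - h + - h by ring.
  by rewrite expRD -/r -expr2; lra.
have rM : 1 - r ^+ M <= 1 by rewrite gerBl exprn_ge0.
have rM0 : 0 <= 1 - r ^+ M by rewrite subr_ge0 exprn_ile1// ltW.
have w0 : 0 <= wt L r e by apply: wt_ge0.
set w := wt L r e in hw w0 *.
have q0 : 0 < 1 + freq e ^+ 2 by rewrite ltr_wpDr ?sqr_ge0.
have key : h ^+ 2 / 32 * (1 + freq e ^+ 2) <= (1 - r) ^+ 2 + 2 * r * c.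
  have a1 : (h / 2) ^+ 2 <= (1 - r) ^+ 2.
    by rewrite ler_pXn2r ?nnegrE//; move: h0 r1; lra.
  have c0 : 0 <= c by rewrite subr_ge0 cos_le1.
  have a2 : c <= 2 * r * c by rewrite ler_peMl//; lra.
  have h4 : (h / 2) ^+ 2 = h ^+ 2 / 4 by field.
  have s16 : (4 : R) ^+ 2 = 16 by ring.
  move: hc a1; rewrite h4 s16; have := sqr_ge0 h; have := sqr_ge0 (freq e).
  set H := h ^+ 2; set F := freq e ^+ 2 => F0 H0.
  have HF : 0 <= H * F by rewrite mulr_ge0.
  lra.
have hw2 : w * (h ^+ 2 / 32 * (1 + freq e ^+ 2)) <= 2 * h.
  rewrite (le_trans (ler_wpM2l w0 key))// hw.
  by rewrite (le_trans (ler_piMr _ rM))// subr_ge0 exprn_ile1// ltW.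
rewrite ler_pdivlMr// mulrAC ler_pdivrMr//.
have -> : 16 / D%:R * M%:R = 32 * pi / h.
  have gen (H m d p : R) : H != 0 -> d != 0 -> H * m = 2 * p * d -> 16 / d * m = 32 * p / H.
    move=> H0 d0' E; apply: (mulIf H0); rewrite mulfVK//.
    have -> : 16 / d * m * H = 16 / d * (H * m) by ring.
    by rewrite E; field.
  apply: gen; rewrite ?gt_eqF//.
  by rewrite /h mulfVK ?gt_eqF// mulr2n; ring.
have p2 := pi_ge2 R.
rewrite ler_pdivlMr//.
have : w * (1 + freq e ^+ 2) * h * (h / 32) <= 2 * h.
  by rewrite (le_trans _ hw2)// le_eqVlt; apply/orP; left; apply/eqP; ring.
have -> : 2 * h = 64 * (h / 32) by field.
have h32 : 0 < h / 32 by rewrite (divr_gt0 h0).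
rewrite (ler_pM2r h32) => /le_trans; apply; lra.
Qed.

(** Fourier coefficients of the kernel on the grid of mesh [h]. *)
Definition kw (e : nat) : R := mult R e * (wt L r e / M%:R).

Lemma kw_ge0 e : 0 <= kw e.
Proof. by rewrite mulr_ge0 ?divr_ge0 ?wt_ge0//; have /andP[] := mult_bounds R e. Qed.

Lemma kw_le e : (e <= L)%N -> kw e <= 32 / D%:R / (1 + freq e ^+ 2).
Proof.
move=> eL; have /andP[m0 m2] := mult_bounds R e.
have w0 : 0 <= wt L r e / M%:R by rewrite divr_ge0 ?wt_ge0.
rewrite (le_trans (ler_pM m0 w0 m2 (wt_upper eL)))// !mulrA -natrM.
by [].
Qed.

Lemma sum_harmonic N : \sum_(1 <= e < N.+1) (e%:R : R)^-1 <= 1 + ln N%:R.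
Proof.
case: N => [|N]; first by rewrite big_geq// ln0// addr0.
elim: N => [|N IH]; first by rewrite big_nat1 invr1 ln1 addr0.
rewrite big_nat_recr//= (le_trans (lerD IH (lexx _)))// -addrA lerD2l -lerBrDl.
exact: ln_succB_ge.
Qed.

(** On the grid the only error is the periodisation; off the grid, rounding [v] to a
    multiple of [h] costs [h] times the first moment of the coefficients, which is only of
    size [ln L] by [kw_le]. *)
Lemma kernel_approx v : 0 <= v -> v <= D%:R ->
  `|\sum_(0 <= e < L.+1) kw e * cos (freq e * v) - expR (- v)| <=
     expR (- D%:R) + h * (1 + 32 * (1 + ln L%:R)).
Proof.
move=> v0 vD.
pose q := Num.truncn (v / h).
have vh0 : 0 <= v / h by rewrite divr_ge0// ltW.
have q1 : q%:R * h <= v by rewrite -ler_pdivlMr// truncn_le.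
have q2 : v <= q%:R * h + h.
  by rewrite -[X in _ + X]mul1r -mulrDl natr1 -ler_pdivrMr// ltW// truncnS_gt.
have p2 := pi_ge2 R.
have hM : h * M%:R = 2 * pi * D%:R by rewrite /h mulfVK ?gt_eqF// mulr2n; ring.
have qM : (q < M)%N.
  rewrite -(ltr_nat R) -(ltr_pM2l h0) hM mulrC (le_lt_trans q1)// (le_lt_trans vD)//.
  by rewrite ltr_pMl//; lra.
have e1 : \sum_(0 <= e < L.+1) kw e * cos (freq e * (q%:R * h)) = r ^+ q + r ^+ (M - q).
  apply: (@mulfI _ (M%:R : R)); first by rewrite gt_eqF.
  rewrite -(sum_wt_cos r0 r1 qM) mulr_sumr; apply: eq_bigr => e _.
  rewrite /kw theta_freq -/M; have -> : freq e * (q%:R * h) = q%:R * (h * freq e) by ring.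
  by rewrite /kw; field; rewrite gt_eqF.
have rX k : r ^+ k = expR (- (k%:R * h)) by rewrite /r -expRM_natl mulrN.
have d1 : `|r ^+ q - expR (- v)| <= h.
  have qh0 : 0 <= q%:R * h by rewrite mulr_ge0// ltW.
  rewrite rX ger0_norm; first by rewrite (le_trans (expRN_lipschitz qh0 q1))//; lra.
  by rewrite subr_ge0 ler_expR lerN2.
have d2 : r ^+ (M - q) <= expR (- D%:R).
  rewrite rX ler_expR lerN2 natrB ?(ltnW qM)// mulrBl [M%:R * _]mulrC hM.
  have : 2 * 2 * D%:R <= 2 * pi * D%:R :> R by rewrite ler_wpM2r ?ler_wpM2l.
  by move: q1 vD DR; lra.
have d3 : `|\sum_(0 <= e < L.+1) kw e * cos (freq e * v) -
   \sum_(0 <= e < L.+1) kw e * cos (freq e * (q%:R * h))| <= h * (32 * (1 + ln L%:R)).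
  rewrite -sumrB (le_trans (ler_norm_sum _ _ _))//.
  rewrite (le_trans (_ : _ <= \sum_(0 <= e < L.+1) kw e * (freq e * h)))//.
    apply: ler_sum => e _; rewrite -mulrBr normrM (ger0_norm (kw_ge0 _)) ler_wpM2l ?kw_ge0//.
    have f0 : 0 <= freq e by rewrite divr_ge0.
    rewrite (le_trans (cos_lipschitz _ _))// -mulrBr normrM (ger0_norm f0) ler_wpM2l//.
    by rewrite ger0_norm; lra.
  rewrite big_ltn// {1}/freq mul0r mul0r mulr0 add0r.
  have -> : h * (32 * (1 + ln L%:R)) = (32 * h) * (1 + ln L%:R) by ring.
  have h32 : 0 <= 32 * h by rewrite mulr_ge0// ltW.
  rewrite (le_trans _ (ler_wpM2l h32 (sum_harmonic L)))// mulr_sumr.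
  rewrite big_nat [leRHS]big_nat; apply: ler_sum => e /andP[e0]; rewrite ltnS => eL.
  have fe : 0 < freq e by rewrite divr_gt0// ltr0n.
  have fh : 0 <= freq e * h by rewrite mulr_ge0 ?(ltW fe) ?(ltW h0).
  rewrite (le_trans (ler_wpM2r fh (kw_le eL)))//.
  have -> : 32 * h / e%:R = (32 / D%:R / freq e ^+ 2) * (freq e * h).
    by rewrite /freq; field; rewrite ?gt_eqF ?ltr0n//= gt_eqF// ltr0n.
  rewrite ler_wpM2r// ler_wpM2l ?divr_ge0// lef_pV2 ?posrE ?exprn_gt0 ?ltr_wpDr ?sqr_ge0//.
  by rewrite lerDr.
have t1 := ler_normD (r ^+ q - expR (- v)) (r ^+ (M - q)).
have r0' : 0 <= r ^+ (M - q) by rewrite exprn_ge0.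
rewrite (ger0_norm r0') in t1.
rewrite e1 in d3; set S := \sum_(_ <= _ < _) _ in d3 *.
have := ler_normD (S - (r ^+ q + r ^+ (M - q))) ((r ^+ q - expR (- v)) + r ^+ (M - q)).
have -> : S - (r ^+ q + r ^+ (M - q)) + (r ^+ q - expR (- v) + r ^+ (M - q)) = S - expR (- v) by ring.
move=> /le_trans; apply; move: d1 d2 d3 t1; lra.
Qed.

End Grid.

(** A positive trigonometric approximation of [exp (- |v|)] for [|v| <= D], standing in
    for Fourier inversion. The mesh is of order [D / L] with [L = j ^ 2] and
    [ln L <= 2 j], so the error tends to 0 as [j] grows. *)
Lemma spectral_kernel (eps : R) : 0 < eps -> exists D0 : nat, forall D, (D0 < D)%N ->
  exists (L : nat) (a : nat -> R),
   (forall e, (e <= L)%N -> 0 <= a e <= 32 / D%:R / (1 + freq D e ^+ 2)) /\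
   (forall v, `|v| <= D%:R ->
     `|\sum_(0 <= e < L.+1) a e * cos (freq D e * v) - expR (- `|v|)| <= eps).
Proof.
move=> eps0; exists (Num.truncn (2 / eps)) => D hD.
have D0 : (0 < D)%N by rewrite (leq_ltn_trans _ hD).
have DR : 0 < D%:R :> R by rewrite ltr0n.
have eD : expR (- D%:R) <= eps / 2 :> R.
  have hD' : 2 / eps <= D%:R.
    by rewrite (le_trans (ltW (truncnS_gt _)))// ler_nat.
  rewrite expRN -[leRHS]invrK lef_pV2 ?posrE ?expR_gt0 ?invr_gt0 ?divr_gt0// invf_div.
  by rewrite (le_trans hD')// (le_trans _ (expR_ge1Dx _))// lerDr.
(* the mesh error in [kernel_approx] is at most [h * j * 97] once [ln L <= 2 * j]: 97 =
   1 + 32 * 3 *)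
pose c : R := 97; have c97 : c = 97 by [].
pose B : R := 8 * D%:R + 8 * c * D%:R / eps.
pose j := (Num.truncn B).+1.
have jR : 0 < j%:R :> R by rewrite ltr0n.
have j1 : 1 <= j%:R :> R by rewrite ler1n.
have jB : B <= j%:R by rewrite ltW// truncnS_gt.
have c0 : 0 < c by rewrite c97.
have B1 : 8 * D%:R <= j%:R :> R.
  by rewrite (le_trans _ jB)// /B lerDl divr_ge0 ?(ltW eps0)// !mulr_ge0// ltW.
have B2 : 8 * c * D%:R <= j%:R * eps.
  rewrite -ler_pdivrMr// (le_trans _ jB)// /B lerDr mulr_ge0//.
pose L := (j ^ 2)%N; have LR : L%:R = j%:R ^+ 2 :> R by rewrite natrX.
pose h : R := pi *+ 2 * D%:R / (2 * L).+1%:R.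
have hle : h * j%:R ^+ 2 <= 4 * D%:R.
  have p4 : pi <= 4 :> R by have := pihalf_lt2 R; lra.
  have lz : 0 < (2 * L).+1%:R :> R by rewrite ltr0n.
  rewrite /h mulrAC ler_pdivrMr// -[(2 * L).+1%:R]natr1 natrM LR.
  have : 0 <= j%:R ^+ 2 * D%:R :> R by rewrite mulr_ge0// sqr_ge0.
  have : pi * (j%:R ^+ 2 * D%:R) <= 4 * (j%:R ^+ 2 * D%:R) :> R.
    by rewrite ler_wpM2r// mulr_ge0// sqr_ge0.
  by rewrite mulr2n; set J := j%:R ^+ 2 : R; have := ltW DR; nra.
have h0 : 0 <= h by rewrite divr_ge0// mulr_ge0// mulrn_wge0// pi_ge0.
have hj : h * j%:R * (2 * c) <= eps.
  have : h * j%:R ^+ 2 * (2 * c) <= j%:R * eps.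
    rewrite (le_trans _ B2)//.
    have -> : 8 * c * D%:R = 4 * D%:R * (2 * c) by ring.
    by rewrite ler_wpM2r// mulr_ge0// ltW.
  have -> : h * j%:R ^+ 2 * (2 * c) = j%:R * (h * j%:R * (2 * c)) by ring.
  by rewrite ler_pM2l.
have h2 : h <= 1 / 2.
  have : h * j%:R ^+ 2 <= j%:R / 2 by rewrite (le_trans hle)//; lra.
  have -> : h * j%:R ^+ 2 = j%:R * (h * j%:R) by ring.
  have -> : j%:R / 2 = j%:R * (1 / 2) :> R by ring.
  by rewrite ler_pM2l// => hh; rewrite (le_trans _ hh)// ler_peMr.
exists L, (kw D L); split=> [e eL|v vD]; first by rewrite kw_ge0//= kw_le.
have -> : \sum_(0 <= e < L.+1) kw D L e * cos (freq D e * v) =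
   \sum_(0 <= e < L.+1) kw D L e * cos (freq D e * `|v|).
  apply: eq_bigr => e _; rewrite -[in LHS]cos_norm normrM ger0_norm// divr_ge0//.
rewrite (le_trans (kernel_approx D0 h2 _ vD))//.
have lnL : ln L%:R <= 2 * j%:R :> R.
  rewrite LR lnXn// -[leLHS]mulr_natl ler_wpM2l// ltW// ln_sublinear//.
have : h * (1 + 32 * (1 + ln L%:R)) <= h * (j%:R * c).
  by rewrite ler_wpM2l// c97; lra.
rewrite -/h => hh; move: eD hj; rewrite mulrA in hh.
lra.
Qed.

End SpectralKernel.

(** * Plancherel inequality and large sieve *)

Section QuadraticForms.
Variable R : realType.
Local Notation C := R[i].
Implicit Types (x b : nat -> C) (v : nat -> R) (t : R).

(** With [v j] proportional to [ln j], a Dirichlet polynomial on a vertical line. *)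
Definition trig (N : nat) x v t : C := \sum_(1 <= j < N.+1) x j * cis (- (t * v j)).

Lemma conjcM (a b : C) : (a * b)^*%C = a^*%C * b^*%C.
Proof. exact: rmorphM. Qed.

Lemma quad_expand N x v t : cabs (trig N x v t) ^+ 2 =
  \sum_(1 <= j < N.+1) \sum_(1 <= k < N.+1) Re (x j * (x k)^*%C * cis (- (t * (v j - v k)))).
Proof.
rewrite cabs_sqrE rmorph_sum/= big_distrlr/= Re_sum; apply: eq_bigr => j _.
rewrite Re_sum; apply: eq_bigr => k _; congr Re.
rewrite conjcM -cisN opprK.
have -> : - (t * (v j - v k)) = - (t * v j) + t * v k by ring.
by rewrite cisD; ring.
Qed.

Lemma Re_mul_cisD (z : C) t : Re (z * cis (- t)) + Re (z * cis t) = 2 * (Re z * cos t).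
Proof. by case: z => c d; rewrite /cis cosN sinN /=; ring. Qed.

Lemma quad_sym N x v t : cabs (trig N x v t) ^+ 2 + cabs (trig N x v (- t)) ^+ 2 =
  2 * \sum_(1 <= j < N.+1) \sum_(1 <= k < N.+1) Re (x j * (x k)^*%C) * cos (t * (v j - v k)).
Proof.
rewrite !quad_expand -big_split/= mulr_sumr; apply: eq_bigr => j _.
rewrite -big_split/= mulr_sumr; apply: eq_bigr => k _.
by rewrite mulNr opprK Re_mul_cisD.
Qed.

Definition trig2 N x v t : R := cabs (trig N x v t) ^+ 2 + cabs (trig N x v (- t)) ^+ 2.

Lemma trig2_ge0 N x v t : 0 <= trig2 N x v t.
Proof. by rewrite addr_ge0 ?sqr_ge0. Qed.

(** Expanding the kernel into cosines turns the quadratic form into a weighted mean square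
    of the trigonometric polynomial; this inequality replaces Plancherel. *)
Lemma spectral_upper (eps : R) : 0 < eps -> exists D0 : nat, forall D, (D0 < D)%N ->
  exists L : nat, forall N x v,
  (forall j k, (0 < j <= N)%N -> (0 < k <= N)%N -> `|v j - v k| <= D%:R) ->
  \sum_(1 <= j < N.+1) \sum_(1 <= k < N.+1) Re (x j * (x k)^*%C) * expR (- `|v j - v k|) <=
  16 / D%:R * \sum_(0 <= e < L.+1) trig2 N x v (freq R D e) / (1 + freq R D e ^+ 2) +
  eps * (\sum_(1 <= j < N.+1) cabs (x j)) ^+ 2.
Proof.
move=> eps0; have [D0 hD0] := spectral_kernel eps0; exists D0 => D /hD0[L [a [ha hk]]].
exists L => N x v hv.
pose kap j k := \sum_(0 <= e < L.+1) a e * cos (freq R D e * (v j - v k)).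
have e1 : \sum_(1 <= j < N.+1) \sum_(1 <= k < N.+1) Re (x j * (x k)^*%C) * kap j k <=
   16 / D%:R * \sum_(0 <= e < L.+1) trig2 N x v (freq R D e) / (1 + freq R D e ^+ 2).
  have -> : \sum_(1 <= j < N.+1) \sum_(1 <= k < N.+1) Re (x j * (x k)^*%C) * kap j k =
     \sum_(0 <= e < L.+1) a e / 2 * trig2 N x v (freq R D e).
    rewrite (eq_bigr (fun j => \sum_(0 <= e < L.+1) \sum_(1 <= k < N.+1)
       a e * (Re (x j * (x k)^*%C) * cos (freq R D e * (v j - v k))))); last first.
      move=> j _; rewrite exchange_big/=; apply: eq_bigr => k _.
      by rewrite mulr_sumr; apply: eq_bigr => e _; rewrite mulrCA.
    rewrite exchange_big/=; apply: eq_bigr => e _.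
    rewrite /trig2 quad_sym mulrA mulfVK// mulr_sumr; apply: eq_bigr => j _.
    by rewrite mulr_sumr.
  rewrite mulr_sumr big_nat [leRHS]big_nat; apply: ler_sum => e /andP[_]; rewrite ltnS => eL.
  have /andP[a0 a1] := ha e eL.
  rewrite [leRHS]mulrCA mulrC ler_wpM2l ?trig2_ge0//.
  by rewrite ler_pdivrMr// (le_trans a1)// le_eqVlt; apply/orP; left; apply/eqP; ring.
rewrite -lerBlDl (le_trans (lerB (lexx _) e1))//.
rewrite -sumrB expr2 big_distrlr/= mulr_sumr big_nat [leRHS]big_nat.
apply: ler_sum => j /andP[j0 jN]; rewrite -sumrB mulr_sumr big_nat [leRHS]big_nat.
apply: ler_sum => k /andP[k0 kN]; rewrite -mulrBr.
have h := hk _ (hv j k _ _); rewrite j0 k0 -ltnS jN -ltnS kN in h.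
have {}h := h isT isT; rewrite -/(kap j k) distrC in h.
rewrite (le_trans (ler_norm _))// normrM [eps * _]mulrC ler_pM//.
by rewrite (le_trans (normr_Re_le_cabs _))// cabsM cabs_conj.
Qed.

(** The exponential sum produced by averaging over differences of a block of frequencies;
    its square modulus is a Fejer kernel. *)
Definition geo (n : nat) t : C := \sum_(0 <= a < n) cis (a%:R * t).

Lemma geo_conj n t : (geo n t)^*%C = \sum_(0 <= a < n) cis (- (a%:R * t)).
Proof. by rewrite rmorph_sum; apply: eq_bigr => a _; rewrite cisN. Qed.

Lemma geo_le n t : cabs (geo n t) <= n%:R.
Proof.
rewrite (le_trans (ler_cabs_sum _ _ _))// (eq_bigr (fun=> 1)); last by move=> i _; exact: cabs_cis.
by rewrite big_const_nat subn0 iter_addr_0.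
Qed.

Lemma geo_mul n t : (1 - cis t) * geo n t = 1 - cis (n%:R * t).
Proof.
elim: n => [|n IH]; first by rewrite /geo big_geq// mulr0 mul0r cis0 subrr.
rewrite /geo big_nat_recr//= mulrDr IH -natr1 [in RHS]mulrDl mul1r cisD; ring.
Qed.

(** Decay of the Fejer kernel, which comes from summing the geometric series. *)
Lemma geo_sqr_le n t : `|t| <= pi -> cabs (geo n t) ^+ 2 * t ^+ 2 <= 8 ^+ 2.
Proof.
move=> tpi; have h := cabs_1B_cis_ge tpi.
have : cabs (1 - cis t) * cabs (geo n t) <= 2.
  by rewrite -cabsM geo_mul (le_trans (ler_cabsB _ _))// cabs1 cabs_cis.
have h2 : `|t| / 4 * cabs (geo n t) <= cabs (1 - cis t) * cabs (geo n t).
  by rewrite ler_wpM2r ?cabs_ge0.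
move=> h3; rewrite -[t ^+ 2]real_normK ?num_real// -exprMn.
by rewrite ler_pXn2r ?nnegrE ?mulr_ge0 ?cabs_ge0//; lra.
Qed.

Lemma sum_pairs_expand N b v n (D : R) :
  \sum_(0 <= p < n) \sum_(0 <= q < n) cabs (trig N b v ((p%:R - q%:R) / D)) ^+ 2 =
  \sum_(1 <= j < N.+1) \sum_(1 <= k < N.+1) Re (b j * (b k)^*%C) * cabs (geo n ((v j - v k) / D)) ^+ 2.
Proof.
rewrite (eq_bigr (fun p => \sum_(1 <= j < N.+1) \sum_(1 <= k < N.+1) \sum_(0 <= q < n)
  Re (b j * (b k)^*%C * cis (- ((p%:R - q%:R) / D * (v j - v k)))))); last first.
  move=> p _; rewrite (eq_bigr _ (fun q _ => quad_expand N b v _)) exchange_big/=.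
  by apply: eq_bigr => j _; rewrite exchange_big.
rewrite exchange_big/=; apply: eq_bigr => j _.
rewrite exchange_big/=; apply: eq_bigr => k _.
rewrite (eq_bigr _ (fun p _ => esym (Re_sum _ _ _))) -Re_sum.
set z := b j * _; set th := (v j - v k) / D.
have -> : \sum_(0 <= p < n) \sum_(0 <= q < n) z * cis (- ((p%:R - q%:R) / D * (v j - v k))) =
  z * rc (cabs (geo n th) ^+ 2).
  have -> : rc (cabs (geo n th) ^+ 2) = (geo n th)^*%C * geo n th.
    have := add_Re2_Im2 (geo n th); rewrite -cabs_sqr /rc => ->.
    rewrite -cabsE /rc -rmorphXn/= cabs_sqr; case: (geo n th) => c d /=.
    by simpc; congr Complex; ring.
  rewrite geo_conj big_distrlr/= mulr_sumr; apply: eq_bigr => p _.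
  rewrite mulr_sumr; apply: eq_bigr => q _; rewrite -cisD; congr (_ * cis _).
  by rewrite /th; ring.
by rewrite Re_mul_rc.
Qed.

(** Each frequency [e / D] with [e <= K] is a difference of two integers in [0, 2 K] in at
    least [K] ways. Together with positivity this replaces the smooth majorant that the
    usual proof of the large sieve inserts. *)
Lemma sum_pairs_lower (g : R -> R) K (D : R) : (forall t, 0 <= g t) ->
  K%:R * \sum_(0 <= e < K.+1) (g (e%:R / D) + g (- (e%:R / D))) <=
  2 * \sum_(0 <= p < (2 * K).+1) \sum_(0 <= q < (2 * K).+1) g ((p%:R - q%:R) / D).
Proof.
move=> g0; set n := (2 * K).+1.
have half (f : R -> R) : (forall t, 0 <= f t) ->
    K%:R * \sum_(0 <= e < K.+1) f (e%:R / D) <=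
    \sum_(0 <= q < n) \sum_(0 <= p < n) f ((p%:R - q%:R) / D).
  move=> f0; rewrite (@big_cat_nat _ _ _ K 0 n)//=; last by rewrite /n; lia.
  rewrite -[leLHS]addr0 lerD//; last by do 2 apply: sumr_ge0 => ? _.
  rewrite mulr_natl -[K in _ *+ K]subn0 -sumr_const_nat [leLHS]big_nat [leRHS]big_nat.
  apply: ler_sum => q /andP[_ qK].
  rewrite (@big_cat_nat _ _ _ q 0 n)//=; last by rewrite /n; lia.
  rewrite (@big_cat_nat _ _ _ (q + K.+1) q n)//=; [|lia|rewrite /n; lia].
  rewrite -[leLHS]add0r lerD//; first by apply: sumr_ge0.
  rewrite -[leLHS]addr0 lerD//; last by apply: sumr_ge0.
  rewrite le_eqVlt; apply/orP; left; apply/eqP.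
  rewrite -[q in RHS]add0n [RHS]big_addn add0n addKn.
  by apply: eq_bigr => e _; rewrite natrD addrK.
rewrite big_split/= mulrDr [leRHS]mulr_natl mulr2n lerD//.
  by rewrite exchange_big/=; apply: half.
rewrite (le_trans (half (fun t => g (- t)) _))//.
rewrite le_eqVlt; apply/orP; left; apply/eqP.
by apply: eq_bigr => q _; apply: eq_bigr => p _; rewrite -mulNr opprB.
Qed.

Definition gram N b v : R := \sum_(1 <= j < N.+1) \sum_(1 <= k < N.+1)
  cabs (b j) * cabs (b k) / (1 + (v j - v k) ^+ 2).

Lemma gram_ge0 N b v : 0 <= gram N b v.
Proof.
by do 2 apply: sumr_ge0 => ? _; rewrite divr_ge0 ?mulr_ge0 ?cabs_ge0// addr_ge0 ?sqr_ge0.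
Qed.

(** Majorise the frequencies by differences, then bound the resulting Fejer kernel at the
    points [v j - v k] by [K ^ 2 / (1 + (v j - v k) ^ 2)]. *)
Lemma large_sieve N b v (D K : nat) : (0 < D)%N -> (D <= K)%N ->
  (forall j k, (0 < j <= N)%N -> (0 < k <= N)%N -> `|v j - v k| <= D%:R) ->
  \sum_(0 <= e < K.+1) trig2 N b v (freq R D e) <= 2 * (3 ^+ 2 + 8 ^+ 2) * K%:R * gram N b v.
Proof.
move=> D0 DK hv; have DR : 0 < D%:R :> R by rewrite ltr0n.
have KR : 0 < K%:R :> R by rewrite ltr0n (leq_trans D0).
have K1 : 1 <= K%:R :> R by rewrite ler1n (leq_trans D0).
have DKR : D%:R <= K%:R :> R by rewrite ler_nat.
rewrite -(ler_pM2l KR).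
rewrite (le_trans (sum_pairs_lower K D%:R (fun t => sqr_ge0 (cabs (trig N b v t)))))//.
rewrite sum_pairs_expand.
have -> : K%:R * (2 * (3 ^+ 2 + 8 ^+ 2) * K%:R * gram N b v) =
  2 * ((3 ^+ 2 + 8 ^+ 2) * K%:R ^+ 2 * gram N b v) by ring.
rewrite ler_wpM2l// mulr_sumr big_nat [leRHS]big_nat; apply: ler_sum => j /andP[j0 jN].
rewrite mulr_sumr big_nat [leRHS]big_nat; apply: ler_sum => k /andP[k0 kN].
set G := cabs (geo _ _) ^+ 2; have G0 : 0 <= G by rewrite sqr_ge0.
rewrite (@le_trans _ _ (cabs (b j) * cabs (b k) * G))//.
  rewrite ler_wpM2r// (le_trans (ler_norm _))// (le_trans (normr_Re_le_cabs _))//.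
  by rewrite cabsM cabs_conj.
rewrite [leRHS]mulrCA ler_wpM2l ?mulr_ge0 ?cabs_ge0// ler_pdivlMr; last first.
  by rewrite ltr_wpDr ?sqr_ge0.
set th := (v j - v k) / D%:R in G G0 *.
have vth : v j - v k = D%:R * th by rewrite /th mulrC mulfVK ?gt_eqF.
have thpi : `|th| <= pi.
  rewrite /th normrM normfV (ger0_norm (ltW DR)) ler_pdivrMr//.
  rewrite (le_trans (hv j k _ _)) ?j0 ?k0//.
  by rewrite ler_peMl// ?(ltW DR)//; have := pi_ge2 R; lra.
have h1 : G <= 3 ^+ 2 * K%:R ^+ 2.
  rewrite /G -exprMn ler_pXn2r ?nnegrE ?cabs_ge0 ?mulr_ge0// (le_trans (geo_le _ _))//.
  by rewrite -natr1 natrM; lra.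
have h2 := geo_sqr_le (2 * K).+1 thpi; rewrite -/G in h2.
rewrite vth exprMn mulrDr mulr1 mulrCA [leRHS]mulrDl lerD//.
have gt0 : 0 <= G * th ^+ 2 by rewrite mulr_ge0 ?sqr_ge0.
rewrite mulrC ler_pM ?sqr_ge0//.
by rewrite ler_pXn2r ?nnegrE// ltW.
Qed.

(** Frequencies [t] are sorted into the ranges [t <= 4 ^ i]; there the weight
    [sqrt (1 + 2 t) / (1 + t ^ 2)] is of size [8 ^ (- i)], against a large sieve bound of
    size [4 ^ i], so the ranges sum like [2 ^ (- i)]. *)
Lemma weight_pick (D e : nat) : (0 < D)%N -> exists2 i : nat, (e <= 4 ^ i * D)%N &
  Num.sqrt (1 + 2 * freq R D e) / (1 + freq R D e ^+ 2) <= 32 / 8 ^+ i /\ (i <= e)%N.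
Proof.
move=> D0; have DR : 0 < D%:R :> R by rewrite ltr0n.
set t := freq R D e; have t0 : 0 <= t by rewrite divr_ge0.
have P : exists i, (e <= 4 ^ i * D)%N.
  exists e; rewrite (leq_trans (ltnW (ltn_expl e (isT : 1 < 4)%N)))// leq_pmulr//.
have qq : 0 < 1 + t ^+ 2 by rewrite ltr_wpDr ?sqr_ge0.
case: (ex_minnP P) => i hi imin; exists i => //; split; last first.
  by apply: imin; rewrite (leq_trans (ltnW (ltn_expl e (isT : 1 < 4)%N)))// leq_pmulr.
have ti : t <= 4 ^+ i by rewrite /t ler_pdivrMr// -natrX -natrM ler_nat.
have i1 : 1 <= 4 ^+ i :> R by rewrite exprn_ege1// ler1n.
have s1 : Num.sqrt (1 + 2 * t) <= 2 * 2 ^+ i.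
  rewrite -[leRHS]ger0_norm ?mulr_ge0 ?exprn_ge0// -sqrtr_sqr ler_wsqrtr//.
  rewrite exprMn exprAC; have -> : (2 : R) ^+ 2 = 4 by ring.
  lra.
rewrite ler_pdivrMr// (le_trans s1)//.
have e8 : 2 * 2 ^+ i = 32 / 8 ^+ i * (16 ^+ i / 16) :> R.
  have -> : (16 : R) ^+ i = 8 ^+ i * 2 ^+ i by rewrite -exprMn; congr (_ ^+ _); ring.
  by field; rewrite expf_neq0// pnatr_eq0.
rewrite e8 ler_wpM2l ?divr_ge0 ?exprn_ge0//.
case: i hi imin {ti i1 s1 e8} => [|i] hi imin.
  by rewrite expr0; have := sqr_ge0 t; lra.
have : ~~ (e <= 4 ^ i * D)%N by apply/negP => /imin; rewrite ltnn.
rewrite -ltnNge => hl.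
have tl : 4 ^+ i <= t by rewrite /t ler_pdivlMr// -natrX -natrM ler_nat ltnW.
have : (4 ^+ i) ^+ 2 <= t ^+ 2 by rewrite ler_pXn2r ?nnegrE// exprn_ge0.
rewrite exprAC; have -> : (4 : R) ^+ 2 = 16 by ring.
rewrite [16 ^+ i.+1]exprS [16 * _]mulrC mulfK ?pnatr_eq0//; lra.
Qed.

Lemma sum_half_powers I : \sum_(0 <= i < I) (2 ^+ i)^-1 <= 2 :> R.
Proof.
suff : \sum_(0 <= i < I) (2 ^+ i)^-1 = 2 - 2 / 2 ^+ I :> R.
  by move=> ->; rewrite gerBl divr_ge0// exprn_ge0.
elim: I => [|I IH]; first by rewrite big_geq// expr0 divr1 subrr.
by rewrite big_nat_recr//= IH exprS; field; rewrite expf_neq0// pnatr_eq0.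
Qed.

Lemma weighted_large_sieve : exists2 Cst : R, 0 < Cst & forall N b v (D L : nat), (0 < D)%N ->
  (forall j k, (0 < j <= N)%N -> (0 < k <= N)%N -> `|v j - v k| <= D%:R) ->
  \sum_(0 <= e < L.+1) Num.sqrt (1 + 2 * freq R D e) / (1 + freq R D e ^+ 2) *
     trig2 N b v (freq R D e) <= Cst * D%:R * gram N b v.
Proof.
pose c : R := 2 * (3 ^+ 2 + 8 ^+ 2).
have c0 : 0 < c by rewrite /c mulr_gt0// addr_gt0// exprn_gt0.
exists (32 * c * 2); first by rewrite !mulr_gt0.
move=> N b v D L D0 hv.
rewrite (@le_trans _ _ (\sum_(0 <= e < L.+1) \sum_(0 <= i < L.+1)
   (32 / 8 ^+ i) * (if (e <= 4 ^ i * D)%N then trig2 N b v (freq R D e) else 0)))//.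
  rewrite big_nat [leRHS]big_nat; apply: ler_sum => e /andP[_ eL].
  have [i hi [hw ie]] := weight_pick e D0.
  rewrite (bigD1_seq i) ?iota_uniq ?mem_index_iota/= ?(leq_ltn_trans ie)// hi.
  rewrite -[leLHS]addr0 lerD ?ler_wpM2r ?trig2_ge0//.
  apply: sumr_ge0 => k _; rewrite mulr_ge0 ?divr_ge0 ?exprn_ge0//.
  by case: ifP => // _; exact: trig2_ge0.
rewrite exchange_big/=.
rewrite (@le_trans _ _ (\sum_(0 <= i < L.+1) 32 * c * D%:R * gram N b v * (2 ^+ i)^-1))//; last first.
  rewrite -mulr_sumr.
  have g0 : 0 <= 32 * c * D%:R * gram N b v.
    by rewrite !mulr_ge0 ?gram_ge0// ltW.
  rewrite (le_trans (ler_wpM2l g0 (sum_half_powers _)))//.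
  by rewrite le_eqVlt; apply/orP; left; apply/eqP; ring.
apply: ler_sum => i _; rewrite -mulr_sumr.
have K0 : (D <= 4 ^ i * D)%N by rewrite leq_pmull// expn_gt0.
have := large_sieve b D0 K0 hv; rewrite -/c => h.
have e8 : (8 : R) ^+ i = 4 ^+ i * 2 ^+ i by rewrite -exprMn; congr (_ ^+ _); ring.
have -> : 32 * c * D%:R * gram N b v * (2 ^+ i)^-1 =
   (32 / 8 ^+ i) * (c * (4 ^ i * D)%:R * gram N b v).
  by rewrite natrM natrX e8; field; rewrite ?expf_neq0 ?pnatr_eq0.
rewrite ler_wpM2l ?divr_ge0 ?exprn_ge0// (le_trans _ h)//.
set K := (4 ^ i * D)%N.
have [LK|KL] := leqP L K.
  rewrite [leRHS](@big_cat_nat _ _ _ L.+1)//= -[leLHS]addr0 lerD//; last first.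
    by apply: sumr_ge0 => e _; exact: trig2_ge0.
  apply: ler_sum => e _; case: ifP => // _; exact: trig2_ge0.
rewrite (@big_cat_nat _ _ _ K.+1 0 L.+1)//=; last by rewrite ltnS ltnW.
rewrite -[leRHS]addr0 lerD//.
  by apply: ler_sum => e _; case: ifP => // _; exact: trig2_ge0.
by rewrite big_nat big1// => e /andP[Ke _]; rewrite leqNgt Ke.
Qed.

End QuadraticForms.

(** * The diagonal estimate over prime powers *)

Section MangoldtGram.
Variable R : realType.
Local Notation C := R[i].
Local Notation Lam := (vonMangoldt R).

Definition blk (k : nat) : nat := trunc_log 2 k.

Lemma sum_by_block (F : nat -> R) N :
  \sum_(1 <= k < N.+1) F k = \sum_(0 <= g < N.+1) \sum_(1 <= k < N.+1 | blk k == g) F k.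
Proof.
under [RHS]eq_bigr do rewrite big_mkcond/=.
rewrite exchange_big/= !big_nat; apply: eq_bigr => k /andP[k0 kN].
have bk : (blk k < N.+1)%N.
  have /andP[h1 _] := trunc_log_bounds (isT : 1 < 2)%N k0.
  have := ltn_expl (trunc_log 2 k) (isT : 1 < 2)%N; rewrite /blk; lia.
rewrite (bigD1_seq (blk k)) ?mem_index_iota ?iota_uniq//= eqxx big1 ?addr0// => g.
by rewrite eq_sym => /negbTE->.
Qed.

Lemma block_psi N g : \sum_(1 <= k < N.+1 | blk k == g) Lam k <= 8 * 2 ^+ g.
Proof.
have h : \sum_(1 <= k < N.+1 | blk k == g) Lam k <= psi R (2 ^ g.+1).
  have [Ng|gN] := leqP N (2 ^ g.+1).
    rewrite (le_trans _ (psi_mono R Ng))// /psi big_mkcond; apply: ler_sum => k _.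
    by case: ifP => // _; exact: vonMangoldt_ge0.
  rewrite (@big_cat_nat _ _ _ (2 ^ g.+1).+1)//=; last by rewrite ltnS ltnW.
  rewrite [X in _ + X]big_nat_cond [X in _ + X]big1 ?addr0; last first.
    move=> k /andP[/andP[k1 _] /eqP bk].
    have /andP[_] := trunc_log_bounds (isT : 1 < 2)%N (leq_ltn_trans (leq0n _) k1).
    by rewrite -/(blk k) bk => k2; move: k1; rewrite ltnNge ltnW.
  rewrite /psi big_mkcond; apply: ler_sum => k _.
  by case: ifP => // _; exact: vonMangoldt_ge0.
rewrite (le_trans h)// (le_trans (psi_le R _))// natrX exprS.
by rewrite le_eqVlt; apply/orP; left; apply/eqP; ring.
Qed.

Lemma block_sum N g (d : R) : 0 < d ->
  \sum_(1 <= k < N.+1 | blk k == g) Lam k * npow (1 + d) k <= 8 * npow d (2 ^ g).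
Proof.
move=> d0.
rewrite (@le_trans _ _ (\sum_(1 <= k < N.+1 | blk k == g) Lam k * ((2 ^+ g)^-1 * npow d (2 ^ g))))//.
  rewrite big_nat_cond [leRHS]big_nat_cond; apply: ler_sum => k /andP[/andP[k0 _] /eqP bk].
  have /andP[+ _] := trunc_log_bounds (isT : 1 < 2)%N k0; rewrite -/(blk k) bk => gk.
  have g0 : (0 < 2 ^ g)%N by rewrite expn_gt0.
  rewrite ler_wpM2l ?vonMangoldt_ge0// npowD ler_pM ?npow_ge0//.
    by rewrite npow_one// lef_pV2 ?posrE ?ltr0n// ?exprn_gt0// -natrX ler_nat.
  by rewrite npow_anti// ltW.
rewrite -mulr_suml mulrA ler_wpM2r ?npow_ge0// ler_pdivrMr ?exprn_gt0//.
exact: block_psi.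
Qed.

Lemma ln2_ge : 1 / 2 <= ln 2 :> R.
Proof. by have := ln_succB_ge R (isT : (0 < 1)%N); rewrite ln1 subr0; lra. Qed.

(** The Chebyshev bound on each dyadic block, then a geometric series of ratio
    [2 ^ (- d)]. *)
Lemma sum_mangoldt_npow N (d : R) : 0 < d -> d <= 1 ->
  \sum_(1 <= k < N.+1) Lam k * npow (1 + d) k <= 32 / d.
Proof.
move=> d0 d1; rewrite sum_by_block.
pose q := npow d 2.
have q0 : 0 < q by exact: npow_gt0.
have qd : d / 4 <= 1 - q.
  rewrite /q /npow; set y := d * ln 2%:R.
  have l2 := ln2_ge.
  have l1 : ln 2 <= 1 :> R by have := @le_ln1Dx R 1; apply; rewrite (@lt_trans _ _ 0).
  have y1 : d / 2 <= y by rewrite /y; nra.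
  have y2 : y <= 1 by rewrite /y -[leRHS]mulr1 ler_pM ?(ltW d0)//; lra.
  have h : expR (- y) <= (1 + y)^-1.
    by rewrite expRN lef_pV2 ?posrE ?expR_gt0 ?expR_ge1Dx//; lra.
  have : (1 + y)^-1 <= 1 - y / 2.
    by rewrite -[leLHS]mul1r ler_pdivrMr; [nra|lra].
  lra.
have qX g : npow d (2 ^ g) = q ^+ g.
  by rewrite /q /npow -expRM_natl natrX lnXn// -mulr_natl; congr expR; ring.
rewrite (@le_trans _ _ (\sum_(0 <= g < N.+1) 8 * q ^+ g))//.
  by apply: ler_sum => g _; rewrite -qX block_sum.
rewrite -mulr_sumr.
have q1 : 0 < 1 - q by rewrite (lt_le_trans _ qd)// divr_gt0.
have : (1 - q) * \sum_(0 <= g < N.+1) q ^+ g <= 1.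
  have := subrX1 q N.+1; rewrite big_mkord => h.
  by rewrite -[1 - q]opprB mulNr -h opprB gerBl exprn_ge0// ltW.
rewrite -ler_pdivlMl// mulr1 => h.
rewrite (le_trans (ler_wpM2l _ h))//.
have : (1 - q)^-1 <= (d / 4)^-1 by rewrite lef_pV2 ?posrE ?divr_gt0.
rewrite invf_div => h2; rewrite (le_trans (ler_wpM2l _ h2))//.
by rewrite mulrA -natrM.
Qed.

Definition bdist (a b : nat) : nat := (maxn a b - minn a b)%N.

(** Logarithms in dyadic blocks at distance [b] differ by at least [(b - 1) * ln 2], and
    [ln 2 >= 1 / 2]. *)
Lemma ln_block_dist j k : (0 < j)%N -> (0 < k)%N ->
  (1 + (ln (j%:R : R) - ln k%:R) ^+ 2)^-1 <= 16 / (1 + (bdist (blk j) (blk k))%:R) ^+ 2.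
Proof.
wlog jk : j k / (blk j <= blk k)%N.
  move=> h j0 k0; have [|/ltnW] := leqP (blk j) (blk k); first by move=> /h; apply.
  by move=> /h/(_ k0 j0); rewrite -opprB sqrrN /bdist maxnC minnC.
move=> j0 k0.
have /andP[_ h1] := trunc_log_bounds (isT : 1 < 2)%N j0.
have /andP[h2 _] := trunc_log_bounds (isT : 1 < 2)%N k0.
rewrite -/(blk j) in h1; rewrite -/(blk k) in h2.
have l2 := ln2_ge.
set D := bdist _ _; have eD : blk k = (blk j + D)%N by rewrite /D /bdist; lia.
have lj : ln (j%:R : R) <= (blk j).+1%:R * ln 2.
  by rewrite mulr_natl -lnXn// ler_ln ?posrE ?ltr0n ?exprn_gt0// -natrX ler_nat ltnW.
have lk : (blk k)%:R * ln 2 <= ln (k%:R : R).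
  by rewrite mulr_natl -lnXn// ler_ln ?posrE ?ltr0n ?exprn_gt0// -natrX ler_nat.
have lkj : (D%:R - 1) * ln 2 <= ln (k%:R : R) - ln j%:R.
  have l20 : 0 <= ln 2 :> R by lra.
  rewrite (le_trans _ (lerB lk lj))// -mulrBl ler_wpM2r//.
  by rewrite eD -[(blk j).+1%:R]natr1 natrD; lra.
have D1 : 0 < 1 + D%:R :> R by rewrite ltr_pwDl.
rewrite -[leLHS]mul1r ler_pdivrMr; last by rewrite ltr_wpDr ?sqr_ge0.
rewrite mulrAC ler_pdivlMr ?exprn_gt0// mul1r -opprB sqrrN.
set x := ln _ - ln _ in lkj *.
case: D eD lkj D1 => [|D] eD lkj D1; first by rewrite addr0 expr1n; have := sqr_ge0 x; lra.
have x1 : D%:R / 2 <= x.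
  rewrite (le_trans _ lkj)// -[D.+1%:R]natr1 addrK ler_wpM2l//; lra.
have x2 : (D%:R / 2) ^+ 2 <= x ^+ 2.
  by rewrite ler_pXn2r ?nnegrE ?divr_ge0// (le_trans _ x1)// divr_ge0.
rewrite -[D.+1%:R]natr1; set y : R := D%:R in x2 *.
have e4 : (y / 2) ^+ 2 = y ^+ 2 / 4 by field.
rewrite e4 in x2.
(* [(y + 2) ^ 2 <= 16 * (1 + y ^ 2 / 4)] amounts to [0 <= 3 * y ^ 2 - 4 * y + 12] *)
have := sqr_ge0 (3 * y - 2); nra.
Qed.

Lemma sum_bdist N b : \sum_(0 <= g < N) ((1 + (bdist b g)%:R) ^+ 2)^-1 <= 4 :> R.
Proof.
have up M : \sum_(0 <= i < M) ((1 + i%:R) ^+ 2)^-1 <= 2 :> R.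
  rewrite (le_trans _ (sum_inv_sqr_le R M))// big_add1/= le_eqVlt; apply/orP; left; apply/eqP.
  by apply: eq_bigr => i _; rewrite addrC natr1.
have pos g : 0 <= ((1 + (bdist b g)%:R) ^+ 2)^-1 :> R by rewrite invr_ge0 sqr_ge0.
rewrite (@le_trans _ _ (\sum_(0 <= g < b + N) ((1 + (bdist b g)%:R) ^+ 2)^-1))//.
  rewrite [leRHS](@big_cat_nat _ _ _ N)//= ?leq_addl// lerDl.
  by apply: sumr_ge0.
rewrite (@big_cat_nat _ _ _ b)//= ?leq_addr//.
have -> : 4 = 2 + 2 :> R by ring.
rewrite lerD//.
  rewrite big_nat_rev/= add0n (le_trans _ (up b))// big_nat [leRHS]big_nat.
  apply: ler_sum => i /andP[_ ib]; rewrite lef_pV2 ?posrE ?exprn_gt0 ?ltr_pwDl//.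
  rewrite ler_pXn2r ?nnegrE ?addr_ge0// lerD2l ler_nat /bdist; lia.
rewrite (le_trans _ (up N))// -{1}[b]add0n big_addn addKn le_eqVlt; apply/orP; left; apply/eqP.
apply: eq_bigr => i _; rewrite /bdist.
by have -> : (maxn b (i + b) - minn b (i + b) = i)%N by lia.
Qed.

(** Only [|ln j - ln k| = O(1)] matters: the sum over [k] for fixed [j] is bounded block
    by block by the Chebyshev estimate, and the sum over [j] is then [O(1 / d)]. *)
Lemma gram_mangoldt N (b : nat -> C) (v : nat -> R) (d : R) : 0 < d -> d <= 1 ->
  (forall j, (0 < j <= N)%N -> cabs (b j) <= Lam j * npow (1 + d) j) ->
  (forall j k, (0 < j <= N)%N -> (0 < k <= N)%N ->
     (ln j%:R - ln k%:R) ^+ 2 <= (v j - v k) ^+ 2) ->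
  gram N b v <= (16 * (4 * 8)) * (32 / d).
Proof.
move=> d0 d1 hb hv.
rewrite (le_trans _ (ler_wpM2l _ (sum_mangoldt_npow N d0 d1)))// /gram mulr_sumr.
rewrite big_nat [leRHS]big_nat; apply: ler_sum => j /andP[j0 jN].
have jN' : (0 < j <= N)%N by rewrite j0.
rewrite (@le_trans _ _ (cabs (b j) * \sum_(1 <= k < N.+1) cabs (b k) / (1 + (v j - v k) ^+ 2)))//.
  by rewrite mulr_sumr; apply: ler_sum => k _; rewrite mulrA.
rewrite [leRHS]mulrC ler_pM ?cabs_ge0 ?hb//.
  by apply: sumr_ge0 => k _; rewrite divr_ge0 ?cabs_ge0// addr_ge0 ?sqr_ge0.
rewrite (@le_trans _ _ (\sum_(1 <= k < N.+1) 16 *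
    (Lam k * npow (1 + d) k / (1 + (bdist (blk j) (blk k))%:R) ^+ 2)))//.
  rewrite big_nat [leRHS]big_nat; apply: ler_sum => k /andP[k0 kN].
  have kN' : (0 < k <= N)%N by rewrite k0.
  rewrite [leRHS]mulrCA ler_pM ?cabs_ge0 ?hb// ?invr_ge0 ?addr_ge0 ?sqr_ge0//.
  rewrite (le_trans _ (ln_block_dist j0 k0))// lef_pV2 ?posrE ?lerD2l ?hv//.
    by rewrite ltr_wpDr ?sqr_ge0.
  by rewrite ltr_wpDr ?sqr_ge0.
rewrite -mulr_sumr ler_wpM2l// sum_by_block.
rewrite (le_trans _ (ler_wpM2r (ler0n _ 8) (sum_bdist N.+1 (blk j))))// mulr_suml.
apply: ler_sum => g _.
rewrite (eq_bigr (fun k => (Lam k * npow (1 + d) k) * ((1 + (bdist (blk j) g)%:R) ^+ 2)^-1)); last first.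
  by move=> k /eqP ->.
rewrite -mulr_suml mulrC ler_wpM2l ?invr_ge0 ?sqr_ge0//.
by rewrite (le_trans (block_sum _ _ d0))// ler_piMr// npow_le1// ltW.
Qed.

End MangoldtGram.

(** * The energy of a summatory function as a quadratic form *)

Section Energy.
Variable R : realType.
Local Notation C := R[i].
Local Notation Lam := (vonMangoldt R).
Implicit Types (d : R) (a : nat -> C).

Definition psum a n : C := \sum_(1 <= k < n.+1) a k.

(** Abel summation in two variables: the partial double sums of [a j * (a k)^*] are the
    [cabs (psum a n) ^+ 2]. *)
Lemma max_kernel_abel a (g : nat -> R) N :
  \sum_(1 <= j < N.+1) \sum_(1 <= k < N.+1) Re (a j * (a k)^*%C) * g (maxn j k) =
  \sum_(1 <= n < N.+1) (g n - g n.+1) * cabs (psum a n) ^+ 2 + g N.+1 * cabs (psum a N) ^+ 2.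
Proof.
have sq M : cabs (psum a M) ^+ 2 = \sum_(1 <= j < M.+1) \sum_(1 <= k < M.+1) Re (a j * (a k)^*%C).
  rewrite cabs_sqrE /psum rmorph_sum/= big_distrlr/= Re_sum.
  by apply: eq_bigr => j _; rewrite Re_sum.
elim: N => [|N IH].
  by rewrite !big_geq// /psum big_geq// cabs0 expr0n/= mulr0 addr0.
have split2 (F : nat -> nat -> R) :
   \sum_(1 <= j < N.+2) \sum_(1 <= k < N.+2) F j k =
   \sum_(1 <= j < N.+1) \sum_(1 <= k < N.+1) F j k +
   (\sum_(1 <= j < N.+1) F j N.+1 + \sum_(1 <= k < N.+2) F N.+1 k).
  rewrite big_nat_recr//= addrA -big_split/=; congr (_ + _).
  by apply: eq_bigr => j _; rewrite big_nat_recr.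
have key : \sum_(1 <= j < N.+1) Re (a j * (a N.+1)^*%C) * g (maxn j N.+1) +
    \sum_(1 <= k < N.+2) Re (a N.+1 * (a k)^*%C) * g (maxn N.+1 k) =
    g N.+1 * (cabs (psum a N.+1) ^+ 2 - cabs (psum a N) ^+ 2).
  rewrite !sq split2 addrAC subrr add0r mulrDr !mulr_sumr.
  congr (_ + _); rewrite !big_nat; apply: eq_bigr => j /andP[_ jN].
    by rewrite (maxn_idPr _) 1?mulrC// ltnW.
  by rewrite (maxn_idPl _) 1?mulrC.
rewrite split2 IH key [in RHS]big_nat_recr//=; ring.
Qed.

(** In logarithmic coordinates [maxn] is half of sum plus distance. *)
Lemma npow_max d j k : 0 <= d -> (0 < j)%N -> (0 < k)%N ->
  npow (2 * d) (maxn j k) = npow d j * npow d k * expR (- `|d * ln j%:R - d * ln k%:R|).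
Proof.
move=> d0; wlog jk : j k / (j <= k)%N.
  move=> h j0 k0; have /orP[/h|/h] := leq_total j k; first by apply.
  by move=> /(_ k0 j0); rewrite maxnC => ->; rewrite distrC [npow d k * _]mulrC.
move=> j0 k0.
rewrite (maxn_idPr jk) /npow -!expRD; congr expR.
have l : ln j%:R <= ln k%:R :> R by rewrite ler_ln ?posrE ?ltr0n// ler_nat.
by rewrite distrC ger0_norm ?subr_ge0 ?ler_wpM2l//; ring.
Qed.

(** The integral of [2 * (1 + d) * |psum a x| ^ 2 * x ^ (- 3 - 2 d)] for [x] from 1 to
    [N.+1], where [psum a] is a step function. *)
Definition energy d a N : R :=
  \sum_(1 <= n < N.+1) (npow (2 * (1 + d)) n - npow (2 * (1 + d)) n.+1) * cabs (psum a n) ^+ 2.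

Lemma energy_term_ge0 d a n : 0 < d -> (0 < n)%N ->
  0 <= (npow (2 * (1 + d)) n - npow (2 * (1 + d)) n.+1) * cabs (psum a n) ^+ 2.
Proof. by move=> d0 n0; rewrite mulr_ge0 ?sqr_ge0// subr_ge0 npow_anti//; lra. Qed.

Lemma energy_mono d a N N' : 0 < d -> (N <= N')%N -> energy d a N <= energy d a N'.
Proof.
move=> d0 NN; rewrite /energy (@big_cat_nat _ _ _ N.+1 1 N'.+1)//= lerDl big_nat.
by apply: sumr_ge0 => n /andP[n0 _]; rewrite energy_term_ge0// (leq_ltn_trans _ n0).
Qed.

Lemma energy_le_form d a N : 0 < d ->
  let x j := a j * rc (npow (1 + d) j) in
  let v (j : nat) := (1 + d) * ln j%:R in
  energy d a N <=
  \sum_(1 <= j < N.+1) \sum_(1 <= k < N.+1) Re (x j * (x k)^*%C) * expR (- `|v j - v k|).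
Proof.
rewrite /= => d0; have s0 : 0 <= 1 + d by lra.
have -> : \sum_(1 <= j < N.+1) \sum_(1 <= k < N.+1)
   Re (a j * rc (npow (1 + d) j) * (a k * rc (npow (1 + d) k))^*%C) *
   expR (- `|(1 + d) * ln j%:R - (1 + d) * ln k%:R|) =
   \sum_(1 <= j < N.+1) \sum_(1 <= k < N.+1) Re (a j * (a k)^*%C) * npow (2 * (1 + d)) (maxn j k).
  rewrite !big_nat; apply: eq_bigr => j /andP[j0 _].
  rewrite !big_nat; apply: eq_bigr => k /andP[k0 _].
  rewrite (npow_max s0 j0 k0).
  rewrite conjcM [(rc _)^*%C]/= oppr0.
  have -> : a j * rc (npow (1 + d) j) * ((a k)^*%C * Complex (npow (1 + d) k) 0) =
    (a j * (a k)^*%C) * rc (npow (1 + d) j * npow (1 + d) k) by rewrite rcM -[Complex _ 0]/(rc _); ring.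
  by rewrite Re_mul_rc; ring.
rewrite max_kernel_abel -[leLHS]addr0 lerD// mulr_ge0 ?sqr_ge0// npow_ge0//.
Qed.

Lemma log_npow_small d (eps c : R) : 0 < d -> 0 < eps -> 0 < c ->
  exists N0 : nat, (0 < N0)%N /\ forall N, (N0 <= N)%N -> c * npow d N * (ln N%:R + 4) <= eps.
Proof.
move=> d0 e0 c0; have d2 : 0 < d / 2 by rewrite divr_gt0.
pose c' := c * (2 / d + 4).
have c'0 : 0 < c' by rewrite mulr_gt0// addr_gt0// divr_gt0.
have [N0 [N00 h]] := npow_small d2 (divr_gt0 e0 c'0).
exists N0; split=> // N /h{}h.
have -> : npow d N = npow (d / 2) N * npow (d / 2) N by rewrite -npowD -splitr.
set q := npow (d / 2) N in h *.
have q0 : 0 < q := npow_gt0 _ _.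
have q1 : q <= 1 by rewrite npow_le1// ltW.
have l0 : 0 <= ln N%:R :> R by rewrite ln_nat_ge0.
have ql : q * ln N%:R <= 2 / d.
  have : d / 2 * ln N%:R * q <= 1.
    rewrite /q /npow expRN ler_pdivrMr ?expR_gt0// mul1r.
    by rewrite (le_trans _ (expR_ge1Dx _))// lerDr.
  by rewrite -mulrA -ler_pdivlMl ?divr_gt0// mulr1 invf_div mulrC.
have : q * (ln N%:R + 4) <= 2 / d + 4 by rewrite mulrDr lerD// ler_piMl.
move=> h2; have h3 : c * (q * (q * (ln N%:R + 4))) <= c * (q * (2 / d + 4)).
  by rewrite ler_wpM2l ?(ltW c0)// ler_wpM2l// ltW.
have -> : c * (q * q) * (ln N%:R + 4) = c * (q * (q * (ln N%:R + 4))) by ring.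
rewrite (le_trans h3)//.
have -> : c * (q * (2 / d + 4)) = q * c' by rewrite /c'; ring.
by rewrite -ler_pdivlMr.
Qed.

Lemma npow_floor d N k : 0 < d -> (0 < k <= N)%N ->
  npow d (N %/ k) <= npow d N * (npow d (2 * k))^-1.
Proof.
move=> d0 /andP[k0 kN]; have N0 : (0 < N)%N by rewrite (leq_trans k0).
have q0 : (0 < N %/ k)%N by rewrite divn_gt0.
rewrite -ler_pdivrMr ?invr_gt0 ?npow_gt0// invrK -npowM ?muln_gt0//.
apply: npow_anti; rewrite ?(ltW d0)//.
have := ltn_ceil N k0; nia.
Qed.

(** Truncated form of [- F' = F * (- F' / F)]. The convolution identity pairs [j] with the
    sum over [e <= N %/ j]; completing it to [e <= N] costs a tail of the series, and the
    sum of all tails tends to 0 as [N] grows, uniformly in [h]. *)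
Lemma convolution_error d (eps : R) : 0 < d -> 0 < eps -> exists N0 : nat, forall N, (N0 <= N)%N ->
  forall h, ucmul h ->
  cabs (\sum_(1 <= j < N.+1) rc (ln j%:R) * h j * rc (npow (1 + d) j) -
    dsum (1 + d) h N * \sum_(1 <= j < N.+1) rc (Lam j) * h j * rc (npow (1 + d) j)) <= eps.
Proof.
move=> d0 e0; have c0 : 0 < (npow d 2)^-1 / d by rewrite divr_gt0 ?invr_gt0 ?npow_gt0.
have [N0 [N00 hN0]] := log_npow_small d0 e0 c0; exists N0 => N NN h hu.
have N0' : (0 < N)%N by rewrite (leq_trans N00).
have [[h1 hM] hn] := hu.
pose H k := h k * rc (npow (1 + d) k).
have cH : cmul H.
  split=> [|p q p0 q0]; first by rewrite /H h1 npow1 /rc rmorph1 mulr1.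
  by rewrite /H hM// npowM// rcM; ring.
have -> : \sum_(1 <= j < N.+1) rc (ln j%:R) * h j * rc (npow (1 + d) j) =
   \sum_(1 <= k < N.+1) rc (ln k%:R) * H k.
  by apply: eq_bigr => j _; rewrite mulrA.
rewrite sum_ln_convolution// mulrC mulr_suml -sumrB.
rewrite (le_trans (ler_cabs_sum _ _ _))// (le_trans _ (hN0 N NN))//.
rewrite (@le_trans _ _ (\sum_(1 <= k < N.+1) Lam k * npow (1 + d) k * (npow d (N %/ k) / d)))//.
  rewrite big_nat [leRHS]big_nat; apply: ler_sum => k /andP[k0 kN].
  have q0 : (0 < N %/ k)%N by rewrite divn_gt0.
  have -> : rc (Lam k) * H k * (\sum_(1 <= e < (N %/ k).+1) H e) -
    rc (Lam k) * h k * rc (npow (1 + d) k) * dsum (1 + d) h N =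
    - (rc (Lam k) * H k * \sum_((N %/ k).+1 <= e < N.+1) H e).
    have -> : dsum (1 + d) h N = \sum_(1 <= e < (N %/ k).+1) H e + \sum_((N %/ k).+1 <= e < N.+1) H e.
      by rewrite /dsum -/H (@big_cat_nat _ _ _ (N %/ k).+1)//= ltnS leq_div.
    by rewrite /H; ring.
  rewrite cabsN cabsM cabsM cabs_rc (ger0_norm (vonMangoldt_ge0 _ _)) cabs_term//.
  rewrite ler_wpM2l ?mulr_ge0 ?vonMangoldt_ge0 ?npow_ge0//.
  rewrite (le_trans (ler_cabs_sum _ _ _))// (le_trans _ (sum_npow_tail N d0 q0))//.
  by apply: ler_sum => e _; rewrite cabs_term.
have := sum_vonMangoldt_div R N0'.
have w0 : 0 <= (npow d 2)^-1 / d * npow d N by rewrite mulr_ge0 ?npow_ge0// ltW.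
move=> /(ler_wpM2l w0) /(le_trans _); apply.
rewrite mulr_sumr big_nat [leRHS]big_nat; apply: ler_sum => k /andP[k0 kN].
have kN' : (0 < k <= N)%N by rewrite k0.
have := npow_floor d0 kN'; rewrite npowM// invfM => hf.
rewrite -mulrA [leRHS]mulrCA ler_wpM2l ?vonMangoldt_ge0//.
have dV : 0 <= d^-1 by rewrite invr_ge0 ltW.
have hf' : npow d (N %/ k) / d <= npow d N * ((npow d 2)^-1 * (npow d k)^-1) / d by rewrite ler_wpM2r.
rewrite (le_trans (ler_wpM2l (npow_ge0 _ _) hf'))// npowD npow_one//.
rewrite le_eqVlt; apply/orP; left; apply/eqP; field.
by rewrite !gt_eqF ?npow_gt0 ?ltr0n.
Qed.

End Energy.

(** * The energy of ln n * z^Omega(n) *)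

Section EnergyBound.
Variable R : realType.
Local Notation C := R[i].
Local Notation Lam := (vonMangoldt R).
Implicit Types (d t : R).

(** Read off from the large sieve for a polynomial with one coefficient, to avoid a second
    dyadic decomposition. *)
Lemma sum_cauchy_weight : exists2 W : R, 0 < W & forall D L : nat, (0 < D)%N ->
  \sum_(0 <= e < L.+1) (1 + freq R D e ^+ 2)^-1 <= W * D%:R.
Proof.
have [W W0 hW] := weighted_large_sieve R; exists W => // D L D0.
have := hW 1%N (fun=> 1) (fun=> 0) D L D0.
have -> : gram 1 (fun=> 1 : C) (fun=> 0) = 1 :> R.
  by rewrite /gram !big_nat1 cabs1 subrr expr0n/= addr0 divr1 mulr1.
rewrite mulr1 => h.
apply: le_trans (h _); last by move=> *; rewrite subrr normr0.
apply: ler_sum => e _; have f0 : 0 <= freq R D e by rewrite divr_ge0.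
rewrite /trig2 /trig !big_nat1 !mulr0 oppr0 cis0 mulr1 cabs1 expr1n.
have s1 : 1 <= Num.sqrt (1 + 2 * freq R D e).
  by rewrite -[leLHS]sqrtr1 ler_wsqrtr// lerDl mulr_ge0.
have q0 : 0 <= (1 + freq R D e ^+ 2)^-1 by rewrite invr_ge0 addr_ge0 ?sqr_ge0.
nra.
Qed.

Definition lnOmega (z : C) (j : nat) : C := rc (ln j%:R) * z ^+ prime_Omega j.

Lemma sqr_le_sqrt (x y : R) : 0 <= x -> x ^+ 4 <= y -> x ^+ 2 <= Num.sqrt y.
Proof.
move=> x0 xy; rewrite -[leLHS]ger0_norm ?sqr_ge0// -sqrtr_sqr ler_wsqrtr//.
by rewrite -exprM.
Qed.

Lemma sqrt_powR d (x : R) : 0 <= d -> Num.sqrt (d `^ (2 * x)) = d `^ x.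
Proof.
move=> d0; rewrite -[RHS]ger0_norm ?powR_ge0// -sqrtr_sqr; congr Num.sqrt.
by rewrite -powR_mulrn ?powR_ge0// -powRrM mulrC.
Qed.

(** The logarithm supplies the factor [F' / F], whose mean square is [O(1 / d)] by the
    large sieve over prime powers, while [F] itself is bounded by [sup_bound]. The trivial
    bound would be [d ^ (- 3)]. *)
Lemma energy_bound (z : C) (m : nat) : (0 < m)%N -> cabs z = 1 -> z ^+ m = 1 -> z != 1 ->
  exists A Cst d0 : R, [/\ 0 < A, A <= 1, 0 < Cst, 0 < d0 & d0 <= 1] /\
    forall d, 0 < d -> d <= d0 -> forall N,
      energy d (lnOmega z) N <= Cst * d `^ (2 * A - 3).
Proof.
move=> m0 z1 zm zn1.
have [A [C0 [d0 [[A0 A1 C00 d00 d01] hsup]]]] := sup_bound m0 z1 zm zn1.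
have [W W0 hW] := weighted_large_sieve R.
have [W' W'0 hW'] := sum_cauchy_weight.
pose G0 : R := 16 * (4 * 8) * 32.
have G00 : 0 < G0 by rewrite !mulr_gt0.
pose C1 := 32 * Num.sqrt C0 * W * G0 + (64 * W' + 1).
have C1a : 0 <= 32 * Num.sqrt C0 * W * G0 by rewrite !mulr_ge0 ?sqrtr_ge0// ltW.
exists A, C1, d0; split.
  by split=> //; rewrite ltr_wpDl// addr_gt0// mulr_gt0.
move=> d dpos dd N0; have d1 : d <= 1 by rewrite (le_trans dd).
have [N1 hN1] := hsup d dpos dd.
have [N2 hN2] := convolution_error dpos (@ltr01 R).
(* the energy increases with [N], so [N] may be taken beyond all truncation thresholds *)
pose N := maxn N0 (maxn N1 N2).
have {}hN1 := hN1 N (leq_trans (leq_maxl _ _) (leq_maxr _ _)).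
have {}hN2 := hN2 N (leq_trans (leq_maxr _ _) (leq_maxr _ _)).
rewrite (le_trans (energy_mono _ dpos (leq_maxl N0 (maxn N1 N2))))// -/N.
rewrite (le_trans (energy_le_form _ _ dpos))//.
pose x j := lnOmega z j * rc (npow (1 + d) j).
pose v (j : nat) := (1 + d) * ln (j%:R : R).
rewrite -/(x _) -/(v _).
pose b j := rc (Lam j) * z ^+ prime_Omega j * rc (npow (1 + d) j).
pose X := \sum_(1 <= j < N.+1) cabs (x j).
have X0 : 0 <= X by apply: sumr_ge0 => j _; exact: cabs_ge0.
(* chosen so that the error of [spectral_upper] is at most 1, whatever the size of [X] *)
have eps0 : 0 < (1 + X ^+ 2)^-1 by rewrite invr_gt0 ltr_wpDr ?sqr_ge0.
have [D0 hD0] := spectral_upper eps0.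
pose D := maxn D0.+1 (Num.truncn ((1 + d) * ln (N%:R : R))).+1.
have Dpos : (0 < D)%N by rewrite /D leq_max.
have DR : 0 < D%:R :> R by rewrite ltr0n.
have [L hL] := hD0 D (leq_maxl _ _).
have hv j k : (0 < j <= N)%N -> (0 < k <= N)%N -> `|v j - v k| <= D%:R.
  have hD : (1 + d) * ln (N%:R : R) <= D%:R.
    rewrite (le_trans (ltW (truncnS_gt _)))// ler_nat leq_maxr//.
  have bnd i : (0 < i <= N)%N -> 0 <= v i <= D%:R.
    move=> /andP[i0 iN]; rewrite mulr_ge0 ?ln_nat_ge0 ?addr_ge0 ?(ltW dpos)//=.
    rewrite (le_trans _ hD)// ler_wpM2l ?addr_ge0 ?(ltW dpos)//.
    by rewrite ler_ln ?posrE ?ltr0n ?ler_nat// (leq_trans i0).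
  by move=> /bnd/andP[? ?] /bnd/andP[? ?]; rewrite ler_norml; lra.
have := hL N x v hv; rewrite -/X => /le_trans; apply.
have e1 : (1 + X ^+ 2)^-1 * X ^+ 2 <= 1.
  by rewrite ler_pdivrMl ?ltr_wpDr ?sqr_ge0// mulr1 lerDr.
set Y := C0 * d `^ (4 * A - 4) in hN1.
have sY : Num.sqrt Y = Num.sqrt C0 * d `^ (2 * A - 2).
  rewrite sqrtrM ?(ltW C00)//; congr (_ * _).
  have -> : 4 * A - 4 = 2 * (2 * A - 2) by ring.
  by rewrite sqrt_powR// ltW.
have hX t : cabs (trig N x v t) ^+ 2 <=
    2 * Num.sqrt Y * Num.sqrt (1 + 2 * `|t|) * cabs (trig N b v t) ^+ 2 + 2.
  pose tt := t * (1 + d).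
  have xE : trig N x v t = \sum_(1 <= j < N.+1) rc (ln j%:R) * twist z tt j * rc (npow (1 + d) j).
    apply: eq_bigr => j _; rewrite /x /lnOmega /twist /nit /v /tt mulrA; ring.
  have bE : trig N b v t = \sum_(1 <= j < N.+1) rc (Lam j) * twist z tt j * rc (npow (1 + d) j).
    apply: eq_bigr => j _; rewrite /b /twist /nit /v /tt mulrA; ring.
  have h1 := hN2 _ (ucmul_twist tt z1); rewrite -xE -bE in h1.
  have h2 : cabs (dsum (1 + d) (twist z tt) N) ^+ 2 <= Num.sqrt Y * Num.sqrt (1 + 2 * `|t|).
    rewrite -sqrtrM; last by rewrite mulr_ge0 ?powR_ge0// ltW.
    apply: sqr_le_sqrt; first exact: cabs_ge0.
    rewrite (le_trans (hN1 tt))// -/Y ler_wpM2l ?mulr_ge0 ?powR_ge0 ?(ltW C00)//.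
    rewrite lerD2l /tt normrM mulrC ler_wpM2r// ger0_norm ?addr_ge0 ?(ltW dpos)//; lra.
  set F := dsum _ _ _ in h1 h2; set G := trig N b v t in h1 *; set H := trig N x v t in h1 *.
  have h3 : cabs H <= cabs F * cabs G + 1.
    by rewrite -[H](subrK (F * G)) (le_trans (ler_cabsD _ _))// cabsM addrC lerD2l.
  have h4 : cabs H ^+ 2 <= (cabs F * cabs G + 1) ^+ 2.
    by rewrite ler_pXn2r ?nnegrE ?addr_ge0 ?mulr_ge0 ?cabs_ge0.
  have h5 : cabs F ^+ 2 * cabs G ^+ 2 <= Num.sqrt Y * Num.sqrt (1 + 2 * `|t|) * cabs G ^+ 2.
    by rewrite ler_wpM2r ?sqr_ge0.
  move: h4 h5; rewrite -exprMn; have := sqr_ge0 (cabs F * cabs G - 1).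
  set u := cabs F * cabs G.
  rewrite -(mulrA 2) -(mulrA 2); set w := Num.sqrt Y * _ * _; lra.
have hX2 e : trig2 N x v (freq R D e) / (1 + freq R D e ^+ 2) <=
   2 * Num.sqrt Y * (Num.sqrt (1 + 2 * freq R D e) / (1 + freq R D e ^+ 2) *
     trig2 N b v (freq R D e)) + 4 * (1 + freq R D e ^+ 2)^-1.
  have q0 : 0 <= (1 + freq R D e ^+ 2)^-1 by rewrite invr_ge0 addr_ge0 ?sqr_ge0.
  have f0 : 0 <= freq R D e by rewrite divr_ge0.
  have h1 := hX (freq R D e); have h2 := hX (- freq R D e).
  rewrite normrN (ger0_norm f0) in h2; rewrite (ger0_norm f0) in h1.
  have h3 : trig2 N x v (freq R D e) <=
     2 * Num.sqrt Y * Num.sqrt (1 + 2 * freq R D e) * trig2 N b v (freq R D e) + 4.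
    by rewrite (le_trans (lerD h1 h2))// /trig2 mulrDr; lra.
  rewrite (le_trans (ler_wpM2r q0 h3))// le_eqVlt; apply/orP; left; apply/eqP; ring.
have hg : gram N b v <= G0 / d.
  have -> : G0 / d = (16 * (4 * 8)) * (32 / d) by rewrite /G0; ring.
  apply: gram_mangoldt => // [j _|j k /andP[j0 _] /andP[k0 _]].
    rewrite /b !cabsM cabsX z1 expr1n mulr1 !cabs_rc !ger0_norm ?npow_ge0//.
    exact: vonMangoldt_ge0.
  by rewrite /v -mulrBr exprMn ler_peMl ?sqr_ge0// exprn_ege1// lerDl ltW.
have hs := hW N b v D L Dpos hv.
have hs' := hW' D L Dpos.
set S := \sum_(0 <= e < L.+1) _ / _.
have hS : S <= 2 * Num.sqrt Y * (W * D%:R * (G0 / d)) + 4 * (W' * D%:R).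
  rewrite (le_trans (ler_sum _ (fun e _ => hX2 e)))// big_split/= -!mulr_sumr lerD//.
    rewrite ler_wpM2l ?mulr_ge0 ?sqrtr_ge0// (le_trans hs)//.
    by rewrite ler_wpM2l// mulr_ge0// ltW.
  by rewrite ler_wpM2l.
have D16 : 0 <= 16 / D%:R :> R by rewrite divr_ge0.
rewrite (le_trans (lerD (ler_wpM2l D16 hS) e1))//.
have -> : 16 / D%:R * (2 * Num.sqrt Y * (W * D%:R * (G0 / d)) + 4 * (W' * D%:R)) + 1 =
  32 * W * G0 * (Num.sqrt Y / d) + (64 * W' + 1).
  by field; rewrite !gt_eqF.
have -> : Num.sqrt Y / d = Num.sqrt C0 * d `^ (2 * A - 3).
  rewrite sY -mulrA; congr (_ * _); rewrite -[X in _ / X]powRr1 ?(ltW dpos)//.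
  rewrite -powRB ?(gt_eqF dpos) ?implybT//; congr powR; ring.
have p1 : 1 <= d `^ (2 * A - 3).
  have a3 : 2 * A - 3 <= 0 by move: A1; clear; lra.
  by rewrite -[leLHS](powRr0 d); apply: ger_powR => //; rewrite dpos.
rewrite /C1 [leRHS]mulrDl lerD//; last by rewrite ler_peMr// addr_ge0// mulr_ge0// ltW.
by rewrite le_eqVlt; apply/orP; left; apply/eqP; ring.
Qed.

End EnergyBound.

(** * From the energy back to summatory functions *)

Section Tauberian.
Variable R : realType.
Local Notation C := R[i].
Local Notation Lam := (vonMangoldt R).
Variable z : C.
Hypothesis z1 : cabs z = 1.

Definition powOmega (n : nat) : C := z ^+ prime_Omega n.
Let S n := cabs (psum powOmega n).
Let A n := cabs (psum (lnOmega z) n).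

Let S0 n : 0 <= S n. Proof. exact: cabs_ge0. Qed.
Let A0 n : 0 <= A n. Proof. exact: cabs_ge0. Qed.

Let f1 n : cabs (powOmega n) = 1.
Proof. by rewrite cabsX z1 expr1n. Qed.

Lemma cmul_powOmega : cmul powOmega.
Proof.
split=> [|a b a0 b0]; first by rewrite /powOmega prime_Omega1.
by rewrite /powOmega prime_OmegaM// exprD.
Qed.

(** Summatory functions of unimodular sequences are 1-Lipschitz. *)
Lemma psum_shift q i : S q <= S (q + i) + i%:R.
Proof.
have e : psum powOmega q = psum powOmega (q + i) - \sum_(q.+1 <= k < (q + i).+1) powOmega k.
  by rewrite /psum (@big_cat_nat _ _ _ q.+1 1 (q + i).+1)//= ?ltnS ?leq_addr// addrK.
rewrite /S e (le_trans (ler_cabsB _ _))// lerD2l (le_trans (ler_cabs_sum _ _ _))//.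
rewrite (eq_bigr (fun=> 1)) => [|k _]; last exact: f1.
by rewrite big_const_nat iter_addr_0 subSS addKn.
Qed.

Lemma psum_le n : S n <= n%:R.
Proof.
rewrite (le_trans (ler_cabs_sum _ _ _))// (eq_bigr (fun=> 1)) => [|k _]; last exact: f1.
by rewrite big_const_nat iter_addr_0 subSS subn0.
Qed.

(** Removes the logarithmic weight: the sum of [ln n - ln k] over [k <= n] is at most [n]
    by the Stirling bound [ln_fact_ge]. *)
Lemma lnOmega_psum n : S n * ln n%:R <= A n + n%:R.
Proof.
have l0 := ln_nat_ge0 R n.
have e : rc (ln n%:R) * psum powOmega n =
   psum (lnOmega z) n + \sum_(1 <= k < n.+1) rc (ln n%:R - ln k%:R) * powOmega k.
  rewrite /psum mulr_sumr -big_split/=; apply: eq_bigr => k _.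
  by rewrite /lnOmega rcB -/(powOmega k); ring.
have -> : S n * ln n%:R = cabs (rc (ln n%:R) * psum powOmega n).
  by rewrite cabsM cabs_rc ger0_norm// mulrC.
rewrite e (le_trans (ler_cabsD _ _))// lerD2l (le_trans (ler_cabs_sum _ _ _))//.
have h := ln_fact_ge R n; rewrite lerBlDr ln_fact -lerBlDl in h.
rewrite (le_trans _ h)//.
have -> : n%:R * ln n%:R = \sum_(1 <= k < n.+1) ln n%:R :> R.
  by rewrite sumr_const_nat subSS subn0 mulr_natl.
rewrite -sumrB.
rewrite big_nat [leRHS]big_nat; apply: ler_sum => k /andP[k0 kn].
rewrite cabsM f1 mulr1 cabs_rc ger0_norm// subr_ge0 ler_ln ?posrE ?ltr0n ?ler_nat//.
by rewrite (leq_trans k0).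
Qed.

Lemma lnOmega_convolution x : A x <= \sum_(1 <= d < x.+1) Lam d * S (x %/ d).
Proof.
rewrite /A /psum (_ : \sum_(1 <= k < x.+1) lnOmega z k = \sum_(1 <= k < x.+1) rc (ln k%:R) * powOmega k)//.
rewrite sum_ln_convolution; last exact: cmul_powOmega.
rewrite (le_trans (ler_cabs_sum _ _ _))//; apply: ler_sum => d _.
by rewrite !cabsM f1 mulr1 cabs_rc ger0_norm// vonMangoldt_ge0.
Qed.

(** By the Lipschitz property a value is at most the mean over a short interval of length
    [eta * q], up to that length. *)
Lemma psum_smooth (eta : R) q : 0 < eta -> eta <= 1 -> (0 < q)%N ->
  S q <= (\sum_(q <= n < (2 * q).+1) S n) / (eta * q%:R) + (eta * q%:R + 1).
Proof.
move=> e0 e1 q0; have qR : 0 < q%:R :> R by rewrite ltr0n.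
have eq0 : 0 < eta * q%:R by rewrite mulr_gt0.
(* length of the smoothing interval; at least 1, hence the term 1 in the bound *)
pose H := (Num.truncn (eta * q%:R)).+1.
have H1 : eta * q%:R <= H%:R by rewrite ltW// truncnS_gt.
have H2 : H%:R <= eta * q%:R + 1.
  by rewrite -natr1 lerD2r truncn_le ltW.
have Hq : (H <= q.+1)%N.
  rewrite ltnS -(ler_nat R) (le_trans _ (_ : eta * q%:R <= _))//; last first.
    by rewrite ler_piMl// ltW.
  by rewrite truncn_le ltW.
have HR : 0 < H%:R :> R by rewrite ltr0n.
have h1 : H%:R * S q <= \sum_(q <= n < (2 * q).+1) S n + H%:R * H%:R.
  have -> : H%:R * S q = \sum_(0 <= i < H) S q.
    by rewrite sumr_const_nat subn0 mulr_natl.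
  rewrite (@le_trans _ _ (\sum_(0 <= i < H) (S (i + q) + H%:R)))//.
    rewrite big_nat [leRHS]big_nat; apply: ler_sum => i /andP[_ iH].
    by rewrite (le_trans (psum_shift q i))// addnC lerD2l ler_nat ltnW.
  rewrite big_split/= lerD//; last by rewrite sumr_const_nat subn0 mulr_natl.
  rewrite (@big_cat_nat _ _ _ (H + q) q (2 * q).+1)//=; [|lia|lia].
  rewrite -[leLHS]addr0 lerD//; last by apply: sumr_ge0.
  rewrite -[q in leRHS]add0n [leRHS]big_addn addnK le_eqVlt; apply/orP; left; apply/eqP.
  by [].
have h2 : S q <= (\sum_(q <= n < (2 * q).+1) S n) / H%:R + H%:R.
  rewrite -(ler_pM2l HR) (le_trans h1)// mulrDr mulrCA mulfV ?gt_eqF// mulr1.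
  by [].
rewrite (le_trans h2)// lerD// ler_wpM2l ?sumr_ge0// lef_pV2 ?posrE//.
Qed.

(** The convolution with [Lambda] averages [S] over the points [x %/ d]; after smoothing,
    the Chebyshev bound replaces the primes [d] near [x / n] by all integers, and the
    average becomes the logarithmic one. *)
Lemma lnOmega_average (eta : R) x : 0 < eta -> eta <= 1 -> (0 < x)%N ->
  A x <= 16 * x%:R / eta * \sum_(1 <= n < (2 * x).+1) S n / n%:R ^+ 2 +
         eta * x%:R * (ln x%:R + 4) + 4 * x%:R.
Proof.
move=> e0 e1 x0; rewrite (le_trans (lnOmega_convolution x))//.
have eV : 0 <= eta^-1 by rewrite invr_ge0 ltW.
rewrite (@le_trans _ _ (\sum_(1 <= d < x.+1)
   (\sum_(1 <= n < (2 * x).+1) eta^-1 * (S n * (if (d <= (2 * x) %/ n)%N then 2 / n%:R * Lam d else 0)) +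
    eta * (x%:R * (Lam d / d%:R)) + Lam d)))//.
  rewrite big_nat [leRHS]big_nat; apply: ler_sum => d /andP[d0 dx].
  have L0 := vonMangoldt_ge0 R d.
  set q := (x %/ d)%N; have q0 : (0 < q)%N by rewrite divn_gt0.
  have qR : 0 < q%:R :> R by rewrite ltr0n.
  have dR : 0 < d%:R :> R by rewrite ltr0n.
  rewrite (le_trans (ler_wpM2l L0 (psum_smooth e0 e1 q0)))//.
  rewrite mulrDr mulrDr mulr1 addrA !lerD//; last first.
    rewrite mulrCA ler_wpM2l ?(ltW e0)// [leRHS]mulrCA ler_wpM2l//.
    by rewrite ler_pdivlMr// -natrM ler_nat leq_divM.
  rewrite -[leRHS]mulr_sumr; set T := \sum_(q <= n < _) S n.
  have -> : Lam d * (T / (eta * q%:R)) = eta^-1 * (Lam d / q%:R * T) by field; rewrite !gt_eqF.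
  rewrite ler_wpM2l// /T.
  rewrite (@big_cat_nat _ _ _ q 1 (2 * x).+1)//=; last by rewrite (leq_trans (leq_div _ _))//; lia.
  rewrite -[leLHS]add0r lerD//.
    apply: sumr_ge0 => n _; rewrite mulr_ge0//; case: ifP => // _.
    by rewrite mulr_ge0// divr_ge0.
  rewrite (@big_cat_nat _ _ _ (2 * q).+1 q (2 * x).+1)//=; [|lia|]; last first.
    by rewrite ltnS leq_mul2l leq_div.
  rewrite -[leLHS]addr0 lerD//; last first.
    apply: sumr_ge0 => n _; rewrite mulr_ge0//; case: ifP => // _.
    by rewrite mulr_ge0// divr_ge0.
  rewrite mulr_sumr [leLHS]big_nat [leRHS]big_nat; apply: ler_sum => n /andP[qn nq].
  have n0 : (0 < n)%N by rewrite (leq_trans q0).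
  have nR : 0 < n%:R :> R by rewrite ltr0n.
  have -> : (d <= 2 * x %/ n)%N.
    rewrite leq_divRL//; have : (q * d <= x)%N by exact: leq_divM.
    nia.
  rewrite [leRHS]mulrC ler_wpM2r// mulrC ler_wpM2r//.
  rewrite ler_pdivlMr// mulrC ler_pdivrMr// -natrM ler_nat; lia.
rewrite !big_split/= -!mulr_sumr -/(psi R x); do 2 rewrite ?lerD//; last 2 first.
- rewrite -mulrA ler_wpM2l ?(ltW e0)// ler_wpM2l//; exact: sum_vonMangoldt_div.
- exact: psi_le.
rewrite exchange_big/= mulr_sumr big_nat [leRHS]big_nat; apply: ler_sum => n /andP[n0 nx].
have nR : 0 < n%:R :> R by rewrite ltr0n.
rewrite -mulr_sumr -mulr_sumr.
have -> : 16 * x%:R / eta * (S n / n%:R ^+ 2) =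
   eta^-1 * (S n * (2 / n%:R * (4 * (2 * x%:R / n%:R)))).
  by field; rewrite !gt_eqF.
rewrite ler_wpM2l// ler_wpM2l//.
have e2 : \sum_(1 <= d < x.+1) (if (d <= 2 * x %/ n)%N then 2 / n%:R * Lam d else 0) <=
   2 / n%:R * psi R (2 * x %/ n).
  rewrite -big_mkcond/= -mulr_sumr ler_wpM2l ?divr_ge0//.
  set K := (2 * x %/ n)%N; have [Kx|xK] := leqP K x.
    rewrite (@big_cat_nat _ _ _ K.+1)//= [X in _ + X]big_nat_cond [X in _ + X]big1 ?addr0.
      rewrite /psi big_mkcond; apply: ler_sum => d _.
      by case: ifP => // _; exact: vonMangoldt_ge0.
    by move=> d /andP[/andP[Kd _]]; rewrite leqNgt Kd.
  rewrite (le_trans _ (psi_mono R (ltnW xK)))// /psi big_mkcond; apply: ler_sum => d _.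
  by case: ifP => // _; exact: vonMangoldt_ge0.
rewrite (le_trans e2)// ler_wpM2l ?divr_ge0// (le_trans (psi_le _ _))// ler_wpM2l//.
by rewrite ler_pdivlMr// -!natrM ler_nat leq_divM.
Qed.

(** For [n] beyond [expR V] the logarithm gains [V] through [lnOmega_psum], and the weight
    [al] balances the square of [A n] against the number of terms; the terms below
    [expR V] contribute at most [1 + V]. *)
Lemma psum_average (V al : R) M : 0 < V -> 0 < al -> (0 < M)%N ->
  \sum_(1 <= n < M.+1) S n / n%:R ^+ 2 <=
  1 + V + V^-1 * (al * (\sum_(1 <= n < M.+1) A n ^+ 2 / n%:R ^+ 3) + (al^-1 + 1) * (1 + ln M%:R)).
Proof.
move=> V0 al0 M0.
have VV : 0 <= V^-1 by rewrite invr_ge0 ltW.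
pose N := Num.truncn (expR V).
rewrite (@le_trans _ _ (\sum_(1 <= n < M.+1) ((if (n <= N)%N then n%:R^-1 else 0) +
   V^-1 * (al * (A n ^+ 2 / n%:R ^+ 3) + (al^-1 + 1) * n%:R^-1))))//.
  rewrite big_nat [leRHS]big_nat; apply: ler_sum => n /andP[n0 _].
  have nR : 0 < n%:R :> R by rewrite ltr0n.
  have t0 : 0 <= V^-1 * (al * (A n ^+ 2 / n%:R ^+ 3) + (al^-1 + 1) / n%:R).
    rewrite mulr_ge0// addr_ge0// mulr_ge0 ?(ltW al0) ?divr_ge0 ?sqr_ge0 ?exprn_ge0//.
    by rewrite addr_ge0// invr_ge0 ltW.
  case: ifP => [nN|/negbT]; last first.
    rewrite -ltnNge => Nn; rewrite add0r.
    have lV : V <= ln n%:R.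
      rewrite -ler_expR lnK ?posrE// (le_trans (ltW (truncnS_gt _)))// ler_nat//.
    have h1 : S n <= V^-1 * (A n + n%:R).
      rewrite -ler_pdivrMl ?invr_gt0// invrK mulrC (le_trans _ (lnOmega_psum n))//.
      by rewrite ler_wpM2l.
    have h2 : A n / n%:R ^+ 2 <= al * (A n ^+ 2 / n%:R ^+ 3) + al^-1 / n%:R.
      have n3 : 0 < n%:R ^+ 3 :> R by rewrite exprn_gt0.
      have -> : A n / n%:R ^+ 2 = (A n * n%:R) / n%:R ^+ 3 by field; rewrite gt_eqF.
      have -> : al * (A n ^+ 2 / n%:R ^+ 3) + al^-1 / n%:R =
         (al * A n ^+ 2 + al^-1 * n%:R ^+ 2) / n%:R ^+ 3 by field; rewrite !gt_eqF.
      rewrite ler_pM2r ?invr_gt0//.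
      have -> : al * A n ^+ 2 + al^-1 * n%:R ^+ 2 = A n * n%:R +
         al * ((A n - n%:R / (2 * al)) ^+ 2 + 3 * (n%:R / (2 * al)) ^+ 2).
        by field; rewrite gt_eqF.
      by rewrite lerDl mulr_ge0 ?(ltW al0)// addr_ge0 ?sqr_ge0// mulr_ge0 ?sqr_ge0.
    have n2 : 0 <= (n%:R ^+ 2)^-1 :> R by rewrite invr_ge0 sqr_ge0.
    rewrite (le_trans (ler_wpM2r n2 h1))// -mulrA ler_wpM2l// mulrDl.
    have -> : n%:R / n%:R ^+ 2 = n%:R^-1 :> R by field; rewrite gt_eqF.
    by rewrite mulrDl mul1r addrA lerD2r.
  rewrite -[leLHS]addr0 lerD//.
  rewrite ler_pdivrMr ?exprn_gt0// expr2 mulrA mulVf ?gt_eqF// mul1r psum_le//.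
rewrite big_split/= -mulr_sumr lerD//.
  rewrite -big_mkcond/=.
  have [NM|MN] := leqP N M.
    rewrite (@big_cat_nat _ _ _ N.+1)//= [X in _ + X]big_nat_cond [X in _ + X]big1 ?addr0; last first.
      by move=> d /andP[/andP[Kd _]]; rewrite leqNgt Kd.
    rewrite (@le_trans _ _ (\sum_(1 <= n < N.+1) n%:R^-1))//.
      by rewrite big_mkcond; apply: ler_sum => d _; case: ifP.
    rewrite (le_trans (sum_harmonic R N))// lerD2l.
    have [->|N0] := eqVneq N 0%N; first by rewrite ln0// ltW.
    rewrite -ler_expR lnK ?posrE ?ltr0n ?lt0n// truncn_le//; exact: expR_ge0.
  rewrite (@le_trans _ _ (\sum_(1 <= n < M.+1) n%:R^-1))//.
    by rewrite big_mkcond; apply: ler_sum => d _; case: ifP.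
  rewrite (le_trans (sum_harmonic R M))// lerD2l -ler_expR lnK ?posrE ?ltr0n//.
  rewrite (@le_trans _ _ (N%:R))// ?ler_nat ?(ltnW MN)// truncn_le//; exact: expR_ge0.
rewrite ler_wpM2l// big_split/= -!mulr_sumr lerD2l ler_wpM2l ?sum_harmonic//.
by rewrite addr_ge0// invr_ge0 ltW.
Qed.

Lemma cube_le_energy_weight (d : R) n : 0 < d -> (0 < n)%N -> d * ln n%:R <= 1 -> d <= 1 ->
  (n%:R ^+ 3)^-1 <= 16 * expR 2 * (npow (2 * (1 + d)) n - npow (2 * (1 + d)) n.+1).
Proof.
move=> d0 n0 dl d1; have nR : 0 < n%:R :> R by rewrite ltr0n.
have q0 : 0 < 2 * (1 + d) by lra.
have := npow_telescope q0 n0; rewrite ler_pdivlMr//.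
set w := npow _ n - _ => h.
have a1 : npow (1 + 2 * (1 + d)) (2 * n) <= npow (1 + 2 * (1 + d)) n.+1.
  by apply: npow_anti => //; [lra|lia].
have e2 : npow 1 2 = 2^-1 :> R by rewrite npow_one.
have n5 : 1 / 32 <= npow (1 + 2 * (1 + d)) 2.
  have -> : 1 / 32 = npow 5 2 :> R.
    have -> : 5 = 1 + (1 + (1 + (1 + 1))) :> R by ring.
    by rewrite !npowD !e2; field.
  rewrite /npow ler_expR lerN2 ler_wpM2r ?ln_nat_ge0//; lra.
have e3 : npow (1 + 2 * (1 + d)) n = (n%:R ^+ 3)^-1 * npow (2 * d) n.
  have -> : 1 + 2 * (1 + d) = 1 + (1 + (1 + 2 * d)) by ring.
  by rewrite !npowD !npow_one//; field; rewrite gt_eqF.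
have e4 : 1 <= expR 2 * npow (2 * d) n.
  rewrite /npow -expRD -[leLHS]expR0 ler_expR -mulrA; lra.
have c0 : 0 < (n%:R ^+ 3)^-1 :> R by rewrite invr_gt0 exprn_gt0.
rewrite npowM// e3 in a1.
have h2 : 1 / 32 * ((n%:R ^+ 3)^-1 * npow (2 * d) n) <= w / 2.
  have p0 : 0 <= (n%:R ^+ 3)^-1 * npow (2 * d) n by rewrite mulr_ge0 ?npow_ge0// ltW.
  have := ler_wpM2r p0 n5; have := npow_ge0 (1 + 2 * (1 + d)) n.+1.
  move: a1 h; nra.
have h3 : (n%:R ^+ 3)^-1 <= expR 2 * ((n%:R ^+ 3)^-1 * npow (2 * d) n).
  by rewrite mulrCA ler_peMr// ltW.
rewrite (le_trans h3)//.
have := expR_gt0 (2 : R); move: h2; set p := _ * npow _ n; set E := expR 2 => h2 E0.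
have : E * (1 / 32 * p) <= E * (w / 2) by rewrite ler_wpM2l// ltW.
lra.
Qed.

End Tauberian.

(** * Mean values of z^Omega(n) *)

Section MeanValue.
Variable R : realType.
Local Notation C := R[i].

(** With [l = ln (2 x)] and [d = 1 / l], the energy is [O(l ^ (3 - 2 A))]. Taking
    [V = l ^ (1 - A / 2)], [al = l ^ (A - 1)] makes the logarithmic average of [|psum|] of
    size [V], and smoothing with [eta = l ^ (- A / 4)] yields [O(x * l ^ (1 - A / 4))] for
    the weighted sum; dividing by [ln x] leaves the exponent [A / 4]. *)
Lemma mean_value (z : C) (m : nat) : (0 < m)%N -> cabs z = 1 -> z ^+ m = 1 -> z != 1 ->
  exists B Cst : R, exists x0 : nat, [/\ 0 < B, B <= 1, 0 < Cst &
    forall x, (x0 <= x)%N ->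
      cabs (psum (powOmega z) x) <= Cst * x%:R * ln x%:R `^ (- B)].
Proof.
move=> m0 z1 zm zn1.
have [A [C0 [d0 [[A0 A1 C00 d00 d01] hE]]]] := energy_bound m0 z1 zm zn1.
pose C1 := 16 * expR 2 * C0; have C10 : 0 < C1 by rewrite !mulr_gt0 ?expR_gt0.
pose C2 := 16 * (6 + C1) + 9; have C20 : 0 < C2 by rewrite addr_gt0// mulr_gt0// addr_gt0.
exists (A / 4), (2 * (C2 + 1)), (Num.truncn (expR (1 + d0^-1))).+2.
split; [by rewrite divr_gt0|lra|by rewrite mulr_gt0// addr_gt0|].
move=> x hx.
have x2 : (1 < x)%N by rewrite (leq_trans _ hx).
have x0 : (0 < x)%N by rewrite ltnW.
have xR : 0 < x%:R :> R by rewrite ltr0n.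
have dV : 0 < d0^-1 by rewrite invr_gt0.
have lx : 1 + d0^-1 <= ln x%:R.
  rewrite -ler_expR lnK ?posrE// (le_trans (ltW (truncnS_gt _)))// ler_nat//.
  by rewrite (leq_trans _ hx).
pose l : R := ln (2 * x)%:R.
have lE : l = ln 2 + ln x%:R by rewrite /l natrM lnM ?posrE.
have l2 := ln2_ge R.
have l21 : ln 2 <= 1 :> R by have := @le_ln1Dx R 1; apply; rewrite (@lt_trans _ _ 0).
have l1 : 1 <= l by move: lx dV l2; rewrite lE; lra.
have l0 : 0 < l by rewrite (lt_le_trans _ l1).
have lxl : ln x%:R <= l by rewrite lE; lra.
have llx : l <= 2 * ln x%:R by move: lx dV l21; rewrite lE; lra.
have lx0 : 0 < ln x%:R :> R by move: lx dV; lra.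
pose d := l^-1.
have dpos : 0 < d by rewrite invr_gt0.
have dd0 : d <= d0.
  by rewrite -[leRHS]invrK lef_pV2 ?posrE//; move: lx l2; rewrite lE; lra.
have d1 : d <= 1 by rewrite invf_le1.
have pw (a b : R) : l `^ a * l `^ b = l `^ (a + b).
  by rewrite -powRD ?(gt_eqF l0) ?implybT.
have pmono (a b : R) : a <= b -> l `^ a <= l `^ b by move=> ab; apply: ler_powR.
have p1 (a : R) : 0 <= a -> 1 <= l `^ a by move=> a0; rewrite -(powRr0 l); apply: pmono.
set Sx := cabs _; set Ax := cabs (psum (lnOmega z) x).
set Q := \sum_(1 <= n < (2 * x).+1) cabs (psum (lnOmega z) n) ^+ 2 / n%:R ^+ 3.
have hQ : Q <= C1 * l `^ (3 - 2 * A).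
  rewrite (@le_trans _ _ (16 * expR 2 * energy d (lnOmega z) (2 * x)))//.
    rewrite /energy mulr_sumr /Q big_nat [leRHS]big_nat; apply: ler_sum => n /andP[n0 nx].
    rewrite mulrA mulrC ler_wpM2r ?sqr_ge0// cube_le_energy_weight//.
    have nR : 0 < n%:R :> R by rewrite ltr0n.
    rewrite /d mulrC ler_pdivrMr// mul1r ler_ln ?posrE ?ltr0n ?ler_nat ?muln_gt0//.
  rewrite /C1 -[leRHS]mulrA ler_wpM2l ?mulr_ge0 ?expR_ge0//.
  rewrite (le_trans (hE d dpos dd0 _))// ler_wpM2l ?(ltW C00)//.
  rewrite /d -powR_inv1 ?(ltW l0)// -powRrM le_eqVlt; apply/orP; left; apply/eqP.
  by congr powR; ring.
pose V := l `^ (1 - A / 2); pose al := l `^ (A - 1).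
have V0 : 0 < V by rewrite powR_gt0.
have al0 : 0 < al by rewrite powR_gt0.
have VV : V^-1 = l `^ (A / 2 - 1) by rewrite /V -powRN; congr powR; ring.
have alV : al^-1 = l `^ (1 - A) by rewrite /al -powRN; congr powR; ring.
have xx0 : (0 < 2 * x)%N by rewrite muln_gt0.
have := psum_average z1 V0 al0 xx0; rewrite -/Q -/l.
set Sg := \sum_(1 <= n < (2 * x).+1) _ => hS.
have hSg : Sg <= (6 + C1) * V.
  have V1 : 1 <= V by apply: p1; lra.
  have h1 : al * Q <= C1 * l `^ (2 - A).
    rewrite (le_trans (ler_wpM2l (ltW al0) hQ))// mulrCA ler_wpM2l ?(ltW C10)//.
    by rewrite /al pw; apply: pmono; lra.
  have h2 : (al^-1 + 1) * (1 + l) <= 4 * l `^ (2 - A).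
    have a1 : 1 <= al^-1 by rewrite alV; apply: p1; lra.
    have -> : l `^ (2 - A) = al^-1 * l.
      by rewrite alV -[X in _ * X](powRr1 (ltW l0)) pw; congr powR; ring.
    have -> : 4 * (al^-1 * l) = (2 * al^-1) * (2 * l) by ring.
    by rewrite ler_pM//; lra.
  have h3 : V^-1 * l `^ (2 - A) = V by rewrite VV pw /V; congr powR; field.
  have Vi : 0 <= V^-1 by rewrite invr_ge0 ltW.
  have := ler_wpM2l Vi (lerD h1 h2); rewrite -mulrDl mulrCA h3.
  by move=> h4; rewrite (le_trans hS)//; move: h4 V1; lra.
pose eta := l `^ (- (A / 4)).
have e0 : 0 < eta by rewrite powR_gt0.
have e1 : eta <= 1.
  by rewrite -[leRHS](powRr0 l); apply: pmono; rewrite oppr_le0 divr_ge0// ltW.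
have := lnOmega_average z1 e0 e1 x0; rewrite -/Sg -/Ax => hA.
pose W := l `^ (1 - A / 4).
have W0 : 0 <= W by rewrite powR_ge0.
have W1 : 1 <= W by apply: p1; lra.
have etaV : eta^-1 = l `^ (A / 4) by rewrite /eta -powRN opprK.
have hA2 : Ax <= C2 * x%:R * W.
  have g1 : 16 * x%:R / eta * Sg <= 16 * x%:R * ((6 + C1) * W).
    rewrite -(mulrA (16 * x%:R)) ler_wpM2l ?mulr_ge0// (le_trans (ler_wpM2l _ hSg)) ?invr_ge0 ?(ltW e0)//.
    rewrite mulrCA ler_wpM2l ?addr_ge0 ?(ltW C10)// etaV /V pw /W.
    by apply: pmono; lra.
  have g2 : eta * x%:R * (ln x%:R + 4) <= x%:R * (5 * W).
    have eW : W = eta * l.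
      by rewrite /eta -[X in _ * X](powRr1 (ltW l0)) pw /W; congr powR; ring.
    rewrite [eta * _]mulrC -mulrA ler_wpM2l// eW mulrCA ler_wpM2l ?(ltW e0)//.
    by move: lxl l1; lra.
  have g3 : 4 * x%:R <= x%:R * (4 * W).
    by rewrite mulrC ler_wpM2l// ler_peMr.
  rewrite (le_trans hA)// (le_trans (lerD (lerD g1 g2) g3))// /C2.
  by rewrite le_eqVlt; apply/orP; left; apply/eqP; ring.
have := lnOmega_psum z1 x; rewrite -/Sx -/Ax => hSx.
have hSx2 : Sx * ln x%:R <= (C2 + 1) * x%:R * W.
  rewrite (le_trans hSx)//.
  have : x%:R <= x%:R * W by rewrite ler_peMr.
  have -> : (C2 + 1) * x%:R * W = C2 * x%:R * W + x%:R * W by ring.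
  by move: hA2; lra.
have Sx0 : 0 <= Sx by exact: cabs_ge0.
have hSl : Sx * l <= 2 * (C2 + 1) * x%:R * W.
  have : Sx * l <= 2 * (Sx * ln x%:R) by rewrite mulrCA ler_wpM2l.
  by move: hSx2; lra.
have hfin : Sx <= 2 * (C2 + 1) * x%:R * eta.
  rewrite -(ler_pM2r l0) (le_trans hSl)//.
  have -> : W = eta * l.
    by rewrite /eta -[X in _ = _ * X](powRr1 (ltW l0)) pw /W; congr powR; ring.
  by rewrite mulrA.
have c0 : 0 <= 2 * (C2 + 1) * x%:R by rewrite !mulr_ge0// addr_ge0// ltW.
rewrite (le_trans hfin)// ler_wpM2l//.
rewrite /eta !powRN lef_pV2 ?posrE ?powR_gt0//.
by rewrite ge0_ler_powR ?nnegrE ?divr_ge0 ?(ltW A0) ?(ltW lx0) ?(ltW l0).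
Qed.

(** Finitely many roots of unity share the smallest exponent and a common constant. *)
Lemma mean_value_roots (w : C) (m : nat) : (0 < m)%N -> cabs w = 1 -> w ^+ m = 1 ->
  (forall k, (0 < k < m)%N -> w ^+ k != 1) ->
  exists B Cst : R, exists x0 : nat, [/\ 0 < B, B <= 1, 0 < Cst &
    forall k x, (0 < k < m)%N -> (x0 <= x)%N ->
      cabs (psum (powOmega (w ^+ k)) x) <= Cst * x%:R * ln x%:R `^ (- B)].
Proof.
move=> m0 w1 wm wn1.
suff h M : exists B Cst : R, exists x0 : nat, [/\ 0 < B, B <= 1, 0 < Cst &
    forall k x, (0 < k < m)%N -> (k < M)%N -> (x0 <= x)%N ->
      cabs (psum (powOmega (w ^+ k)) x) <= Cst * x%:R * ln x%:R `^ (- B)].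
  have [B [Cst [x0 [B0 B1 C0 h2]]]] := h m; exists B, Cst, x0; split=> // k x km.
  by apply: h2 => //; case/andP: km.
elim: M => [|M [B [Cst [x0 [B0 B1 C0 IH]]]]]; first by exists 1, 1, 0%N; split.
have [kM|kM] := boolP (0 < M < m)%N; last first.
  exists B, Cst, x0; split=> // k x km; rewrite ltnS leq_eqVlt => /orP[/eqP kE|kM'].
    by move: kM; rewrite -kE km.
  exact: IH.
have wM1 : cabs (w ^+ M) = 1 by rewrite cabsX w1 expr1n.
have wMm : (w ^+ M) ^+ m = 1 by rewrite exprAC wm expr1n.
have [B' [Cst' [x0' [B0' B1' C0' h']]]] := mean_value m0 wM1 wMm (wn1 M kM).
pose x1 := (Num.truncn (expR 1 : R)).+1.
exists (Num.min B B'), (Cst + Cst'), (maxn x1 (maxn x0 x0')); split.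
- by rewrite lt_min B0.
- by rewrite ge_min B1.
- exact: addr_gt0.
move=> k x km kM'; rewrite !geq_max => /andP[xx1 /andP[xx0 xx0']].
have x0R : 0 < x%:R :> R by rewrite ltr0n (leq_trans _ xx1).
have l1 : 1 <= ln x%:R :> R.
  by rewrite -ler_expR lnK ?posrE// (le_trans (ltW (truncnS_gt _)))// ler_nat.
have comb (b c : R) : Num.min B B' <= b -> 0 <= c -> c <= Cst + Cst' ->
   c * x%:R * ln x%:R `^ (- b) <= (Cst + Cst') * x%:R * ln x%:R `^ (- Num.min B B').
  move=> bb c0 cc; rewrite ler_pM ?mulr_ge0 ?powR_ge0// ?ler_wpM2r//.
  by apply: ler_powR => //; rewrite lerN2.
move: kM'; rewrite ltnS leq_eqVlt => /orP[/eqP kE|kM'].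
  rewrite kE (le_trans (h' x xx0'))// comb ?ge_min ?lexx ?orbT ?(ltW C0')//.
  by rewrite lerDr ltW.
by rewrite (le_trans (IH k x km kM' xx0))// comb ?ge_min ?lexx ?(ltW C0)// lerDl ltW.
Qed.

End MeanValue.

(** * Roots of unity and residue classes *)

Section RootsFilter.
Variable R : realType.
Local Notation C := R[i].

Lemma cis_roots (m : nat) : (0 < m)%N ->
  m.-primitive_root (cis (pi *+ 2 / m%:R : R)).
Proof.
move=> m0; set t := pi *+ 2 / m%:R.
have mR : m%:R != 0 :> R by rewrite pnatr_eq0 -lt0n.
apply/andP; split=> //; apply/forallP => i; rewrite unity_rootE cisX.
have eE : t *+ i.+1 = i.+1%:R * t by rewrite -mulr_natl.
have [im|im] := eqVneq i.+1 m.
  rewrite eqb_id eE im /t mulrCA divff// mulr1 /cis.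
  have := cos_2pi_nat R 1; rewrite mul1r => ->.
  by have := sin_pi_nat R 2; rewrite mulr_natl => ->.
rewrite eqbF_neg; apply/negP => /eqP[h _].
have ilt : (i.+1 < m)%N by rewrite ltn_neqAle im ltn_ord.
have : 0 < sin (t *+ i.+1 / 2).
  have -> : t *+ i.+1 / 2 = i.+1%:R / m%:R * pi by rewrite eE /t; field.
  rewrite sin_gt0_pi// mulr_gt0 ?divr_gt0 ?pi_gt0 ?ltr0n//=.
  by rewrite gtr_pMl ?pi_gt0// ltr_pdivrMr ?ltr0n// mul1r ltr_nat.
move=> sp; have : cos (t *+ i.+1 / 2 *+ 2) = 1 by rewrite -mulr_natr divfK.
rewrite cos_mulr2n cos2sin2 => h2.
have : 0 < sin (t *+ i.+1 / 2) ^+ 2 by rewrite exprn_gt0.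
by move: h2; lra.
Qed.

Lemma sum_powers_root (u : C) (m : nat) : u ^+ m = 1 ->
  \sum_(k < m) u ^+ k = if u == 1 then m%:R else 0.
Proof.
move=> um; case: eqP => [->|/eqP u1].
  by rewrite (eq_bigr (fun=> 1)) => [|i _]; rewrite ?expr1n// sumr_const card_ord.
have := subrX1 u m; rewrite um subrr => /esym/eqP.
by rewrite mulf_eq0 subr_eq0 (negPf u1) => /eqP.
Qed.

Definition residue_count (m j n : nat) : R :=
  \sum_(1 <= k < n.+1) (prime_Omega k == j %[mod m])%:R.

(** Orthogonality of the characters of the integers modulo [m]. *)
Lemma residue_count_psum (w : C) (m j n : nat) : m.-primitive_root w ->
  rc (m%:R * residue_count m j n) =
  \sum_(i < m) (w ^+ j)^-1 ^+ i * psum (powOmega (w ^+ i)) n.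
Proof.
move=> wP; have wm := prim_expr_order wP.
have w0 : w != 0.
  by apply/eqP => w0; move: (prim_order_gt0 wP) wm; rewrite w0 expr0n => /gtn_eqF -> /eqP; rewrite eq_sym oner_eq0.
under eq_bigr do rewrite /psum mulr_sumr.
rewrite exchange_big/= /residue_count mulr_sumr /rc rmorph_sum/=.
apply: eq_bigr => k _; set a := prime_Omega k.
rewrite (eq_bigr (fun i : 'I_m => (w ^+ a / w ^+ j) ^+ i)); last first.
  by move=> i _; rewrite /powOmega -/a exprMn exprAC mulrC.
rewrite sum_powers_root; last by rewrite exprMn -exprVn exprAC wm expr1n mul1r exprAC exprVn wm invr1 expr1n.
rewrite -(eq_prim_root_expr wP).
have -> : (w ^+ a / w ^+ j == 1) = (w ^+ a == w ^+ j).
  by rewrite -[1](@divff _ (w ^+ j)) ?expf_neq0// (inj_eq (mulIf _))// invr_neq0// expf_neq0.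
by case: eqP => _; rewrite ?mulr1 ?mulr0 ?rmorph0// rmorph_nat.
Qed.

Lemma residue_count_asymp (m j : nat) : (0 < m)%N ->
  exists B Cst : R, exists x0 : nat, [/\ 0 < B, B <= 1, 0 < Cst &
    forall n, (x0 <= n)%N ->
      `|residue_count m j n - n%:R / m%:R| <= Cst * n%:R * ln n%:R `^ (- B)].
Proof.
move=> m0; have wP := cis_roots m0; set w := cis _ in wP.
have mR : 0 < m%:R :> R by rewrite ltr0n.
have w1 : cabs w = 1 by exact: cabs_cis.
have wn1 k : (0 < k < m)%N -> w ^+ k != 1.
  move=> /andP[k0 km]; rewrite -[1](expr0 w) (eq_prim_root_expr wP) mod0n modn_small//.
  by rewrite -lt0n.
have [B [Cst [x0 [B0 B1 C0 h]]]] := mean_value_roots m0 w1 (prim_expr_order wP) wn1.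
exists B, Cst, x0; split=> // n xn.
rewrite -(ler_pM2l mR) -[X in X * `|_|](ger0_norm (ltW mR)) -normrM mulrBr.
have -> : m%:R * (n%:R / m%:R) = n%:R :> R by rewrite mulrC divfK ?gt_eqF.
have -> (x : R) : `|x| = cabs (rc x) by rewrite cabs_rc.
rewrite rcB (residue_count_psum j n wP); case: m m0 {mR} @w wP w1 wn1 h => [//|m] _ w wP w1 wn1 h.
rewrite big_ord_recl expr0 mul1r.
have -> : psum (powOmega (w ^+ @ord0 m)) n = rc n%:R.
  rewrite /psum (eq_bigr (fun=> 1)) => [|k _]; last by rewrite /powOmega/= expr0 expr1n.
  by rewrite big_const_nat iter_addr_0 subSS subn0 /rc rmorph_nat.
rewrite addrAC subrr add0r (le_trans (ler_cabs_sum _ _ _))//.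
set b := Cst * _ * _.
rewrite (@le_trans _ _ (\sum_(i < m) b))//.
  apply: ler_sum => i _; rewrite cabsM cabsX cabsV cabsX w1 !expr1n invr1 expr1n mul1r.
  by rewrite h// ltn_ord.
rewrite sumr_const card_ord -[leLHS]mulr_natl ler_wpM2r ?ler_nat//.
by rewrite !mulr_ge0 ?powR_ge0 ?(ltW C0).
Qed.

Lemma count_le_residue (m j : nat) (x : R) : 0 <= x ->
  (count_le (Omega_class m j) x)%:R = residue_count m j (Num.truncn x).
Proof.
move=> x0; rewrite /count_le; set n := Num.truncn x.
pose s := [seq k <- index_iota 1 n.+1 | prime_Omega k == j %[mod m]].
have -> : [set k : nat | [/\ (0 < k)%N, k%:R <= x & Omega_class m j k]]
    = [set` [fset k in s]%fset].
  apply/seteqP; split=> k /=; rewrite !inE mem_filter mem_index_iota ltnS truncn_ge_nat//.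
    by move=> [-> -> /eqP ->].
  by case/andP => /eqP h /andP[-> ->]; split.
rewrite set_fsetK card_fseq undup_id ?filter_uniq ?iota_uniq// size_filter -sum1_count.
by rewrite natr_sum /residue_count big_mkcond/=; apply: eq_bigr => k _; case: ifP.
Qed.

(** Passing from [x] to its integer part changes [x / m] by at most 1, which is below
    [x / ln x ^ B] as [B <= 1], and [ln x <= 2 * ln (truncn x)]. *)
Lemma count_le_asymp (m j : nat) : (0 < m)%N ->
  exists B Cst X0 : R, [/\ 0 < B, 0 < Cst, expR 1 <= X0 & forall x, X0 <= x ->
    `|(count_le (Omega_class m j) x)%:R - x / m%:R| <= Cst * (x / ln x `^ B)].
Proof.
move=> m0; have [B [Cst [x0 [B0 B1 C0 h]]]] := residue_count_asymp j m0.
have mR : 0 < m%:R :> R by rewrite ltr0n.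
exists B, (2 * Cst + 1), (expR 1 + 4 + x0%:R); split=> //; [by rewrite addr_gt0// mulr_gt0|by rewrite -addrA lerDl|].
move=> x xx; have x4 : 4 <= x by move: xx (expR_ge0 (1 : R)) (ler0n R x0); lra.
have xe : expR 1 <= x by move: xx (ler0n R x0); lra.
have xp : 0 < x by rewrite (lt_le_trans _ x4).
have l1 : 1 <= ln x by rewrite -ler_expR lnK.
have l0 : 0 < ln x by rewrite (lt_le_trans _ l1).
rewrite count_le_residue ?(ltW xp)//; set n := Num.truncn x.
have nx : n%:R <= x by rewrite /n; case/andP: (truncn_itv (ltW xp)).
have xn : x < n.+1%:R by rewrite /n; case/andP: (truncn_itv (ltW xp)).
have xn' : x < n%:R + 1 by rewrite natr1.
have n0 : 0 < n%:R :> R by move: x4 xn'; lra.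
have hn : `|residue_count m j n - n%:R / m%:R| <= Cst * n%:R * ln n%:R `^ (- B).
  by apply: h; rewrite truncn_ge_nat ?(ltW xp)//; move: xx (expR_ge0 (1 : R)); lra.
have lnn : ln x <= 2 * ln n%:R.
  have -> : 2 * ln n%:R = ln (n%:R ^+ 2) :> R by rewrite lnXn// mulr_natl.
  rewrite ler_ln ?posrE ?exprn_gt0// (le_trans (ltW xn'))//.
  have : 3 <= n%:R :> R by move: x4 xn'; lra.
  by move=> n3; rewrite expr2; nra.
have ln0 : 0 < ln n%:R :> R by move: lnn l0; lra.
have hp : ln n%:R `^ (- B) <= 2 * (ln x `^ B)^-1.
  rewrite powRN -ler_pdivrMl// -invfM lef_pV2 ?posrE ?mulr_gt0 ?powR_gt0//.
  rewrite (@le_trans _ _ ((2 * ln n%:R) `^ B))//.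
    by rewrite ge0_ler_powR ?nnegrE ?(ltW B0) ?(ltW l0) ?mulr_ge0 ?(ltW ln0).
  rewrite powRM ?(ltW ln0)// ler_wpM2r ?powR_ge0//.
  by rewrite -[leRHS](powRr1 (ler0n R 2)) ler_powR// ler1n.
have one : 1 <= x / ln x `^ B.
  rewrite ler_pdivlMr ?powR_gt0// mul1r (@le_trans _ _ (ln x))//.
    by rewrite -[leRHS](powRr1 (ltW l0)) ler_powR.
  by have := @le_ln1Dx R (x - 1); rewrite [1 + _]addrC subrK => h'; rewrite (le_trans (h' _))//; move: x4; lra.
have -> : residue_count m j n - x / m%:R =
    (residue_count m j n - n%:R / m%:R) - (x - n%:R) / m%:R by field; rewrite gt_eqF.
rewrite (le_trans (ler_normB _ _))// [leRHS]mulrDl [X in _ <= _ + X]mul1r lerD//.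
  rewrite (le_trans hn)// (@le_trans _ _ (Cst * x * (2 * (ln x `^ B)^-1)))//.
    by rewrite ler_pM ?mulr_ge0 ?powR_ge0 ?(ltW C0) ?(ltW n0)// ler_wpM2l ?(ltW C0).
  by rewrite le_eqVlt; apply/orP; left; apply/eqP; ring.
rewrite (le_trans _ one)// normrM ger0_norm ?subr_ge0// ger0_norm ?invr_ge0//.
rewrite ler_pdivrMr// mul1r (@le_trans _ _ 1) ?ler1n//.
by move: xn'; lra.
Qed.

End RootsFilter.

Theorem theorem1p1 (R : realType) (m j : nat) (m_gt0 : (0 < m)%N)
    (j_lt_m : (j < m)%N) :
  has_natural_density (Omega_class m j) (m%:R^-1 : R) /\
  exists2 A : R, 0 < A &
    (fun x : R => (count_le (Omega_class m j) x)%:R - x / m%:R : R)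
      =O_ +oo (fun x : R => x / ln x `^ A : R).
Proof.
have [B [Cst [X0 [B0 C0 X0e h]]]] := count_le_asymp R j m_gt0.
split; last first.
  exists B => //; apply/eqO_exP; exists Cst => //.
  near=> x; have xX : X0 <= x by near: x; apply: nbhs_pinfty_ge; rewrite num_real.
  rewrite (le_trans (h x xX))// ler_wpM2l ?(ltW C0)//.
  exact: ler_norm.
rewrite /has_natural_density; apply/cvgrPdist_le => e e0.
pose K := expR ((Cst / e) `^ B^-1).
near=> x.
have xX : X0 <= x by near: x; apply: nbhs_pinfty_ge; rewrite num_real.
have xK : K <= x by near: x; apply: nbhs_pinfty_ge; rewrite num_real.
have xp : 0 < x by rewrite (lt_le_trans (expR_gt0 1))// (le_trans X0e).
have lx : 0 < ln x.
  by rewrite (@lt_le_trans _ _ 1)// -ler_expR lnK ?posrE// (le_trans X0e).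
rewrite distrC.
have -> : x^-1 * (count_le (Omega_class m j) x)%:R - m%:R^-1 =
   x^-1 * ((count_le (Omega_class m j) x)%:R - x / m%:R).
  by rewrite mulrBr mulrA mulVf ?mul1r// gt_eqF.
rewrite normrM gtr0_norm ?invr_gt0// mulrC ler_pdivrMr// (le_trans (h x xX))//.
rewrite mulrA -mulrA mulrCA [leRHS]mulrC ler_wpM2l ?(ltW xp)//.
rewrite ler_pdivrMr ?powR_gt0// mulrC -ler_pdivrMr//.
have -> : Cst / e = ((Cst / e) `^ B^-1) `^ B.
  by rewrite -powRrM mulVf ?gt_eqF// powRr1// divr_ge0 ?ltW.
rewrite ge0_ler_powR ?nnegrE ?powR_ge0 ?(ltW B0) ?(ltW lx)//.
by rewrite -ler_expR lnK ?posrE.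
Unshelve. all: by end_near.
Qed.
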